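(* Let $X$ be an infinite-dimensional complex Banach space and $T\in L(X)$. The following conditions are equivalent: (i) there exists a pair $(M,N)$ of closed $T$-invariant subspaces with $X=M\oplus N$ such that $T_M$ is surjective and $T_N$ is Riesz; (ii) $T$ admits a GKRD and $0\notin\operatorname{int}\sigma_{su}(T)$; (iii) $T$ admits a GKRD and the adjoint $T'$ has the SVEP at $0$; (iv) there exists a pair $(M,N)$ of closed $T$-invariant subspaces with $X=M\oplus N$ such that $T_M$ is lower semi-Browder and $T_N$ is Riesz; (v) $T$ admits a GKRD and $0\notin\operatorname{acc}\sigma_{\mathcal B_-}(T)$; (vi) $T$ admits a GKRD and $0\notin\operatorname{int}\sigma_{\mathcal B_-}(T)$; (vii) there exists a bounded projection $P$ on $X$ commuting with $T$ such that $T+P$ is lower semi-Browder and $TP$ is Riesz.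
   Context: $L(X)$ is the algebra of bounded operators on $X$. $S$ is Kato if $R(S)$ is closed and $N(S)\subset R(S^n)$ for all $n\in\mathbb N$. $S$ is Riesz if $S-\lambda$ is Fredholm for all $\lambda\ne0$. $S$ is lower semi-Fredholm if $\operatorname{codim}R(S)<\infty$, and lower semi-Browder if moreover it has finite descent. For closed $T$-invariant $M,N$ with $X=M\oplus N$, $T_M,T_N$ are the restrictions; $T$ admits a GKRD if there is such a pair with $T_M$ Kato and $T_N$ Riesz. $\sigma_{su}(T)=\{\lambda: T-\lambda \text{ not surjective}\}$, $\sigma_{\mathcal B_-}(T)=\{\lambda: T-\lambda\text{ not lower semi-Browder}\}$; $\operatorname{int}$, $\operatorname{acc}$ denote interior and accumulation points. An operator $S$ on a Banach space $Y$ has the SVEP at $\lambda_0$ if for every open disc $D$ centered at $\lambda_0$ the only analytic $f:D\to Y$ with $(S-\lambda)f(\lambda)=0$ on $D$ is $f\equiv0$. *)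

(* Defs.v *)
From HB Require Import structures.
From mathcomp Require Import all_boot all_order all_algebra.
From mathcomp Require Import all_classical all_reals all_analysis.
From mathcomp Require Import complex.
Import numFieldNormedType.Exports.
Set Implicit Arguments. Unset Strict Implicit. Unset Printing Implicit Defensive.
Import Order.TTheory GRing.Theory Num.Theory.
Local Open Scope classical_set_scope.
Local Open Scope ring_scope.

Section OperatorTheory.
Context {R : realType} {X : completeNormedModType R[i]}.

Definition bounded_op (S : X -> X) : Prop :=
  (forall (a : R[i]) (x y : X), S (a *: x + y) = a *: S x + S y) /\ continuous S.

Definition shift (S : X -> X) (l : R[i]) : X -> X := fun x => S x - l *: x.

Definition subspace (M : set X) : Prop :=
  M 0 /\ forall (a : R[i]) x y, M x -> M y -> M (a *: x + y).

Definition span (s : seq X) : set X :=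
  [set x | exists c : nat -> R[i], x = \sum_(i < size s) c i *: nth 0 s i].

(* V is contained in a finite-dimensional subspace, i.e. V (a subspace) is finite-dimensional *)
Definition finite_dim (V : set X) : Prop := exists s : seq X, V `<=` span s.

(* the subspace Rg has finite codimension in the subspace W (Rg <= W) *)
Definition finite_codim_in (W Rg : set X) : Prop :=
  exists s : seq X, W `<=` [set x | exists r v, [/\ Rg r, span s v & x = r + v]].

Definition invariant (S : X -> X) (M : set X) : Prop := S @` M `<=` M.

Definition direct_sum (M N : set X) : Prop :=
  M `&` N = [set 0] /\ forall x, exists m n, M m /\ N n /\ x = m + n.

Definition reducing_pair (S : X -> X) (M N : set X) : Prop :=
  [/\ subspace M /\ subspace N, closed M /\ closed N,
      invariant S M, invariant S N & direct_sum M N].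

(* Properties of the restriction S_W of S to an S-invariant subspace W:
   kernel N(S_W) = ker_in W S, range R(S_W) = S @` W. *)
Definition ker_in (W : set X) (S : X -> X) : set X := [set x | W x /\ S x = 0].

Definition surjective_on (W : set X) (S : X -> X) : Prop := S @` W = W.

Definition fredholm_on (W : set X) (S : X -> X) : Prop :=
  finite_dim (ker_in W S) /\ finite_codim_in W (S @` W).

Definition riesz_on (W : set X) (S : X -> X) : Prop :=
  forall l : R[i], l != 0 -> fredholm_on W (shift S l).

Definition kato_on (W : set X) (S : X -> X) : Prop :=
  closed (S @` W) /\ forall n : nat, ker_in W S `<=` (iter n S) @` W.

Definition lower_semi_browder_on (W : set X) (S : X -> X) : Prop :=
  finite_codim_in W (S @` W) /\
  exists d : nat, (iter d S) @` W = (iter d.+1 S) @` W.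

Definition GKRD (T : X -> X) : Prop :=
  exists M N, reducing_pair T M N /\ kato_on M T /\ riesz_on N T.

Definition sigma_su (T : X -> X) : set R[i] :=
  [set l | ~ surjective_on setT (shift T l)].
Definition sigma_lsB (T : X -> X) : set R[i] :=
  [set l | ~ lower_semi_browder_on setT (shift T l)].

Definition int_pt (A : set R[i]) (z : R[i]) : Prop :=
  exists2 e : R[i], 0 < e & forall w, `|w - z| < e -> A w.
Definition acc_pt (A : set R[i]) (z : R[i]) : Prop :=
  forall e : R[i], 0 < e -> exists w, [/\ A w, w != z & `|w - z| < e].

Definition dual_elt (f : X -> R[i]) : Prop :=
  (forall (a : R[i]) (x y : X), f (a *: x + y) = a * f x + f y) /\
  exists2 K : R[i], 0 <= K & forall x, `|f x| <= K * `|x|.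

(* f : C -> X' is (complex-)analytic on the open disc D(z0, r), for the norm of X'
   ( ||phi|| = sup_{||x||<=1} |phi x| ): holomorphic at each point of the disc. *)
Definition dual_analytic_on (z0 r : R[i]) (f : R[i] -> X -> R[i]) : Prop :=
  (forall l, `|l - z0| < r -> dual_elt (f l)) /\
  forall l, `|l - z0| < r ->
    exists g : X -> R[i], dual_elt g /\
      forall e : R[i], 0 < e -> exists2 d : R[i], 0 < d &
        forall m, `|m - z0| < r -> `|m - l| < d ->
          forall x : X, `|f m x - f l x - (m - l) * g x| <= e * `|m - l| * `|x|.

Definition adjoint_SVEP_at (T : X -> X) (l0 : R[i]) : Prop :=
  forall r : R[i], 0 < r -> forall f : R[i] -> X -> R[i],
    dual_analytic_on l0 r f ->
    (forall l, `|l - l0| < r -> forall x, f l (T x) - l * f l x = 0) ->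
    forall l, `|l - l0| < r -> forall x, f l x = 0.

Definition infinite_dimensional : Prop := ~ finite_dim (@setT X).

End OperatorTheory.

(* Main.v *)
(* Put [X = M + N] with [T] Kato on [M] and Riesz on [N].  If [T M <> M], then a
   functional vanishing on [T M] but not on [M] extends, by Hahn-Banach and the
   open mapping theorem, to a power series [f] of functionals with
   [f l o T = l f l] on [M]: the Kato condition makes every coefficient vanish on
   the kernel of [T], so that the next one can be defined on [T M].  Such an [f]
   contradicts the SVEP of the adjoint at 0, and also forces [T - l] to have
   infinite descent on [M] for all small [l].
   The same construction, modulo the hyperkernel, shows that an operator with
   range of finite codimension which is a limit of surjective operators [T - l]
   has finite descent; conversely finite descent makes [T - l] surjective for
   small [l <> 0].  Following a ray from infinity, a Riesz operator therefore has
   finite descent at every [l <> 0] and is surjective at nearby points.  The SVEP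
   then follows from the identity theorem, and a lower semi-Browder operator
   splits as surjective plus nilpotent of finite rank because its stable range
   [T^d M] has an invariant finite-dimensional complement. *)
Require Import Defs.
From mathcomp Require Import all_boot all_order all_algebra.
From mathcomp Require Import all_classical all_reals all_analysis.
From mathcomp Require Import complex.
From mathcomp Require Import ring lra.
Import numFieldNormedType.Exports.
Set Implicit Arguments. Unset Strict Implicit. Unset Printing Implicit Defensive.
Import Order.TTheory GRing.Theory Num.Theory.
Local Open Scope classical_set_scope.
Local Open Scope ring_scope.
Import Defs.

(** The coefficients of [f] come from repeatedly solving g o S = f for a functional g. Each solution
    costs the same factor, the open mapping constant [C], so the coefficients grow at most like C^n
    and the series converges near 0. Solving is always done modulo a subspace [Z] (zero, the kernel
    of a power, or a finite-dimensional complement added to one of these). This is why the open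
    mapping theorem below concerns sums of an image and [Z], and bounds only the preimage. The
    descent arguments play two facts against each other: failure of finite descent at a point
    spreads to a full neighbourhood, while finite descent spreads to surjectivity on a punctured
    neighbourhood. For the SVEP, points with [T - l] surjective are known to be dense only in a disc
    whose radius is dictated by [M], whereas the analytic function lives on a disc of arbitrary
    radius. The identity theorem closes this gap. Since only vanishing is to be proved, its Cauchy
    estimate may lose a constant. The implications run (i), (v), (vi), (i); (ii) implies (vi) by
    inclusion of spectra. *)

Section RealNorm.
Context {R : realType}.

(** The norm has values in [R[i]], whose order is partial; the real version is accessible to [lra]
    and [nra]. *)
Definition nm (V : normedZmodType R[i]) (v : V) : R := complex.Re `|v|.

Lemma nmE (V : normedZmodType R[i]) (v : V) : `|v| = ((nm v)%:C)%C.
Proof. by rewrite /nm RRe_real // normr_real. Qed.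

Lemma nm_ge0 (V : normedZmodType R[i]) (v : V) : 0 <= nm v.
Proof. by rewrite -ler0c -nmE normr_ge0. Qed.

Lemma nm0 (V : normedZmodType R[i]) : nm (0 : V) = 0.
Proof. by rewrite /nm normr0. Qed.

Lemma nm_eq0 (V : normedZmodType R[i]) (v : V) : nm v = 0 -> v = 0.
Proof. by move=> h; apply/eqP; rewrite -normr_eq0 nmE h. Qed.

Lemma nm_gt0 (V : normedZmodType R[i]) (v : V) : v != 0 -> 0 < nm v.
Proof.
move=> h; rewrite lt_neqAle nm_ge0 andbT; apply/negP => /eqP e.
by move: h; rewrite (nm_eq0 (esym e)) eqxx.
Qed.

Lemma nmN (V : normedZmodType R[i]) (v : V) : nm (- v) = nm v.
Proof. by rewrite /nm normrN. Qed.

Lemma nmBC (V : normedZmodType R[i]) (u v : V) : nm (u - v) = nm (v - u).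
Proof. by rewrite -nmN opprB. Qed.

Lemma nmD (V : normedZmodType R[i]) (u v : V) : nm (u + v) <= nm u + nm v.
Proof. by rewrite -lecR rmorphD /= -!nmE ler_normD. Qed.

Lemma nmB (V : normedZmodType R[i]) (u v : V) : nm (u - v) <= nm u + nm v.
Proof. by rewrite -(nmN v) nmD. Qed.

Lemma nm_tri (V : normedZmodType R[i]) (w u v : V) :
  nm (u - v) <= nm (u - w) + nm (w - v).
Proof. by rewrite -[X in nm X](subrKA w) nmD. Qed.

Lemma nmZ (X : normedModType R[i]) (a : R[i]) (x : X) :
  nm (a *: x) = nm a * nm x.
Proof. by apply: complexI; rewrite rmorphM /= -!nmE normrZ. Qed.

Lemma nmM (a b : R[i]) : nm (a * b) = nm a * nm b.
Proof. by apply: complexI; rewrite rmorphM /= -!nmE normrM. Qed.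

Lemma nmR (t : R) : nm (t%:C)%C = `|t|.
Proof. by rewrite /nm normc_def /= expr0n /= addr0 sqrtr_sqr. Qed.

Lemma nm1 : nm (1 : R[i]) = 1.
Proof. by rewrite /nm normr1. Qed.

Lemma nmX (a : R[i]) n : nm (a ^+ n) = nm a ^+ n.
Proof. by elim: n => [|n IH]; rewrite ?expr0 ?nm1 // !exprS nmM IH. Qed.

Lemma nmV (a : R[i]) : nm a^-1 = (nm a)^-1.
Proof. by apply: complexI; rewrite fmorphV /= -!nmE normfV. Qed.

Lemma nm_lt (V : normedZmodType R[i]) (v : V) (e : R) :
  (`|v| < (e%:C)%C) = (nm v < e).
Proof. by rewrite nmE ltcR. Qed.

Lemma nm_le (V : normedZmodType R[i]) (v : V) (e : R) :
  (`|v| <= (e%:C)%C) = (nm v <= e).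
Proof. by rewrite nmE lecR. Qed.

Lemma posC (e : R[i]) : 0 < e -> exists2 d : R, 0 < d & e = (d%:C)%C.
Proof.
move=> e0; exists (complex.Re e); last by rewrite RRe_real // gtr0_real.
by move: e0; rewrite ltcE => /andP[].
Qed.

Lemma Re_le_nm (z : R[i]) : `|complex.Re z| <= nm z.
Proof. by rewrite -lecR -nmE normc_ge_Re. Qed.

Lemma Im_le_nm (z : R[i]) : `|complex.Im z| <= nm z.
Proof.
rewrite -lecR -nmE normc_def lecR -sqrtr_sqr; apply: ler_wsqrtr.
by rewrite lerDr sqr_ge0.
Qed.

Lemma nm_le_ReIm (z : R[i]) : nm z <= `|complex.Re z| + `|complex.Im z|.
Proof.
case: z => x y /=; have -> : (x +i* y)%C = (x%:C + 'i * y%:C)%C.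
  by rewrite [LHS]complexE.
apply: le_trans (nmD _ _) _; rewrite nmM !nmR.
by rewrite /nm normc_def /= expr0n expr1n add0r sqrtr1 mul1r.
Qed.

Lemma pow2_small (K e : R) : 0 < e -> exists N : nat, K / 2 ^+ N < e.
Proof.
move=> e0; have [N hN] : exists N : nat, `|K| / e < N%:R.
  by exists (Num.truncn (`|K| / e)).+1; rewrite truncnS_gt.
exists N; rewrite ltr_pdivrMr ?exprn_gt0 //.
have h2 : N%:R <= 2 ^+ N :> R by rewrite -natrX ler_nat ltnW // ltn_expl.
have : `|K| < e * N%:R by rewrite mulrC -ltr_pdivrMr.
have := ler_norm K; have : e * N%:R <= e * 2 ^+ N by rewrite ler_pM2l.
lra.
Qed.

Lemma le_all_eps (x y : R) : (forall e, 0 < e -> x <= y + e) -> x <= y.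
Proof. by move=> h; apply/ler_addgt0Pr => e /h. Qed.

End RealNorm.

(** * Sums of geometrically dominated series *)

Lemma cauchy_limit (K : numFieldType) (V : completeNormedModType K)
    (U : nat -> V) (b : nat -> K) :
  (forall n m, (n <= m)%N -> `|U m - U n| <= b n) ->
  (forall e, 0 < e -> exists N : nat, b N < e) ->
  exists s, forall n, `|s - U n| <= b n.
Proof.
move=> hU hb.
have cU : cvg (U @ \oo).
  apply: cauchy_cvg; apply: cauchy_exP => e e0; have [N hN] := hb _ e0.
  exists (U N); exists N => //= m /= Nm; rewrite -ball_normE /ball_ /= distrC.
  by apply: le_lt_trans hN; exact: hU.
exists (lim (U @ \oo)) => n; apply/ler_addgt0Pr => e e0.
have /cvgrPdist_lt /(_ e e0) [N _ hN] := cU.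
have h1 := hN (maxn N n) (leq_maxl _ _).
have h2 := hU n (maxn N n) (leq_maxr _ _).
rewrite -(subrKA (U (maxn N n))); apply: le_trans (ler_normD _ _) _.
by rewrite addrC; apply: lerD => //; exact: ltW.
Qed.

(** Kept over an arbitrary numerical field because it is applied both over [R] and over [R[i]]. *)
Lemma geometric_limit (K : numFieldType) (V : completeNormedModType K)
    (u : nat -> V) (B : K) :
  (forall n, `|u n| <= B / 2 ^+ n) ->
  (forall e, 0 < e -> exists N : nat, 2 * B / 2 ^+ N < e) ->
  exists s, forall n, `|s - \sum_(i < n) u i| <= 2 * B / 2 ^+ n.
Proof.
move=> hu hB; apply: cauchy_limit hB => n m /subnK <-.
have B0 : 0 <= B by have := hu 0%N; rewrite expr0 divr1; apply: le_trans.
set U := fun m => \sum_(i < m) u i; rewrite -/(U _) -/(U _).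
(* The bound is sharpened to a difference of two tails, so that the induction on [m - n]
   telescopes. *)
suff: `|U (m - n + n)%N - U n| <= 2 * B / 2 ^+ n - 2 * B / 2 ^+ (m - n + n).
  move/le_trans; apply; rewrite gerBl divr_ge0 ?mulr_ge0 ?exprn_ge0 //.
elim: (m - n)%N => [|k IH]; first by rewrite !subrr normr0.
rewrite addSn /U big_ord_recr /= -/(U _) addrAC.
apply: le_trans (ler_normD _ _) _; apply: le_trans (lerD IH (hu _)) _.
rewrite le_eqVlt; apply/orP; left; apply/eqP; rewrite exprS.
have h : (2 : K) ^+ (k + n) != 0 by rewrite expf_neq0 // pnatr_eq0.
have h' : (2 : K) ^+ n != 0 by rewrite expf_neq0 // pnatr_eq0.
by field; rewrite h h'.
Qed.

Section Geometric.
Context {R : realType}.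

Lemma geometricX (X : completeNormedModType R[i]) (u : nat -> X) (B : R) :
  (forall n, nm (u n) <= B / 2 ^+ n) ->
  exists s, forall n, nm (s - \sum_(i < n) u i) <= 2 * B / 2 ^+ n.
Proof.
have cE n : ((B / 2 ^+ n)%:C)%C = (B%:C)%C / 2 ^+ n :> R[i].
  by rewrite rmorphM fmorphV rmorphXn /= rmorph_nat.
have c2E n : ((2 * B / 2 ^+ n)%:C)%C = 2 * (B%:C)%C / 2 ^+ n :> R[i].
  by rewrite rmorphM fmorphV rmorphXn rmorphM /= !rmorph_nat.
move=> hu; have [|e /posC [d d0 ->]|s hs] := @geometric_limit _ _ u (B%:C)%C.
- by move=> n; rewrite -cE nm_le.
- by have [N hN] := pow2_small (2 * B) d0; exists N; rewrite -c2E ltcR.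
by exists s => n; rewrite -nm_le c2E.
Qed.

Lemma geometricR (u : nat -> R) (B : R) :
  (forall n, `|u n| <= B / 2 ^+ n) ->
  exists s, forall n, `|s - \sum_(i < n) u i| <= 2 * B / 2 ^+ n.
Proof.
move=> hu; apply: (@geometric_limit R R^o u B) hu _ => e.
exact: pow2_small.
Qed.

(** Real and imaginary parts are summed separately, each with factor 2; hence the factor 4. *)
Lemma geometricC (u : nat -> R[i]) (B : R) :
  (forall n, nm (u n) <= B / 2 ^+ n) ->
  exists s, forall n, nm (s - \sum_(i < n) u i) <= 4 * B / 2 ^+ n.
Proof.
move=> hu.
have [n|x hx] := @geometricR (fun n => complex.Re (u n)) B.
  exact: le_trans (Re_le_nm _) (hu n).
have [n|y hy] := @geometricR (fun n => complex.Im (u n)) B.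
  exact: le_trans (Im_le_nm _) (hu n).
exists (x +i* y)%C => n; apply: le_trans (nm_le_ReIm _) _.
have -> : complex.Re ((x +i* y)%C - \sum_(i < n) u i)
  = x - \sum_(i < n) complex.Re (u i) by rewrite raddfB /= raddf_sum.
have -> : complex.Im ((x +i* y)%C - \sum_(i < n) u i)
  = y - \sum_(i < n) complex.Im (u i) by rewrite raddfB /= raddf_sum.
have := hx n; have := hy n; have -> : 4 * B / 2 ^+ n = 2 * B / 2 ^+ n + 2 * B / 2 ^+ n by ring.
lra.
Qed.

End Geometric.

(** * Equations between linear combinations *)

Section LinearCombinations.
Context {K : comPzRingType} {V : lmodType K}.

(** Syntax for a proof by reflection: vectors become indices into an environment, and an equation in
    the module reduces to one scalar equation per index. *)
Inductive lexp :=
  LVar of nat | LZero | LAdd of lexp & lexp | LOpp of lexp | LScale of K & lexp.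

Fixpoint leval (env : seq V) e := match e with
  | LVar n => nth 0 env n
  | LZero => 0
  | LAdd a b => leval env a + leval env b
  | LOpp a => - leval env a
  | LScale k a => k *: leval env a
  end.

Fixpoint lcoef e (i : nat) : K := match e with
  | LVar n => if n == i then 1 else 0
  | LZero => 0
  | LAdd a b => lcoef a i + lcoef b i
  | LOpp a => - lcoef a i
  | LScale k a => k * lcoef a i
  end.

Fixpoint lbound (n : nat) e := match e with
  | LVar m => (m < n)%N
  | LZero => true
  | LAdd a b => lbound n a && lbound n b
  | LOpp a => lbound n a
  | LScale k a => lbound n a
  end.

Fixpoint lsum (env : seq V) (c : nat -> K) : V :=
  if env is v :: env' then c 0%N *: v + lsum env' (fun i => c i.+1) else 0.

Lemma lsumE (env : seq V) c : lsum env c = \sum_(i < size env) c i *: nth 0 env i.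
Proof.
elim: env c => [|v env IH] c /=; first by rewrite big_ord0.
by rewrite big_ord_recl IH.
Qed.

Lemma leval_sum env e : lbound (size env) e -> leval env e = lsum env (lcoef e).
Proof.
rewrite lsumE; elim: e => [n|| a IHa b IHb|a IHa|k a IHa] /=.
- move=> hn; rewrite (bigD1 (Ordinal hn)) //= eqxx scale1r big1 ?addr0 // => i.
  by rewrite -val_eqE /= eq_sym => /negPf ->; rewrite scale0r.
- by rewrite big1 // => i _; rewrite scale0r.
- move=> /andP [/IHa -> /IHb ->]; rewrite -big_split /=.
  by apply: eq_bigr => i _; rewrite scalerDl.
- move=> /IHa ->; rewrite -sumrN; by apply: eq_bigr => i _; rewrite scaleNr.
- move=> /IHa ->; rewrite scaler_sumr; by apply: eq_bigr => i _; rewrite scalerA.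
Qed.

(** On a concrete environment this unfolds to a finite conjunction, which [repeat split] turns into
    goals for [ring]. *)
Fixpoint lsame (n : nat) (c d : nat -> K) : Prop :=
  if n is m.+1 then c 0%N = d 0%N /\ lsame m (fun i => c i.+1) (fun i => d i.+1)
  else True.

Lemma lsum_same env c d : lsame (size env) c d -> lsum env c = lsum env d.
Proof.
by elim: env c d => [|v env IH] c d //= [-> /IH ->].
Qed.

Lemma leval_eq env a b : lbound (size env) a && lbound (size env) b ->
  lsame (size env) (lcoef a) (lcoef b) -> leval env a = leval env b.
Proof. by move=> /andP [ha hb] h; rewrite !leval_sum // (lsum_same h). Qed.

End LinearCombinations.

Ltac lm_add x l := match l with
  | x :: _ => l
  | ?y :: ?t => let t' := lm_add x t in constr:(y :: t')
  | _ => constr:(x :: l)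
  end.
Ltac lm_idx x l := match l with
  | x :: _ => constr:(0%N)
  | _ :: ?t => let n := lm_idx x t in constr:(S n)
  end.
Ltac lm_env t l := match t with
  | ?a + ?b => let l1 := lm_env a l in lm_env b l1
  | - ?a => lm_env a l
  | _ *: ?a => lm_env a l
  | 0 => l
  | _ => lm_add t l
  end.
Ltac lm_reify K t l := match t with
  | ?a + ?b => let x := lm_reify K a l in let y := lm_reify K b l in constr:(@LAdd K x y)
  | - ?a => let x := lm_reify K a l in constr:(@LOpp K x)
  | ?k *: ?a => let x := lm_reify K a l in constr:(@LScale K k x)
  | 0 => constr:(@LZero K)
  | _ => let n := lm_idx t l in constr:(@LVar K n)
  end.

(* Reduces an equation between linear combinations to equations between the
   coefficients. *)
Ltac lmod_split K := match goal with |- ?a = ?b :> ?V =>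
  let l0 := constr:(@nil V) in let l1 := lm_env a l0 in let l := lm_env b l1 in
  let x := lm_reify K a l in let y := lm_reify K b l in
  refine (@leval_eq K _ l x y _ _); [done | cbn -[GRing.add GRing.mul GRing.opp GRing.zero GRing.one GRing.inv]; repeat split] end.
Ltac lmod K := lmod_split K; try ring.


(** * Operators, open mapping, Hahn-Banach and eigenfunctionals *)

Section Operators.
Context {R : realType} {X : completeNormedModType R[i]}.
Implicit Types (S T : X -> X) (M N Z V W : set X).

(** * Linear and bounded maps, subspaces and spans *)

Definition lin S := forall (a : R[i]) x y, S (a *: x + y) = a *: S x + S y.

Definition bop S := lin S /\ exists2 K : R, 0 < K & forall x, nm (S x) <= K * nm x.

Lemma linD S : lin S -> forall x y, S (x + y) = S x + S y.
Proof. by move=> h x y; have := h 1 x y; rewrite !scale1r. Qed.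

Lemma lin0 S : lin S -> S 0 = 0.
Proof.
by move=> h; have := linD h 0 0; rewrite addr0 => h0; apply: (addrI (S 0)); rewrite -h0 addr0.
Qed.

Lemma linZ S : lin S -> forall (a : R[i]) x, S (a *: x) = a *: S x.
Proof. by move=> h a x; have := h a x 0; rewrite (lin0 h) !addr0. Qed.

Lemma linN S : lin S -> forall x, S (- x) = - S x.
Proof. by move=> h x; rewrite -scaleN1r (linZ h) scaleN1r. Qed.

Lemma linB S : lin S -> forall x y, S (x - y) = S x - S y.
Proof. by move=> h x y; rewrite (linD h) (linN h). Qed.

Lemma lin_sum S n (u : nat -> X) : lin S ->
  S (\sum_(i < n) u i) = \sum_(i < n) S (u i).
Proof.
move=> h; elim: n => [|n IH]; first by rewrite !big_ord0 (lin0 h).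
by rewrite !big_ord_recr /= (linD h) IH.
Qed.

Lemma bopP S : bounded_op S <-> bop S.
Proof.
split=> [[lS cS]|[lS [K K0 hK]]]; split=> //.
  have /cvgrPdist_lt /(_ 1 ltr01) /nbhs_ballP [e /posC [d d0 ->] he] := cS 0.
  (* Continuity at 0 gives norm below 1 on the ball of radius [d]; every nonzero [x] is scaled to
     norm [d / 2]. *)
  exists (2 / d); first by rewrite divr_gt0.
  move=> x; have [->|x0] := eqVneq x 0; first by rewrite (lin0 lS) !nm0 mulr0.
  have nx := nm_gt0 x0.
  have t0 : 0 < d / 2 / nm x by rewrite !divr_gt0.
  have := he (((d / 2 / nm x)%:C)%C *: x).
  rewrite -ball_normE /ball_ /= (lin0 lS) !sub0r !normrN -(rmorph1 (real_complex R)) !nm_lt.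
  rewrite (linZ lS) !nmZ nmR gtr0_norm // divfK ?gt_eqF // => h.
  have {h} : d / 2 / nm x * nm (S x) < 1 by apply: h; lra.
  rewrite mulrAC ltr_pdivrMr // mul1r => h.
  rewrite mulrAC ler_pdivlMr //; lra.
move=> x; apply/cvgrPdist_lt => e /posC [d d0 ->].
apply/nbhs_ballP; exists (((d / K)%:C)%C); first by rewrite /= -(rmorph0 (real_complex R)) ltcR divr_gt0.
move=> y; rewrite -ball_normE /ball_ /= !nm_lt -(linB lS) => h.
by apply: le_lt_trans (hK _) _; rewrite mulrC -ltr_pdivlMr.
Qed.

Lemma closedP M : closed M <->
  forall x, (forall e : R, 0 < e -> exists2 y, M y & nm (x - y) < e) -> M x.
Proof.
split=> [cM x h|h x hx].
  apply: cM => A /nbhs_ballP [e /posC [d d0 ->] hA].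
  have [y My hy] := h _ d0; exists y; split=> //; apply: hA.
  by rewrite -ball_normE /ball_ /= nm_lt.
apply: h => e e0; have [|y [My]] := hx (ball x (e%:C)%C).
  by apply: nbhsx_ballx; rewrite -(rmorph0 (real_complex R)) ltcR.
by rewrite -ball_normE /ball_ /= nm_lt => h; exists y.
Qed.

Lemma subD M x y : subspace M -> M x -> M y -> M (x + y).
Proof. by move=> [_ h] Mx My; have := h 1 x y Mx My; rewrite scale1r. Qed.

Lemma subZ M (a : R[i]) x : subspace M -> M x -> M (a *: x).
Proof. by move=> [M0 h] Mx; have := h a x 0 Mx M0; rewrite addr0. Qed.

Lemma subN M x : subspace M -> M x -> M (- x).
Proof. by move=> sM Mx; rewrite -scaleN1r; apply: subZ. Qed.

Lemma subB M x y : subspace M -> M x -> M y -> M (x - y).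
Proof. by move=> sM Mx My; apply: subD => //; apply: subN. Qed.

Lemma sub_sum M n (u : 'I_n -> X) : subspace M -> (forall i, M (u i)) ->
  M (\sum_(i < n) u i).
Proof.
move=> sM h; apply: (big_ind M) => //; first by case: sM.
by move=> x y; apply: subD.
Qed.

Lemma sub_setT : subspace (@setT X).
Proof. by []. Qed.

Lemma sub_set0 : subspace [set (0 : X)].
Proof. by split=> // a x y /= -> ->; rewrite scaler0 addr0. Qed.

Lemma closed_set0 : closed [set (0 : X)].
Proof.
apply/closedP => x h /=; apply: nm_eq0; apply/eqP; rewrite eq_le nm_ge0 andbT.
apply: le_all_eps => e /h [y /= ->]; rewrite subr0 add0r; exact: ltW.
Qed.

Lemma closed_limit M (u : nat -> X) x (b : nat -> R) : closed M ->
  (forall n, M (u n)) -> (forall n, nm (x - u n) <= b n) ->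
  (forall e, 0 < e -> exists N : nat, b N < e) -> M x.
Proof.
move=> /closedP cM hu hb he; apply: cM => e /he [N hN].
by exists (u N) => //; apply: le_lt_trans hN.
Qed.

Lemma nm_limit0 (V : normedZmodType R[i]) (x : V) (b : nat -> R) :
  (forall n, nm x <= b n) -> (forall e, 0 < e -> exists N : nat, b N < e) -> x = 0.
Proof.
move=> hb he; apply: nm_eq0; apply/eqP; rewrite eq_le nm_ge0 andbT.
apply: le_all_eps => e /he [N hN]; rewrite add0r.
by apply: ltW; apply: le_lt_trans hN.
Qed.

Definition addS M N : set X := [set x | exists m n, [/\ M m, N n & x = m + n]].

Lemma addS_sub M N : subspace M -> subspace N -> subspace (addS M N).
Proof.
move=> sM sN; split; first by exists 0, 0; rewrite addr0; split; [case: sM|case: sN|].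
move=> a _ _ [m [n [Mm Nn ->]]] [m' [n' [Mm' Nn' ->]]].
exists (a *: m + m'), (a *: n + n'); split; [exact: (proj2 sM)|exact: (proj2 sN)|].
by rewrite scalerDr addrACA.
Qed.

Lemma addSl M N x : subspace N -> M x -> addS M N x.
Proof. by move=> [N0 _] Mx; exists x, 0; rewrite addr0. Qed.

Lemma addSr M N x : subspace M -> N x -> addS M N x.
Proof. by move=> [M0 _] Nx; exists 0, x; rewrite add0r. Qed.

Lemma addS_le M N W : subspace W -> M `<=` W -> N `<=` W -> addS M N `<=` W.
Proof. by move=> sW MW NW _ [m [n [Mm Nn ->]]]; apply: subD; auto. Qed.

Lemma image_sub S M : lin S -> subspace M -> subspace (S @` M).
Proof.
move=> lS sM; split; first by exists 0; [case: sM|exact: lin0].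
move=> a _ _ [x Mx <-] [y My <-]; exists (a *: x + y); last exact: lS.
exact: (proj2 sM).
Qed.

Lemma span_nil x : span [::] x <-> x = 0 :> X.
Proof.
split=> [[c]|->]; first by rewrite big_ord0.
by exists (fun=> 0); rewrite big_ord0.
Qed.

Lemma span_cons (e : X) s x :
  span (e :: s) x <-> exists a y, span s y /\ x = a *: e + y.
Proof.
split=> [[c ->]|[a [y [[c ->] ->]]]].
  exists (c 0%N), (\sum_(i < size s) c i.+1 *: nth 0 s i); split.
    by exists (fun i => c i.+1).
  by rewrite big_ord_recl.
by exists (fun i => if i is j.+1 then c j else a); rewrite big_ord_recl.
Qed.

Lemma span_sub s : subspace (@span R X s).
Proof.
split; first by exists (fun=> 0); rewrite big1 // => i _; rewrite scale0r.
move=> a _ _ [c ->] [d ->]; exists (fun i => a * c i + d i).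
rewrite scaler_sumr -big_split /=; apply: eq_bigr => i _.
by rewrite scalerA -scalerDl.
Qed.

Lemma span_le s W : subspace W -> (forall x, x \in s -> W x) -> span s `<=` W.
Proof.
move=> sW; elim: s => [|e s IH] hs x.
  by move/span_nil => ->; case: sW.
move/span_cons => [a [y [/IH hy ->]]]; apply: subD => //.
  by apply: subZ => //; apply: hs; rewrite mem_head.
by apply: hy => z zs; apply: hs; rewrite inE zs orbT.
Qed.

Lemma mem_span (s : seq X) x : x \in s -> span s x.
Proof.
elim: s => // e s IH; rewrite inE => /orP [/eqP ->|/IH h]; apply/span_cons.
  by exists 1, 0; rewrite scale1r addr0; split=> //; case: (span_sub s).
by exists 0, x; rewrite scale0r add0r.
Qed.

Lemma span_mono (s t : seq X) : {subset s <= t} -> span s `<=` span t.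
Proof.
by move=> st; apply: span_le => [|x /st]; [exact: span_sub|exact: mem_span].
Qed.

Lemma span_map S s : lin S -> S @` span s `<=` span (map S s).
Proof.
move=> lS _ [x + <-]; elim: s x => [|e s IH] x.
  by move/span_nil => -> /=; rewrite (lin0 lS); case: (span_sub [::]).
move/span_cons => [a [y [/IH hy ->]]] /=; rewrite lS.
by apply/span_cons; exists a, (S y).
Qed.

(** * Steinitz exchange and induction on codimension *)

Lemma exchange W s e : subspace W -> addS W (span s) e -> ~ W e ->
  exists s', (size s').+1 = size s /\
    addS W (span s) `<=` addS (addS W (span [:: e])) (span s').
Proof.
move=> sW; elim: s W sW => [|a s IH] W sW.
  by move=> [w [v [Ww /span_nil -> ->]]]; rewrite addr0.
(* Either [a] plays no part in producing [e] and is kept, or its coefficient [c] is nonzero and [a]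
   can be replaced by [e]. *)
have [We'|nWs] := pselect (addS W (span s) e); [move=> _ nWe|].
  have [s' [sz hs']] := IH _ sW We' nWe.
  exists (a :: s'); rewrite /= sz; split=> // x [w [v [Ww]]].
  move/span_cons => [c [y [sy ->]]] ->.
  have [|p [q [hp hq hpq]]] := hs' (w + y); first by exists w, y.
  exists p, (c *: a + q); split=> //; last by rewrite addrCA hpq addrCA.
  by apply/span_cons; exists c, q.
move=> [w [v [Ww /span_cons [c [y [sy ->]]] he]]] _.
have [c0|c0] := eqVneq c 0.
  by case: nWs; exists w, y; split=> //; rewrite he c0 scale0r add0r.
exists s; split=> // x [w' [v' [Ww' /span_cons [d [z [sz ->]]] ->]]].
have ae : a = c^-1 *: (e - w - y).
  by rewrite he; lmod_split R[i]; field.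
exists (w' - (d / c) *: w + (d / c) *: e), (z - (d / c) *: y); split.
- exists (w' - (d / c) *: w), ((d / c) *: e); split=> //.
    by apply: subB => //; apply: subZ.
  by apply/span_cons; exists (d / c), 0; rewrite addr0; split=> //; apply/span_nil.
- by apply: subB; [exact: span_sub| |apply: subZ => //; exact: span_sub].
by rewrite {1}ae; lmod R[i].
Qed.

Definition cofinite W V := exists s, W `<=` addS V (span s).

Lemma codim_ind W (Q : set X -> Prop) V :
  subspace W -> subspace V -> V `<=` W -> cofinite W V ->
  (forall V, subspace V -> V `<=` W ->
     (V <> W -> forall e, W e -> ~ V e -> Q (addS V (span [:: e]))) -> Q V) ->
  Q V.
Proof.
move=> sW sV VW [s hs] hQ.
elim: {s}(size s) {-2}s (erefl (size s)) V sV VW hs => [|n IH] s sz V sV VW hs.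
  apply: hQ => // nVW; case: nVW; rewrite eqEsubset; split=> // x /hs.
  by rewrite (size0nil sz) => -[w [v [Ww /span_nil -> ->]]]; rewrite addr0.
apply: hQ => // nVW e We nVe.
have [s' []] := exchange sV (hs _ We) nVe; rewrite sz => -[sz' hs'].
apply: (IH s') => //; first by apply: addS_sub => //; exact: span_sub.
  apply: addS_le => //; apply: span_le => // x; rewrite inE => /eqP -> //.
by apply: subset_trans hs'.
Qed.

(** * Baire category, successive approximation and open mapping *)

Lemma baire_closed V (A : nat -> set X) :
  closed V -> V !=set0 -> V `<=` \bigcup_k A k ->
  exists k v (d : R), [/\ V v, 0 < d & forall u, V u -> nm (u - v) < d ->
    forall e : R, 0 < e -> exists2 w, A k w & nm (u - w) < e].
Proof.
move=> cV [v0 Vv0] VA; apply: contrapT => /forallNP hA.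
(* [p] holds a stage and a ball; the next ball avoids [A p.1] and has at most half the radius. The
   premises, with a dummy ball when they fail, let [choice] act on all [p]. *)
have step (p : nat * (X * R)) : exists q : X * R, V p.2.1 -> 0 < p.2.2 ->
    [/\ V q.1, 0 < q.2, q.2 <= p.2.2 / 2, nm (q.1 - p.2.1) < p.2.2 / 2 &
        forall w, A p.1 w -> q.2 < nm (q.1 - w)].
  have [Vp|] := pselect (V p.2.1); last by exists (v0, 1).
  have [d0|] := pselect (0 < p.2.2); last by exists (v0, 1).
  apply: contrapT => /forallNP hq.
  apply: (hA p.1); exists p.2.1, (p.2.2 / 2); split=> //; first by rewrite divr_gt0.
  move=> u Vu hu e e0; apply: contrapT => hw.
  pose m := Num.min (e / 2) (p.2.2 / 2).
  have m0 : 0 < m by rewrite lt_min !divr_gt0.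
  apply: (hq (u, m)) => _ _; split=> //=; first by rewrite ge_min lexx orbT.
  move=> w Aw; rewrite ltNge; apply/negP => h; apply: hw; exists w => //.
  apply: le_lt_trans h _; apply: (@le_lt_trans _ _ (e / 2)); last by lra.
  by rewrite ge_min lexx.
have [F hF] := choice step.
pose sq := fix sq n := if n is k.+1 then F (k, sq k) else (v0, 1).
have sqP n : V (sq n).1 /\ 0 < (sq n).2.
  by elim: n => [|n [Vn dn]] //=; have [] := hF (n, sq n) Vn dn.
have stp n := hF (n, sq n) (proj1 (sqP n)) (proj2 (sqP n)).
have dle n : (sq n).2 <= 1 / 2 ^+ n.
  elim: n => [|n IH] /=; first by rewrite expr0 divr1.
  have [_ _ /le_trans h _ _] := stp n; apply: h => /=.
  by rewrite exprS invfM mulrA mulrAC ler_pM2r.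
have hv n m : (n <= m)%N -> nm ((sq m).1 - (sq n).1) <= (sq n).2.
  (* Centres move by less than half the radius and radii at least halve, so distances telescope
     against differences of radii. *)
  move/subnK <-; suff : nm ((sq (m - n + n)%N).1 - (sq n).1)
      <= (sq n).2 - (sq (m - n + n)%N).2.
    by have [_] := sqP (m - n + n)%N; lra.
  elim: (m - n)%N => [|k IH]; first by rewrite !subrr nm0.
  have [_ _ h1 h2 _] := stp (k + n)%N; move: h1 h2 => /=.
  have := nm_tri (sq (k + n)%N).1 (sq (k.+1 + n)%N).1 (sq n).1.
  by rewrite addSn /=; lra.
have [n m nm_||v hvl] := @cauchy_limit _ _ (fun n => (sq n).1) (fun n => (((sq n).2)%:C)%C).
- by rewrite nm_le; exact: hv.
- move=> e /posC [d d0 ->]; have [N hN] := pow2_small 1 d0.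
  by exists N; rewrite ltcR; apply: le_lt_trans hN.
have {}hvl n : nm (v - (sq n).1) <= (sq n).2 by rewrite -nm_le.
have Vv : V v.
  apply: (closed_limit cV (fun n => proj1 (sqP n)) hvl) => e e0.
  by have [N hN] := pow2_small 1 e0; exists N; apply: le_lt_trans hN.
have [k _ Akv] := VA _ Vv.
have [_ _ _ _ /(_ _ Akv)] := stp k; have := hvl k.+1.
by rewrite nmBC /= => h1 h2; have := le_lt_trans h1 h2; rewrite ltxx.
Qed.

(** Iterating a solution up to half the error gives an exact one. Only the [M]-parts are summed; the
    [Z]-part is recovered as [v - S x], which is a limit of partial sums in the closed subspace [Z].
    The lemma serves the open mapping theorem and both results on shifted operators. *)
Lemma successive_approximation S M Z V (C : R) :
  bop S -> subspace M -> closed M -> subspace Z -> closed Z -> 0 <= C ->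
  (forall v, V v -> exists x z, [/\ M x, Z z, V (v - (S x + z)),
     nm x <= C * nm v & nm (v - (S x + z)) <= nm v / 2]) ->
  forall v, V v -> exists x z, [/\ M x, Z z, v = S x + z & nm x <= 2 * C * nm v].
Proof.
move=> [lS [K K0 hK]] sM cM sZ cZ C0 h v Vv.
have /choice [f hf] (u : X) : exists p : X * X, V u -> [/\ M p.1, Z p.2,
    V (u - (S p.1 + p.2)), nm p.1 <= C * nm u & nm (u - (S p.1 + p.2)) <= nm u / 2].
  have [/h [x [z hxz]]|] := pselect (V u); last by exists (0, 0).
  by exists (x, z).
pose r n := iter n (fun u => u - (S (f u).1 + (f u).2)) v.
have Vr n : V (r n) by elim: n => //= n /hf [].
have rle n : nm (r n) <= nm v / 2 ^+ n.
  elim: n => [|n IH] /=; first by rewrite expr0 divr1.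
  have [_ _ _ _ /le_trans] := hf _ (Vr n); apply.
  by rewrite exprS invfM mulrA mulrAC ler_pM2r.
have [n|x hx] := @geometricX _ _ (fun n => (f (r n)).1) (C * nm v).
  have [_ _ _ /le_trans hC _] := hf _ (Vr n); apply: hC.
  by rewrite -mulrA ler_wpM2l.
have sumr n : S (\sum_(i < n) (f (r i)).1) + \sum_(i < n) (f (r i)).2 = v - r n.
  rewrite (@lin_sum S n (fun i => (f (r i)).1) lS) -big_split /=; elim: n => [|n IH].
    by rewrite big_ord0 subrr.
  by rewrite big_ord_recr IH /=; lmod R[i].
exists x, (v - S x); split.
- apply: (@closed_limit M (fun n => \sum_(i < n) (f (r i)).1) x _ cM _ hx).
    by move=> n; apply: sub_sum => // i; have [] := hf _ (Vr i).
  by move=> e e0; have [N] := pow2_small (2 * (C * nm v)) e0; exists N.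
- pose B := nm v + K * (2 * (C * nm v)).
  apply: (@closed_limit Z (fun n => \sum_(i < n) (f (r i)).2) _
    (fun n => B / 2 ^+ n) cZ).
  + by move=> n; apply: sub_sum => // i; have [] := hf _ (Vr i).
  + move=> n; have -> : v - S x - \sum_(i < n) (f (r i)).2
        = r n - S (x - \sum_(i < n) (f (r i)).1).
      have -> : r n = v - (S (\sum_(i < n) (f (r i)).1) + \sum_(i < n) (f (r i)).2).
        by rewrite sumr; lmod R[i].
      by rewrite (linB lS); lmod R[i].
    apply: le_trans (nmB _ _) _; rewrite /B mulrDl; apply: lerD => //.
    apply: le_trans (hK _) _; rewrite -mulrA; apply: ler_wpM2l; first exact: ltW.
    by rewrite hx.
  + by move=> e e0; have [N] := pow2_small B e0; exists N.
- by rewrite addrC subrK.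
- by have := hx 0%N; rewrite big_ord0 subr0 expr0 divr1 mulrA.
Qed.

(** The open mapping theorem for the map induced by [S] into the quotient by [Z], phrased without
    quotients. The image plus [Z] is closed, so Baire's theorem applies inside it. *)
Lemma open_mapping S M Z : bop S -> subspace M -> closed M ->
  subspace Z -> closed Z -> closed (addS (S @` M) Z) ->
  exists2 C : R, 0 < C & forall v, addS (S @` M) Z v ->
    exists x z, [/\ M x, Z z, v = S x + z & nm x <= C * nm v].
Proof.
move=> bS sM cM sZ cZ; have [lS _] := bS.
have sV := addS_sub (image_sub lS sM) sZ.
move: sV; set V := addS _ _ => sV cV.
pose A (k : nat) := [set w | exists x z, [/\ M x, Z z, w = S x + z & nm x <= k%:R]].
have VA : V `<=` \bigcup_k A k.
  move=> _ [_ [z [[x Mx <-] Zz ->]]].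
  exists (Num.truncn (nm x)).+1 => //; exists x, z; split=> //.
  by apply: ltW; rewrite truncnS_gt.
have V0 : V !=set0 by exists 0; case: sV.
have [k [v0 [d [Vv0 d0 hd]]]] := baire_closed cV V0 VA.
(* [v] is scaled to norm [d / 2], and a difference of two approximants of norm at most [k] is scaled
   back. The successor keeps [C] positive when [k] is 0. *)
pose C := 4 * k.+1%:R / d.
have C0 : 0 < C by rewrite divr_gt0 // mulr_gt0.
have apx v : V v -> exists x z, [/\ M x, Z z, V (v - (S x + z)),
     nm x <= C * nm v & nm (v - (S x + z)) <= nm v / 2].
  move=> Vv; have [v00|vn0] := eqVneq v 0.
    exists 0, 0; rewrite v00 (lin0 lS) addr0 subr0 !nm0 mulr0 mul0r.
    by split=> //; [case: sM|case: sZ|case: sV].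
  have nv := nm_gt0 vn0.
  pose t := d / (2 * nm v).
  have t0 : 0 < t by rewrite divr_gt0 // mulr_gt0.
  have tC : (t%:C)%C != 0 by rewrite -(rmorph0 (real_complex R)) (inj_eq (@complexI R)) gt_eqF.
  have d8 : 0 < d / 8 by rewrite divr_gt0.
  have Vtv : V (v0 + (t%:C)%C *: v) by apply: subD => //; apply: subZ.
  have ltd : nm (v0 + (t%:C)%C *: v - v0) < d.
    rewrite addrAC subrr add0r nmZ nmR gtr0_norm // /t invfM mulrA mulfVK ?gt_eqF //.
    by rewrite ltr_pdivrMr //; lra.
  (* Two errors below [d / 8] add up to at most [d / 4], which is half the norm of the scaled
     vector. *)
  have [w [x [z [Mx Zz -> nx]]] hw] := hd _ Vtv ltd _ d8.
  have nm00 : nm (v0 - v0) < d by rewrite subrr nm0.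
  have [w' [x' [z' [Mx' Zz' -> nx']]] hw'] := hd v0 Vv0 nm00 _ d8.
  pose y := ((t^-1)%:C)%C *: (x - x'); pose q := ((t^-1)%:C)%C *: (z - z').
  have My : M y by apply: subZ => //; apply: subB.
  have Zq : Z q by apply: subZ => //; apply: subB.
  exists y, q; split=> //.
  - by apply: subB => //; exists (S y), q; split=> //; exists y.
  - rewrite /y nmZ nmR gtr0_norm ?invr_gt0 // /C /t invfM invrK.
    have : nm (x - x') <= 2 * k.+1%:R.
      apply: le_trans (nmB _ _) _; rewrite -natr1; lra.
    move=> h; apply: (@le_trans _ _ (d^-1 * (2 * nm v) * (2 * k.+1%:R))).
      by rewrite ler_wpM2l // mulr_ge0 ?invr_ge0 ?mulr_ge0 // ltW.
    by rewrite le_eqVlt; apply/orP; left; apply/eqP; ring.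
  - have -> : v - (S y + q) = ((t^-1)%:C)%C *:
        ((v0 + (t%:C)%C *: v - (S x + z)) - (v0 - (S x' + z'))).
      rewrite /y /q (linZ lS) (linB lS) fmorphV /=.
      by lmod_split R[i]; field.
    rewrite nmZ nmR gtr0_norm ?invr_gt0 //.
    have := nmB (v0 + (t%:C)%C *: v - (S x + z)) (v0 - (S x' + z')).
    set n0 := nm _ => hn; have hn1 : n0 < d / 4 by lra.
    rewrite /t invfM invrK; apply: (@le_trans _ _ (d^-1 * (2 * nm v) * (d / 4))).
      by rewrite ler_wpM2l ?mulr_ge0 ?invr_ge0 ?mulr_ge0 // ltW.
    rewrite le_eqVlt; apply/orP; left; apply/eqP; field; exact: lt0r_neq0.
exists (2 * C); first by rewrite mulr_gt0.
exact: successive_approximation bS sM cM sZ cZ (ltW C0) apx.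
Qed.

(** * Closedness under finite-dimensional extension *)

Lemma dist_closed V m : subspace V -> closed V -> ~ V m ->
  exists2 d : R, 0 < d & forall v (c : R[i]), V v -> nm c * d <= nm (v + c *: m).
Proof.
move=> sV /closedP cV nVm; apply: contrapT => /forall2NP hd; apply: nVm.
apply: cV => e e0; have [//|he] := hd e.
apply: contrapT => hm; apply: he => v c Vv.
have [->|c0] := eqVneq c 0; first by rewrite nm0 mul0r nm_ge0.
have -> : v + c *: m = c *: (m - - (c^-1 *: v)) by lmod_split R[i]; field.
rewrite nmZ ler_pM2l ?nm_gt0 // leNgt; apply/negP => h; apply: hm.
by exists (- (c^-1 *: v)) => //; apply: subN => //; apply: subZ.
Qed.

(** The coefficient of [e] is controlled by the norm through [dist_closed], so along a convergent
    sequence it converges, and the [V]-part with it. *)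
Lemma closed_add1 V e : subspace V -> closed V -> closed (addS V (span [:: e])).
Proof.
move=> sV cV; have [Ve|nVe] := pselect (V e).
  suff -> : addS V (span [:: e]) = V by [].
  rewrite eqEsubset; split=> x; last by move=> Vx; apply: addSl => //; exact: span_sub.
  apply: addS_le => //; apply: span_le => // y; rewrite inE => /eqP -> //.
have [d d0 hd] := dist_closed sV cV nVe; apply/closedP => x hx.
have /choice [p hp] (n : nat) : exists p : X * R[i],
    V p.1 /\ nm (x - (p.1 + p.2 *: e)) <= 1 / 2 ^+ n.
  have [|_ [v [_ [Vv /span_cons [c [_ [/span_nil -> ->]]] ->]]] h] := hx (1 / 2 ^+ n).
    by rewrite divr_gt0 // exprn_gt0.
  by exists (v, c); split=> //; move: h; rewrite addr0 => /ltW.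
pose q n := (p n).1 + (p n).2 *: e.
have [n|c hc] := @geometricC _ (fun n => (p n.+1).2 - (p n).2) (2 / d).
  rewrite mulrAC ler_pdivlMr //.
  have := hd ((p n.+1).1 - (p n).1) ((p n.+1).2 - (p n).2) _.
  have -> : (p n.+1).1 - (p n).1 + ((p n.+1).2 - (p n).2) *: e = q n.+1 - q n.
    by rewrite /q; lmod R[i].
  move=> h; apply: le_trans (h _) _.
    by apply: subB => //; have [] := hp n; have [] := hp n.+1.
  apply: le_trans (nm_tri x _ _) _; rewrite nmBC.
  have [_ h1] := hp n.+1; have [_ h2] := hp n.
  have : 1 / 2 ^+ n.+1 <= 1 / 2 ^+ n :> R.
    by rewrite ler_pM2l // lef_pV2 ?posrE ?exprn_gt0 // ler_weXn2l // ler1n.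
  have -> : 2 / 2 ^+ n = 1 / 2 ^+ n + 1 / 2 ^+ n :> R by ring.
  rewrite -/(q _) in h1 h2; lra.
have {}hc n : nm (c + (p 0%N).2 - (p n).2) <= 4 * (2 / d) / 2 ^+ n.
  have := hc n; rewrite (_ : \sum_(i < n) _ = (p n).2 - (p 0%N).2).
    by rewrite opprB addrA addrAC.
  elim: n => [|n IH]; first by rewrite big_ord0 subrr.
  by rewrite big_ord_recr IH /= addrC subrKA.
set c' := c + _ in hc.
exists (x - c' *: e), (c' *: e); split; last by rewrite subrK.
  pose B := 1 + 4 * (2 / d) * nm e.
  apply: (@closed_limit V (fun n => (p n).1) _ (fun n => B / 2 ^+ n)) => //.
  - by move=> n; have [] := hp n.
  - move=> n; have -> : x - c' *: e - (p n).1 = (x - q n) - (c' - (p n).2) *: e.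
      by rewrite /q; lmod R[i].
    apply: le_trans (nmB _ _) _; rewrite nmZ /B mulrDl; apply: lerD.
      by have [] := hp n.
    by rewrite mulrAC ler_wpM2r ?nm_ge0.
  - by move=> r r0; have [N] := pow2_small B r0; exists N.
by apply: subZ; [exact: span_sub|apply: mem_span; rewrite mem_head].
Qed.

Lemma addS_cons V e s :
  addS V (span (e :: s)) = addS (addS V (span s)) (span [:: e]).
Proof.
rewrite eqEsubset; split=> x.
  move=> [v [_ [Vv /span_cons [a [y [sy ->]]] ->]]].
  exists (v + y), (a *: e); split; [by exists v, y| |by lmod R[i]].
  by apply/span_cons; exists a, 0; rewrite addr0; split=> //; apply/span_nil.
move=> [_ [_ [[v [y [Vv sy ->]]] /span_cons [a [_ [/span_nil -> ->]]] ->]]].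
exists v, (a *: e + y); split=> //; last by lmod R[i].
by apply/span_cons; exists a, y.
Qed.

Lemma closed_add_span V s : subspace V -> closed V -> closed (addS V (span s)).
Proof.
move=> sV cV; elim: s => [|e s IH].
  suff -> : addS V (span [::]) = V by [].
  rewrite eqEsubset; split=> x; last by move=> Vx; apply: addSl => //; exact: span_sub.
  by move=> [v [_ [Vv /span_nil -> ->]]]; rewrite addr0.
rewrite addS_cons; apply: closed_add1 => //.
by apply: addS_sub => //; exact: span_sub.
Qed.

Lemma complement W V : subspace W -> subspace V -> V `<=` W -> cofinite W V ->
  exists s, [/\ span s `<=` W, forall x, span s x -> V x -> x = 0 &
    W `<=` addS V (span s)].
Proof.
move=> sW sV VW fV.
apply: (@codim_ind W (fun V => exists s, [/\ span s `<=` W,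
  forall x, span s x -> V x -> x = 0 & W `<=` addS V (span s)]) V) => //.
move=> {VW fV sV} V sV VW hV; have [VeW|nVW] := pselect (V = W).
  exists [::]; split=> [x /span_nil ->|x /span_nil //|x].
    by case: sW.
  by rewrite VeW => Wx; apply: addSl => //; exact: span_sub.
have [e [We nVe]] : exists e, W e /\ ~ V e.
  apply: contrapT => h; apply: nVW; rewrite eqEsubset; split=> // x Wx.
  by apply: contrapT => nVx; apply: h; exists x.
have [s [sW' s0 Ws]] := hV nVW e We nVe.
exists (e :: s); split.
- move=> _ /span_cons [a [y [/sW' Wy ->]]]; apply: subD => //; exact: subZ.
- move=> _ /span_cons [a [y [sy ->]]] Vx.
  have y0 : y = 0.
    apply: s0 => //; exists (a *: e + y), (- a *: e); split=> //.
      apply/span_cons; exists (- a), 0; rewrite addr0; split=> //; exact/span_nil.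
    by lmod R[i].
  move: Vx; rewrite y0 addr0; have [->|a0] := eqVneq a 0; first by rewrite scale0r.
  move=> Vae; case: nVe; have -> : e = a^-1 *: (a *: e) by lmod_split R[i]; field.
  exact: subZ.
- move=> x /Ws [_ [q [[v [y [Vv ey ->]]] sq ->]]]; rewrite addS_cons.
  by exists (v + q), y; split=> //; [exists v, q|lmod R[i]].
Qed.

(** Enlarging [Z] by a finite-dimensional complement turns the sum into the closed space [W], where
    open mapping applies. Differences of elements of the original sum have no component in the
    complement, so their controlled preimages can be summed along a convergent sequence. *)
Lemma cofinite_closed S M Z W : bop S -> subspace M -> closed M ->
  subspace Z -> closed Z -> subspace W -> closed W ->
  addS (S @` M) Z `<=` W -> cofinite W (addS (S @` M) Z) ->
  closed (addS (S @` M) Z).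
Proof.
move=> bS sM cM sZ cZ sW cW; have [lS [K K0 hK]] := bS.
have := addS_sub (image_sub lS sM) sZ.
set V := addS _ _ => sV VW fV.
have [s [sWs sV0 hW]] := complement sW sV VW fV.
have sZ' : subspace (addS Z (span s)) by apply: addS_sub => //; exact: span_sub.
have WE : addS (S @` M) (addS Z (span s)) = W.
  rewrite eqEsubset; split.
    apply: addS_le => //; first by move=> x Mx; apply: VW; apply: addSl.
    apply: addS_le => // z Zz; apply: VW; apply: addSr => //; exact: image_sub.
  move=> x /hW [_ [y [[p [z [Sp Zz ->]]] sy ->]]].
  by exists p, (z + y); split=> //; [exists z, y|lmod R[i]].
have [|C C0 hC] := open_mapping bS sM cM sZ' (closed_add_span sZ cZ).
  by rewrite WE.
rewrite {}WE in hC.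
apply/closedP => x hx.
have /choice [v hv] (n : nat) : exists v, V v /\ nm (x - v) <= 1 / 2 ^+ n.
  have [|v Vv h] := hx (1 / 2 ^+ n); first by rewrite divr_gt0 // exprn_gt0.
  by exists v; split=> //; exact: ltW.
have /choice [p hp] (n : nat) : exists p : X * X, [/\ M p.1, Z p.2,
    v n.+1 - v n = S p.1 + p.2 & nm p.1 <= (2 * C) / 2 ^+ n].
  have [Vn hn] := hv n; have [Vn1 hn1] := hv n.+1.
  have VB : V (v n.+1 - v n) by apply: subB.
  have [y [_ [My [z [f [Zz sf ->]]] e ny]]] := hC _ (VW _ VB).
  have f0 : f = 0.
    apply: sV0 => //; have -> : f = (v n.+1 - v n) - (S y + z) by rewrite e; lmod R[i].
    by apply: subB => //; exists (S y), z; split=> //; exists y.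
  exists (y, z); split=> //=; first by rewrite e f0 addr0.
  apply: le_trans ny _; rewrite (mulrC 2) -mulrA ler_pM2l //.
  apply: le_trans (nm_tri x _ _) _; rewrite nmBC.
  have : 1 / 2 ^+ n.+1 <= 1 / 2 ^+ n :> R.
    by rewrite ler_pM2l // lef_pV2 ?posrE ?exprn_gt0 // ler_weXn2l // ler1n.
  have -> : 2 / 2 ^+ n = 1 / 2 ^+ n + 1 / 2 ^+ n :> R by ring.
  lra.
have [n|y hy] := @geometricX _ _ (fun n => (p n).1) (2 * C).
  by have [] := hp n.
have sumv n : S (\sum_(i < n) (p i).1) + \sum_(i < n) (p i).2 = v n - v 0%N.
  rewrite (@lin_sum S n (fun i => (p i).1) lS) -big_split /=.
  elim: n => [|n IH]; first by rewrite big_ord0 subrr.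
  by rewrite big_ord_recr IH /=; have [_ _ <- _] := hp n; rewrite addrC subrKA.
have My : M y.
  apply: (@closed_limit M (fun n => \sum_(i < n) (p i).1) y _ cM _ hy).
    by move=> n; apply: sub_sum => // i; have [] := hp i.
  by move=> e e0; have [N] := pow2_small (2 * (2 * C)) e0; exists N.
have Zz : Z (x - v 0%N - S y).
  pose B := 1 + K * (2 * (2 * C)).
  apply: (@closed_limit Z (fun n => \sum_(i < n) (p i).2) _ (fun n => B / 2 ^+ n)) => //.
  - by move=> n; apply: sub_sum => // i; have [] := hp i.
  - move=> n; have -> : x - v 0%N - S y - \sum_(i < n) (p i).2
        = (x - v n) - S (y - \sum_(i < n) (p i).1).
      have -> : v n = v 0%N + (S (\sum_(i < n) (p i).1) + \sum_(i < n) (p i).2).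
        by rewrite sumv; lmod R[i].
      by rewrite (linB lS); lmod R[i].
    apply: le_trans (nmB _ _) _; rewrite /B mulrDl; apply: lerD; first by have [] := hv n.
    by apply: le_trans (hK _) _; rewrite -[leRHS]mulrA ler_pM2l.
  - by move=> e e0; have [N] := pow2_small B e0; exists N.
have -> : x = v 0%N + (S y + (x - v 0%N - S y)) by lmod R[i].
by apply: subD => //; [have [] := hv 0%N|exists (S y), (x - v 0%N - S y); split=> //; exists y].
Qed.

(** * Hahn-Banach theorem, separation and lifting of functionals *)

Definition dlin (f : X -> R[i]) := forall (a : R[i]) x y, f (a *: x + y) = a * f x + f y.

Lemma dlin0 f : dlin f -> f 0 = 0.
Proof.
by move=> h; have := h (-1) 0 0; rewrite scaler0 addr0 mulN1r addNr.
Qed.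

Lemma dlinD f x y : dlin f -> f (x + y) = f x + f y.
Proof. by move=> h; have := h 1 x y; rewrite scale1r mul1r. Qed.

Lemma dlinZ f a x : dlin f -> f (a *: x) = a * f x.
Proof. by move=> h; have := h a x 0; rewrite (dlin0 h) !addr0. Qed.

Lemma dlinB f x y : dlin f -> f (x - y) = f x - f y.
Proof. by move=> h; rewrite (dlinD _ _ h) -scaleN1r (dlinZ _ _ h) mulN1r. Qed.

(* Graphs of dominated real-linear functionals: the bound forces a real-linear
   relation to be single-valued. *)
Definition dominated (K : R) (G : set (X * R)) :=
  [/\ G (0, 0), (forall (t : R) p q, G p -> G q ->
        G ((t%:C)%C *: p.1 + q.1, t * p.2 + q.2)) &
      forall p, G p -> p.2 <= K * nm p.1].

(** The value at [x] must lie above every [b.2 - K * nm (b.1 - x)] and below every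
    [K * nm (y.1 + x) - y.2]; the triangle inequality makes the supremum of the former
    admissible. *)
Lemma dominated_step K G x : 0 <= K -> dominated K G ->
  exists G', [/\ dominated K G', G `<=` G' & exists a, G' (x, a)].
Proof.
move=> K0 [G0 Glin Gb].
pose A : set R := [set b.2 - K * nm (b.1 - x) | b in G].
have ubA y : G y -> ubound A (K * nm (y.1 + x) - y.2).
  move=> Gy _ [b Gb' <-]; have := Gb _ (Glin 1 _ _ Gy Gb').
  rewrite rmorph1 scale1r mul1r /= => h.
  have : K * nm (y.1 + b.1) <= K * (nm (y.1 + x) + nm (b.1 - x)).
    apply: ler_wpM2l => //; have -> : y.1 + b.1 = (y.1 + x) + (b.1 - x) by lmod R[i].
    exact: nmD.
  lra.
have A0 : A !=set0 by exists (0 - K * nm (0 - x)), (0, 0).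
have sA : has_sup A by split=> //; exists (K * nm ((0 : X) + x) - 0); exact: (ubA (0, 0)).
pose a := sup A.
have a1 b : G b -> b.2 - K * nm (b.1 - x) <= a.
  by move=> hb; apply: ub_le_sup; [case: sA|exists b].
have a2 y : G y -> a <= K * nm (y.1 + x) - y.2 by move=> hy; apply: ge_sup => //; exact: ubA.
have Gscale (t : R) p : G p -> G ((t%:C)%C *: p.1, t * p.2).
  by move=> Gp; have := Glin t _ _ Gp G0; rewrite /= !addr0.
exists [set p | exists (t : R) q, G q /\ p = ((t%:C)%C *: x + q.1, t * a + q.2)].
split.
- split.
  + exists 0, (0, 0); split=> //=; rewrite rmorph0 scale0r mul0r !addr0 //.
  + move=> r _ _ [t [q [Gq ->]]] [t' [q' [Gq' ->]]] /=.
    exists (r * t + t'), ((r%:C)%C *: q.1 + q'.1, r * q.2 + q'.2).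
    split=> /=; first exact: Glin.
    congr pair; last by ring.
    by rewrite rmorphD rmorphM; lmod R[i].
  + move=> _ [t [q [Gq ->]]] /=; have [t0|t0|->] := ltgtP t 0; last first.
    * by rewrite rmorph0 scale0r mul0r !add0r; exact: Gb.
    * have := a2 _ (Gscale t^-1 _ Gq) => /=.
      have -> : (t%:C)%C *: x + q.1 = (t%:C)%C *: (((t^-1)%:C)%C *: q.1 + x).
        rewrite scalerDr scalerA -rmorphM /= mulfV ?gt_eqF // rmorph1 scale1r addrC //.
      rewrite nmZ nmR gtr0_norm // => h.
      have : t * a <= t * (K * nm (((t^-1)%:C)%C *: q.1 + x) - t^-1 * q.2).
        by rewrite ler_pM2l.
      rewrite mulrBr !mulrA mulfV ?gt_eqF // mul1r; rewrite (mulrC t K); lra.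
    * pose s := - t; have s0 : 0 < s by rewrite /s; lra.
      have := a1 _ (Gscale s^-1 _ Gq) => /=.
      have -> : (t%:C)%C *: x + q.1 = (s%:C)%C *: (((s^-1)%:C)%C *: q.1 - x).
        rewrite scalerBr scalerA -rmorphM /= mulfV ?gt_eqF // rmorph1 scale1r.
        by rewrite /s rmorphN; lmod R[i].
      rewrite nmZ nmR gtr0_norm // => h.
      have : s * (s^-1 * q.2 - K * nm (((s^-1)%:C)%C *: q.1 - x)) <= s * a.
        by rewrite ler_pM2l.
      rewrite mulrBr !mulrA mulfV ?gt_eqF // mul1r; rewrite (mulrC s K) /s; lra.
- by move=> p Gp; exists 0, p; rewrite rmorph0 scale0r mul0r !add0r; case: p Gp.
- by exists a, 1, (0, 0); split=> //=; rewrite rmorph1 scale1r mul1r !addr0.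
Qed.

Lemma dominated_total K G : 0 <= K -> dominated K G ->
  exists u : X -> R, [/\ forall (t : R) x y, u ((t%:C)%C *: x + y) = t * u x + u y,
    forall x, u x <= K * nm x & forall p, G p -> u p.1 = p.2].
Proof.
move=> K0 dG.
(* Zorn is applied to sets whose union with [G] is dominated, so that the empty chain also has an
   admissible union. *)
have [|A [dA maxA]] := @Zorn_bigcup _ (fun A => dominated K (A `|` G)).
  move=> F FP tot; have [G0 Glin Gb] := dG; split; first by right.
    move=> t p q [[A FA Ap]|Gp] [[B FB Bq]|Gq].
    - have [AB|BA] := tot _ _ FA FB; last first.
          have [_ l _] := FP _ FA; have Aq : A q by exact: BA.
        by have [h|h] := l t p q (or_introl Ap) (or_introl Aq); [left; exists A|right].
      have [_ l _] := FP _ FB; have Bp : B p by exact: AB.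
      by have [h|h] := l t p q (or_introl Bp) (or_introl Bq); [left; exists B|right].
    - have [_ l _] := FP _ FA.
      by have [h|h] := l t p q (or_introl Ap) (or_intror Gq); [left; exists A|right].
    - have [_ l _] := FP _ FB.
      by have [h|h] := l t p q (or_intror Gp) (or_introl Bq); [left; exists B|right].
    - by right; exact: Glin.
  by move=> p [[A FA Ap]|/Gb //]; have [_ _] := FP _ FA; apply; left.
have tot x : exists a, (A `|` G) (x, a).
  have [G' [dG' GG' [a Ga]]] := dominated_step x K0 dA.
  exists a; have [//|nAa] := pselect ((A `|` G) (x, a)).
  exfalso; apply: (maxA G').
    split; first by move=> p Ap; apply: GG'; left.
    by move=> h; apply: nAa; left; exact: h.
  suff -> : G' `|` G = G' by [].
  by rewrite eqEsubset; split=> p; [case=> // Gp; apply: GG'; right|left].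
have [H0 Hlin Hb] := dA.
have uniq x a b : (A `|` G) (x, a) -> (A `|` G) (x, b) -> a = b.
  move=> Ha Hb'; have := Hb _ (Hlin (-1) _ _ Ha Hb'); have := Hb _ (Hlin (-1) _ _ Hb' Ha).
  rewrite /= rmorphN1 scaleN1r addNr nm0 mulr0; lra.
have [u hu] := choice tot.
exists u; split.
- by move=> t x y; apply: uniq (hu _) _; exact: (Hlin t _ _ (hu x) (hu y)).
- by move=> x; have := Hb _ (hu x).
- by move=> [x a] Gp /=; apply: uniq (hu x) _; right.
Qed.

Lemma hahn_banach V (f : X -> R[i]) (K : R) : subspace V -> 0 <= K ->
  (forall (a : R[i]) x y, V x -> V y -> f (a *: x + y) = a * f x + f y) ->
  (forall x, V x -> nm (f x) <= K * nm x) ->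
  exists g, [/\ dlin g, forall x, nm (g x) <= K * nm x & forall x, V x -> g x = f x].
Proof.
move=> sV K0 fl fb; have V0 : V 0 by case: sV.
have f0 : f 0 = 0 by have := fl (-1) 0 0 V0 V0; rewrite scaler0 addr0 mulN1r addNr.
have fZ (a : R[i]) x : V x -> f (a *: x) = a * f x.
  by move=> Vx; have := fl a x 0 Vx V0; rewrite f0 !addr0.
have [|u [ul ub uV]] := @dominated_total K [set p | V p.1 /\ p.2 = complex.Re (f p.1)] K0.
  split=> /=; first by rewrite f0.
    move=> t p q [Vp ->] [Vq ->]; split; first exact: (proj2 sV).
    rewrite fl // raddfD /=; case: (f p.1) => x y /=.
    by rewrite mul0r subr0.
  move=> p [Vp ->]; apply: le_trans (fb _ Vp).
  exact: le_trans (ler_norm _) (Re_le_nm _).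
have u0 : u 0 = 0 by have := ul (-1) 0 0; rewrite scaler0 addr0 mulN1r addNr.
have uD x y : u (x + y) = u x + u y by have := ul 1 x y; rewrite rmorph1 scale1r mul1r.
have uZ (t : R) x : u ((t%:C)%C *: x) = t * u x by have := ul t x 0; rewrite u0 !addr0.
(* A complex-linear functional is determined by its real part [u]. *)
pose g x := (u x +i* - u ('i%C *: x))%C.
have gl : dlin g.
  move=> [a b] x y; rewrite /g.
  have aE (z : X) : (a +i* b)%C *: z = (a%:C)%C *: z + (b%:C)%C *: ('i%C *: z).
    by rewrite [(a +i* b)%C]complexE; lmod R[i].
  have iE (z : X) : 'i%C *: ((a +i* b)%C *: z) = (a%:C)%C *: ('i%C *: z) + ((- b)%:C)%C *: z.
    have ii : 'i%C * 'i%C = -1 :> R[i] by rewrite -expr2 sqr_i.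
    have -> : (((- b)%:C)%C : R[i]) = (b%:C)%C * ('i%C * 'i%C) by rewrite ii mulrN1 rmorphN.
    by rewrite [(a +i* b)%C]complexE; lmod R[i].
  rewrite scalerDr iE aE !uD !uZ; apply/eqP; rewrite eq_complex /=.
  by apply/andP; split; apply/eqP; ring.
exists g; split=> //.
- move=> x; have [->|g0] := eqVneq (g x) 0; first by rewrite nm0 mulr_ge0 // nm_ge0.
  (* The unimodular factor that makes [g (c *: x)] real and nonnegative, so that the bound on [u]
     bounds [g]. *)
  pose c := ((nm (g x))%:C)%C / g x.
  have cg : g (c *: x) = ((nm (g x))%:C)%C by rewrite dlinZ // /c divfK.
  have nc : nm c = 1.
    by rewrite nmM nmV nmR ger0_norm ?nm_ge0 // mulfV // gt_eqF // nm_gt0.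
  have := ub (c *: x); rewrite nmZ nc mul1r; apply: le_trans.
  have : complex.Re (g (c *: x)) = nm (g x) by rewrite cg.
  by move=> <-.
- move=> x Vx; rewrite /g (uV (x, complex.Re (f x))) //=.
  rewrite (uV ('i%C *: x, complex.Re (f ('i%C *: x)))) //=; last first.
    by split=> //; exact: subZ.
  by rewrite fZ //; case: (f x) => a b /=; rewrite mul0r mul1r sub0r opprK.
Qed.

Lemma separation V m : subspace V -> closed V -> ~ V m ->
  exists g, [/\ dlin g, (exists2 K : R, 0 < K & forall x, nm (g x) <= K * nm x),
    (forall x, V x -> g x = 0) & g m != 0].
Proof.
move=> sV cV nVm; have [d d0 hd] := dist_closed sV cV nVm.
(* The coefficient of [m], extended by 0 outside the sum of [V] and the line through [m]; its bound
   is the inverse of the distance constant [d]. *)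
have [f hf] : exists f : X -> R[i], forall v c, V v -> f (v + c *: m) = c.
  have /choice [f hf] (x : X) : exists c, forall v c', V v -> x = v + c' *: m -> c = c'.
    have [[v [c [Vv ->]]]|h] := pselect (exists v c, V v /\ x = v + c *: m).
      exists c => v' c' Vv' e; have [/eqP|cc'] := eqVneq (c - c') 0.
        by rewrite subr_eq0 => /eqP.
      case: nVm; have -> : m = (c - c')^-1 *: (v' - v).
        have -> : v' - v = (c - c') *: m.
          have -> : v' = v + c *: m - c' *: m by rewrite e addrK.
          by lmod R[i].
        by rewrite scalerA mulVf // scale1r.
      by apply: subZ => //; apply: subB.
    by exists 0 => v c Vv e; case: h; exists v, c.
  by exists f => v c Vv; exact: (hf _ v c).
have spanE x : addS V (span [:: m]) x -> exists v c, V v /\ x = v + c *: m.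
  move=> [v [_ [Vv /span_cons [c [_ [/span_nil -> ->]]] ->]]].
  by exists v, c; rewrite addr0.
have [||a _ _ /spanE [v [c [Vv ->]]] /spanE [v' [c' [Vv' ->]]]|
    _ /spanE [v [c [Vv ->]]]|g [gl gb gV]] := @hahn_banach (addS V (span [:: m])) f d^-1.
- by apply: addS_sub => //; exact: span_sub.
- by rewrite invr_ge0 ltW.
- have -> : a *: (v + c *: m) + (v' + c' *: m) = (a *: v + v') + (a * c + c') *: m.
    by lmod R[i].
  by rewrite !hf //; exact: (proj2 sV).
- by rewrite hf // mulrC ler_pdivlMr //; exact: hd.
exists g; split=> //; first by exists d^-1; rewrite // invr_gt0.
  move=> x Vx; rewrite gV; last by apply: addSl => //; exact: span_sub.
  by have := hf x 0 Vx; rewrite scale0r addr0.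
rewrite gV; last by apply: addSr => //; apply: mem_span; rewrite mem_head.
have V0 : V 0 by case: sV.
by have := hf 0 1 V0; rewrite scale1r add0r => ->; exact: oner_neq0.
Qed.

(** On the image plus [Z], set g(S x + z) = f(x). Two choices of x differ by an element that [S]
    sends into [Z], hence by an element of [Z], where [f] vanishes; the choice with controlled norm
    gives the bound, and Hahn-Banach extends g. *)
Lemma dual_step S M Z f (C K : R) : lin S -> subspace M -> subspace Z ->
  Z `<=` M -> (forall x, M x -> Z (S x) -> Z x) -> 0 <= K -> 0 <= C ->
  (forall v, addS (S @` M) Z v ->
     exists x z, [/\ M x, Z z, v = S x + z & nm x <= C * nm v]) ->
  dlin f -> (forall x, nm (f x) <= K * nm x) -> (forall z, Z z -> f z = 0) ->
  exists g, [/\ dlin g, forall x, nm (g x) <= K * C * nm x,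
    forall z, Z z -> g z = 0 & forall x, M x -> g (S x) = f x].
Proof.
move=> lS sM sZ ZM SZ K0 C0 hC fl fb fZ.
have sV := addS_sub (image_sub lS sM) sZ; move: hC sV; set V := addS _ _ => hC sV.
have /choice [p hp] (v : X) : exists p : X * X, V v ->
    [/\ M p.1, Z p.2, v = S p.1 + p.2 & nm p.1 <= C * nm v].
  have [/hC [x [z h]]|] := pselect (V v); last by exists (0, 0).
  by exists (x, z).
have key v x z : V v -> M x -> Z z -> v = S x + z -> f (p v).1 = f x.
  move=> Vv Mx Zz e; have [Mp Zp e' _] := hp _ Vv.
  apply/eqP; rewrite -subr_eq0 -dlinB //; apply/eqP; apply: fZ; apply: SZ.
    exact: subB.
  rewrite (linB lS); have -> : S (p v).1 = v - (p v).2 by rewrite {2}e'; lmod R[i].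
  have -> : v - (p v).2 - S x = z - (p v).2 by rewrite {1}e; lmod R[i].
  exact: subB.
have [||a u v Vu Vv|v Vv|g [gl gb gV]] := @hahn_banach V (fun v => f (p v).1) (K * C).
- by [].
- exact: mulr_ge0.
- have [Mu Zu eu _] := hp _ Vu; have [Mv Zv ev _] := hp _ Vv.
  rewrite -fl; apply: key => //; first exact: (proj2 sV).
  + exact: (proj2 sM).
  + exact: (proj2 sZ _ _ _ Zu Zv).
  + by rewrite lS {1}eu {1}ev; lmod R[i].
- have [_ _ _ h] := hp _ Vv; apply: le_trans (fb _) _.
  by rewrite -mulrA ler_wpM2l.
exists g; split=> //.
- move=> z Zz; have Vz : V z by apply: addSr => //; exact: image_sub.
  rewrite gV // (key z 0 z) //; first exact: dlin0.
    by case: sM.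
  by rewrite (lin0 lS) add0r.
- move=> x Mx; have Vx : V (S x) by apply: addSl => //; exists x.
  by rewrite gV // (key (S x) x 0) ?addr0 //; case: sZ.
Qed.

(** * Power series of functionals with geometric remainders *)

Definition gsum (u : nat -> R[i]) s :=
  exists B : R, forall n, nm (s - \sum_(i < n) u i) <= B / 2 ^+ n.

Lemma gsum_unique u s t : gsum u s -> gsum u t -> s = t.
Proof.
move=> [B hB] [D hD]; apply/eqP; rewrite -subr_eq0; apply/eqP.
apply: (@nm_limit0 _ _ (fun n => (B + D) / 2 ^+ n)).
  move=> n; apply: le_trans (nm_tri (\sum_(i < n) u i) _ _) _.
  by rewrite mulrDl [X in _ + X]nmBC; exact: lerD.
by move=> e e0; have [N] := pow2_small (B + D) e0; exists N.
Qed.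

Lemma gsum_lin (a : R[i]) u v s t :
  gsum u s -> gsum v t -> gsum (fun n => a * u n + v n) (a * s + t).
Proof.
move=> [B hB] [D hD]; exists (nm a * B + D) => n.
rewrite big_split /= -mulr_sumr opprD addrACA -mulrBr.
apply: le_trans (nmD _ _) _; rewrite nmM mulrDl; apply: lerD => //.
by rewrite -mulrA; apply: ler_wpM2l; [exact: nm_ge0|exact: hB].
exact: hD.
Qed.

Lemma gsum_ext u v s : (forall n, u n = v n) -> gsum u s -> gsum v s.
Proof.
by move=> h [B hB]; exists B => n; rewrite -(eq_bigr _ (fun i _ => h _)).
Qed.

Lemma gsum_shift u s : gsum u s -> gsum (fun n => u n.+1) (s - u 0%N).
Proof.
move=> [B hB]; exists (`|B| / 1) => n; have := hB n.+1.
rewrite big_ord_recl /= opprD addrA => /le_trans; apply.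
apply: (@le_trans _ _ (`|B| / 2 ^+ n.+1)).
  by rewrite ler_wpM2r ?ler_norm // invr_ge0 exprn_ge0.
by rewrite divr1; apply: ler_wpM2l => //; rewrite lef_pV2 ?posrE ?exprn_gt0 // ler_weXn2l // ler1n.
Qed.

Lemma gsum_bound u s (B : R) : gsum u s -> (forall n, nm (u n) <= B / 2 ^+ n) ->
  nm s <= 4 * B.
Proof.
move=> us /geometricC [t ht]; have -> : s = t.
  by apply: gsum_unique us _; exists (4 * B).
by have := ht 0%N; rewrite big_ord0 subr0 expr0 divr1.
Qed.

(** The second-order Taylor remainder of a power. The factor 4^n absorbs the polynomial growth in
    [n], and multiplying by [r ^+ 2] avoids the exponent n - 2. *)
Lemma power_error (m l : R[i]) (r : R) n : nm m <= r -> nm l <= r ->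
  r ^+ 2 * nm (m ^+ n - l ^+ n - n%:R * l ^+ n.-1 * (m - l))
    <= (4 * r) ^+ n * nm (m - l) ^+ 2.
Proof.
move=> hm hl; have r0 : 0 <= r by apply: le_trans hm; exact: nm_ge0.
set d := nm (m - l); have d0 : 0 <= d by exact: nm_ge0.
elim: n => [|n IH].
  by rewrite !expr0 subrr !mul0r subr0 nm0 mulr0 mul1r sqr_ge0.
set e := (X in nm X) in IH *.
have -> : m ^+ n.+1 - l ^+ n.+1 - n.+1%:R * l ^+ n.+1.-1 * (m - l)
    = m * (m ^+ n - l ^+ n - n%:R * l ^+ n.-1 * (m - l))
      + n%:R * l ^+ n.-1 * (m - l) ^+ 2.
  case: n {IH e} => [|n] /=; rewrite ?exprS ?expr0; first by ring.
  by rewrite -[n.+2%:R]natr1; ring.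
apply: (@le_trans _ _ (r * (r ^+ 2 * nm (m ^+ n - l ^+ n - n%:R * l ^+ n.-1 * (m - l)))
    + r ^+ 2 * (n%:R * r ^+ n.-1 * d ^+ 2))).
  set E := (X in r * (_ * X)); set D := n%:R * _ * d ^+ 2.
  have -> : r * (r ^+ 2 * E) + r ^+ 2 * D = r ^+ 2 * (r * E + D) by ring.
  apply: ler_wpM2l; first exact: sqr_ge0.
  apply: le_trans (nmD _ _) _; rewrite !nmM !nmX; apply: lerD.
    by apply: ler_wpM2r => //; exact: nm_ge0.
  apply: ler_wpM2r; first exact: sqr_ge0.
  have -> : nm (n%:R : R[i]) = n%:R by rewrite -(rmorph_nat (real_complex R)) nmR ger0_norm.
  by apply: ler_wpM2l => //; apply: lerXn2r => //; rewrite nnegrE nm_ge0.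
apply: (@le_trans _ _ (r * ((4 * r) ^+ n * d ^+ 2) + n%:R * r ^+ n.+1 * d ^+ 2)).
  apply: lerD; first exact: ler_wpM2l.
  case: n {IH e} => [|n]; first by rewrite !mul0r mulr0.
  by rewrite le_eqVlt; apply/orP; left; apply/eqP; rewrite /= !exprS; ring.
have -> : r * ((4 * r) ^+ n * d ^+ 2) + n%:R * r ^+ n.+1 * d ^+ 2
    = (4 ^+ n + n%:R) * (r ^+ n.+1 * d ^+ 2) by rewrite exprMn [r ^+ n.+1]exprS; ring.
rewrite exprMn -mulrA; apply: ler_wpM2r; first by rewrite mulr_ge0 ?exprn_ge0.
have : n%:R <= 4 ^+ n :> R by rewrite -natrX ler_nat ltnW // ltn_expl.
have : 0 <= 4 ^+ n :> R by rewrite exprn_ge0.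
rewrite exprS; lra.
Qed.

(* An analytic family of eigenvectors of the adjoint of [S] on [M]. *)
Definition eigen_family S M := exists (r : R) (f : R[i] -> X -> R[i]) (m : X),
  [/\ 0 < r, dual_analytic_on 0 (r%:C)%C f,
      forall l, nm l < r -> forall x, M x -> f l (S x) = l * f l x,
      M m & f 0 m != 0].

Lemma power_series_analytic (F : nat -> X -> R[i]) (K C : R) :
  0 <= K -> 0 < C -> (forall n, dlin (F n)) ->
  (forall n x, nm (F n x) <= K * C ^+ n * nm x) ->
  exists (r : R) (f : R[i] -> X -> R[i]), [/\ 0 < r, dual_analytic_on 0 (r%:C)%C f &
    forall l x, nm l < r -> gsum (fun n => l ^+ n * F n x) (f l x)].
Proof.
(* 1/8 is 1/2 times 1/4: the powers of 1/4 absorb the factor [n] of the derived series and the 4^n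
   of [power_error], and those of 1/2 remain for summation. *)
move=> K0 C0 Fl Fb; have [r r0 rC] : exists2 r : R, 0 < r & r * C = 1 / 8.
  exists (1 / (8 * C)); first by rewrite divr_gt0 // mulr_gt0.
  by field; rewrite lt0r_neq0.
have Bx0 (x : X) : 0 <= K * nm x by rewrite mulr_ge0 ?nm_ge0.
have pow8 n : r ^+ n * C ^+ n <= 1 / 2 ^+ n.
  rewrite -exprMn rC expr_div_n expr1n ler_pM2l // lef_pV2 ?posrE ?exprn_gt0 //.
  by apply: lerXn2r; rewrite ?nnegrE //; lra.
have ft l x n : nm l <= r -> nm (l ^+ n * F n x) <= K * nm x / 2 ^+ n.
  move=> hl; rewrite nmM nmX; apply: (@le_trans _ _ (r ^+ n * (K * C ^+ n * nm x))).
    apply: ler_pM => //; rewrite ?exprn_ge0 ?nm_ge0 //.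
    by apply: lerXn2r; rewrite ?nnegrE ?nm_ge0 // ltW.
  have -> : r ^+ n * (K * C ^+ n * nm x) = K * nm x * (r ^+ n * C ^+ n) by ring.
  by have := ler_wpM2l (Bx0 x) (pow8 n); rewrite mul1r.
have gt l x n : nm l <= r ->
    nm (n%:R * l ^+ n.-1 * F n x) <= (8 * C * K * nm x) / 2 ^+ n.
  move=> hl; case: n => [|n].
    by rewrite !mul0r nm0 expr0 divr1 -mulrA mulr_ge0 // mulr_ge0 // ltW.
  have hn : nm (n.+1%:R : R[i]) = n.+1%:R.
    by rewrite -(rmorph_nat (real_complex R)) nmR ger0_norm.
  rewrite !nmM nmX hn /=.
  apply: (@le_trans _ _ (n.+1%:R * r ^+ n * (K * C ^+ n.+1 * nm x))).
    apply: ler_pM; [by rewrite mulr_ge0 // exprn_ge0 // nm_ge0|exact: nm_ge0| |exact: Fb].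
    by apply: ler_wpM2l => //; apply: lerXn2r; rewrite ?nnegrE ?nm_ge0 // ltW.
  have -> : n.+1%:R * r ^+ n * (K * C ^+ n.+1 * nm x)
      = C * K * nm x * (n.+1%:R * (r * C) ^+ n).
    rewrite exprMn [C ^+ n.+1]exprS; move: (n.+1%:R : R) => a; ring.
  have -> : 8 * C * K * nm x / 2 ^+ n.+1 = C * K * nm x * (4 / 2 ^+ n).
    by rewrite exprS; field; rewrite expf_neq0.
  apply: ler_wpM2l; first by rewrite -mulrA mulr_ge0 // ltW.
  rewrite rC expr_div_n expr1n mul1r ler_pdivrMr ?exprn_gt0 //.
  have -> : (8 : R) = 4 * 2 by ring.
  have -> : 4 / 2 ^+ n * (4 * 2) ^+ n = 4 * 4 ^+ n :> R.
    by rewrite exprMn; field; rewrite expf_neq0.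
  have h4 : n%:R <= 4 ^+ n :> R by rewrite -natrX ler_nat ltnW // ltn_expl.
  have h1 : 1 <= 4 ^+ n :> R by rewrite exprn_ege1 // ler1n.
  rewrite -natr1; lra.
have /choice [f hf] (p : R[i] * X) : exists s, nm p.1 <= r ->
    gsum (fun n => p.1 ^+ n * F n p.2) s.
  have [hl|] := pselect (nm p.1 <= r); last by exists 0.
  have [s hs] := geometricC (fun n => ft p.1 p.2 n hl).
  by exists s => _; exists (4 * (K * nm p.2)).
have /choice [g hg] (p : R[i] * X) : exists s, nm p.1 <= r ->
    gsum (fun n => n%:R * p.1 ^+ n.-1 * F n p.2) s.
  have [hl|] := pselect (nm p.1 <= r); last by exists 0.
  have [s hs] := geometricC (fun n => gt p.1 p.2 n hl).
  by exists s => _; exists (4 * (8 * C * K * nm p.2)).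
have dlin_gsum (c : nat -> R[i]) (h : X -> R[i]) :
    (forall x, gsum (fun n => c n * F n x) (h x)) -> dlin h.
  move=> hh a x y; apply: gsum_unique (hh _) _.
  apply: gsum_ext (gsum_lin a (hh x) (hh y)) => n /=.
  by rewrite Fl mulrDr; congr (_ + _); ring.
exists r, (fun l x => f (l, x)); split=> //; last by move=> l x /ltW; exact: (hf (l, x)).
split=> l; rewrite subr0 nm_lt => /ltW hl.
  split; first by apply: (dlin_gsum (fun n => l ^+ n)) => x; exact: (hf (l, x)).
  exists (((4 * K)%:C)%C); first by rewrite -(rmorph0 (real_complex R)) lecR mulr_ge0.
  move=> x; rewrite !nmE -rmorphM lecR -mulrA.
  exact: gsum_bound (hf (l, x) hl) (fun n => ft l x n hl).
exists (fun x => g (l, x)); split.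
  split; first by apply: (dlin_gsum (fun n => n%:R * l ^+ n.-1)) => x; exact: (hg (l, x)).
  exists (((4 * (8 * C * K))%:C)%C).
    by rewrite -(rmorph0 (real_complex R)) lecR !mulr_ge0 // ltW.
  move=> x; rewrite !nmE -rmorphM lecR -[leRHS]mulrA.
  exact: gsum_bound (hg (l, x) hl) (fun n => gt l x n hl).
(* [D] is the constant of the quadratic error: 4 comes from [gsum_bound] and the square of [r] from
   [power_error]. *)
move=> e /posC [e' e0 ->]; pose D := 4 * K / r ^+ 2.
have D0 : 0 <= D by apply: divr_ge0; [exact: mulr_ge0|exact: sqr_ge0].
exists (((e' / (D + 1))%:C)%C).
  by rewrite -(rmorph0 (real_complex R)) ltcR divr_gt0 //; lra.
move=> m; rewrite subr0 !nm_lt => /ltW hm hd x.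
have main : nm (f (m, x) - f (l, x) - (m - l) * g (l, x)) <= D * nm (m - l) ^+ 2 * nm x.
  have h := gsum_lin (- (m - l)) (hg (l, x) hl)
    (gsum_lin (-1) (hf (l, x) hl) (hf (m, x) hm)).
  have := @gsum_bound _ _ (nm (m - l) ^+ 2 * K * nm x / r ^+ 2) h.
  have -> : - (m - l) * g (l, x) + (-1 * f (l, x) + f (m, x))
    = f (m, x) - f (l, x) - (m - l) * g (l, x) by ring.
  have -> : 4 * (nm (m - l) ^+ 2 * K * nm x / r ^+ 2) = D * nm (m - l) ^+ 2 * nm x.
    by rewrite /D; ring.
  apply=> n /=.
  have -> : - (m - l) * (n%:R * l ^+ n.-1 * F n x) + (-1 * (l ^+ n * F n x) + m ^+ n * F n x)
     = (m ^+ n - l ^+ n - n%:R * l ^+ n.-1 * (m - l)) * F n x by ring.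
  rewrite nmM; set E := nm _.
  have hE : r ^+ 2 * E <= (4 * r) ^+ n * nm (m - l) ^+ 2 by exact: power_error.
  rewrite mulrAC ler_pdivlMr ?exprn_gt0 //.
  apply: (@le_trans _ _ ((r ^+ 2 * E) * (K * C ^+ n * nm x))).
    have -> : E * nm (F n x) * r ^+ 2 = r ^+ 2 * E * nm (F n x) by ring.
    apply: ler_wpM2l; last exact: Fb.
    by rewrite mulr_ge0 ?sqr_ge0 // nm_ge0.
  apply: le_trans (ler_wpM2r _ hE) _.
    by rewrite mulr_ge0 ?nm_ge0 // mulr_ge0 // exprn_ge0 // ltW.
  have -> : (4 * r) ^+ n * nm (m - l) ^+ 2 * (K * C ^+ n * nm x)
     = (4 * (r * C)) ^+ n * (nm (m - l) ^+ 2 * K * nm x) by rewrite !exprMn; ring.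
  rewrite rC (_ : 4 * (1 / 8) = 1 / 2 :> R); last by field.
  by rewrite expr_div_n expr1n mul1r mulrC.
rewrite !nmE -!rmorphM lecR; apply: le_trans main _.
apply: ler_wpM2r; first exact: nm_ge0.
rewrite expr2 mulrA; apply: ler_wpM2r; first exact: nm_ge0.
move: hd; rewrite ltr_pdivlMr; last by lra.
have := nm_ge0 (m - l); nra.
Qed.

(** Start with a functional vanishing on the image plus [Z] but not at [m], and lift it repeatedly
    by [dual_step]. The hypotheses on [Z] are exactly what makes every lift vanish on [Z] again, so
    that the next one exists. *)
Lemma eigen_family_ex S M Z (C : R) : lin S -> subspace M -> subspace Z ->
  Z `<=` M -> (forall x, M x -> Z (S x) -> Z x) -> 0 < C ->
  (forall v, addS (S @` M) Z v ->
     exists x z, [/\ M x, Z z, v = S x + z & nm x <= C * nm v]) ->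
  closed (addS (S @` M) Z) -> ~ M `<=` addS (S @` M) Z -> eigen_family S M.
Proof.
move=> lS sM sZ ZM SZ C0 hC cV /existsNP [m /not_implyP [Mm nVm]].
have sV := addS_sub (image_sub lS sM) sZ.
have [f0 [f0l [K K0 f0b] f0V f0m]] := separation sV cV nVm.
pose P (B : R) (f : X -> R[i]) := [/\ dlin f, forall x, nm (f x) <= B * nm x &
  forall z, Z z -> f z = 0].
have /choice [F hF] (p : R * (X -> R[i])) : exists g, 0 <= p.1 -> P p.1 p.2 ->
    P (p.1 * C) g /\ forall x, M x -> g (S x) = p.2 x.
  have [B0|] := pselect (0 <= p.1); last by exists p.2.
  have [[fl fb fZ]|] := pselect (P p.1 p.2); last by exists p.2.
  have [g [gl gb gZ gS]] := dual_step lS sM sZ ZM SZ B0 (ltW C0) hC fl fb fZ.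
  by exists g.
pose ph := fix ph n := if n is k.+1 then F (K * C ^+ k, ph k) else f0.
have B0 n : 0 <= K * C ^+ n by rewrite mulr_ge0 ?exprn_ge0 // ltW.
have phP n : P (K * C ^+ n) (ph n).
  elim: n => [|n IH] /=.
    by rewrite expr0 mulr1; split=> // z Zz; apply: f0V; apply: addSr => //; exact: image_sub.
  by rewrite exprSr mulrA; have [] := hF (K * C ^+ n, ph n) (B0 n) IH.
have phS n x : M x -> ph n.+1 (S x) = ph n x.
  by have [_ h] := hF (K * C ^+ n, ph n) (B0 n) (phP n); exact: h.
have [n|n x|r [f [r0 fa fs]]] := @power_series_analytic ph K C (ltW K0) C0.
- by have [] := phP n.
- by have [] := phP n.
exists r, f, m; split=> //.
- move=> l hl x Mx.
  have h1 := gsum_shift (fs l (S x) hl).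
  have h2 : gsum (fun n => l * (l ^+ n * ph n x) + 0) (l * f l x + 0).
    apply: gsum_lin; first exact: fs.
    by exists 0 => n; rewrite big1 // subr0 nm0 mul0r.
  (* The constant term vanishes on the image of [S]; dropping it shifts the series by one and
     produces the factor [l]. *)
  have e0 : l ^+ 0 * ph 0%N (S x) = 0.
    by rewrite /= f0V ?mulr0 //; apply: addSl => //; exists x.
  rewrite e0 subr0 in h1; rewrite addr0 in h2.
  apply: gsum_unique h1 _; apply: gsum_ext h2 => n.
  by rewrite phS // addr0 exprS mulrA.
- have h := fs 0 m; rewrite nm0 in h; have {}h := h r0.
  suff -> : f 0 m = f0 m by [].
  apply: gsum_unique h _; exists (nm (f0 m)) => -[|n].
    by rewrite big_ord0 subr0 expr0 divr1.
  rewrite big_ord_recl big1 /=; last by move=> i _; rewrite expr0n mul0r.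
  by rewrite expr0 mul1r addr0 subrr nm0 divr_ge0 ?nm_ge0 // exprn_ge0.
Qed.

(** * Eigenfunctionals against finite descent *)

Lemma iter_lin S n : lin S -> lin (iter n S).
Proof. by move=> lS; elim: n => [|n IH] a x y //=; rewrite IH lS. Qed.

Lemma iter_bop S n : bop S -> bop (iter n S).
Proof.
move=> [lS [K K0 hK]]; split; first exact: iter_lin.
exists (K ^+ n); first exact: exprn_gt0.
elim: n => [|n IH] x /=; first by rewrite expr0 mul1r.
by apply: le_trans (hK _) _; rewrite exprS -mulrA ler_pM2l.
Qed.

Lemma shift_bop S l : bop S -> bop (shift S l).
Proof.
move=> [lS [K K0 hK]]; split; first by move=> a x y; rewrite /shift lS; lmod R[i].
exists (K + nm l); first by have := nm_ge0 l; lra.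
by move=> x; apply: le_trans (nmB _ _) _; rewrite nmZ mulrDl lerD2r.
Qed.

Lemma shift_shift S l m : shift (shift S l) m = shift S (l + m).
Proof. by apply/funext => x; rewrite /shift; lmod R[i]. Qed.

Lemma shift_inv S M l : subspace M -> S @` M `<=` M -> shift S l @` M `<=` M.
Proof.
move=> sM SM _ [x Mx <-]; apply: subB => //; last exact: subZ.
by apply: SM; exists x.
Qed.

Lemma iter_inv S M n : S @` M `<=` M -> iter n S @` M `<=` M.
Proof.
move=> SM _ [x Mx <-]; elim: n => //= n IH; by apply: SM; exists (iter n S x).
Qed.

Lemma analytic_continuous (r : R) (f : R[i] -> X -> R[i]) x l (e : R) : dual_analytic_on 0 (r%:C)%C f ->
  nm l < r -> 0 < e -> exists2 d : R, 0 < d &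
    forall m, nm m < r -> nm (m - l) < d -> nm (f m x - f l x) < e.
Proof.
move=> [fd fa] hl e0; have [|g [[gl [B B0 gb]] hg]] := fa l; first by rewrite subr0 nm_lt.
have [d /posC [d' d0 ->] hd] := hg 1 ltr01.
have hgx : nm (g x) <= complex.Re B * nm x.
  by rewrite -nm_le rmorphM /= RRe_real ?ger0_real // -nmE.
pose D := complex.Re B * nm x + nm x + 1.
have B0' : 0 <= complex.Re B by move: B0; rewrite lecE => /andP[].
have D0 : 0 < D by have := mulr_ge0 B0' (nm_ge0 x); have := nm_ge0 x; rewrite /D; lra.
exists (Num.min d' (e / D)); first by rewrite lt_min d0 divr_gt0.
move=> m hm; rewrite lt_min ltr_pdivlMr // => /andP [h1 h2].
have := hd m; rewrite subr0 !nm_lt => /(_ hm h1 x); rewrite mul1r !nmE -rmorphM lecR => h3.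
have -> : f m x - f l x = (f m x - f l x - (m - l) * g x) + (m - l) * g x by ring.
apply: le_lt_trans (nmD _ _) _; rewrite nmM.
have := ler_wpM2l (nm_ge0 (m - l)) hgx; have := nm_ge0 (m - l).
rewrite /D in h2; nra.
Qed.

Lemma iter_eigen (f : X -> R[i]) S M (c : R[i]) n x : S @` M `<=` M ->
  (forall x, M x -> f (S x) = c * f x) -> M x -> f (iter n S x) = c ^+ n * f x.
Proof.
move=> SM h Mx; elim: n => [|n IH] /=; first by rewrite expr0 mul1r.
by rewrite h ?IH ?exprS ?mulrA //; apply: (iter_inv (n := n) SM); exists x.
Qed.

(* At an eigenvalue [l], finite descent gives [M = (S - l) M + ker (S - l)^d].
   Eigenfunctionals for [m <> l] vanish on the second summand, hence so does
   the one for [l] by continuity, and it vanishes on the first. *)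
Lemma eigen_no_descent S M : lin S -> subspace M -> S @` M `<=` M ->
  eigen_family S M -> exists2 e : R, 0 < e & forall l, nm l < e -> forall d,
    iter d (shift S l) @` M <> iter d.+1 (shift S l) @` M.
Proof.
move=> lS sM SM [r [f [m0 [r0 fa fe Mm0 fm0]]]].
have fl l : nm l < r -> dlin (f l).
  by move=> hl; have [] := (proj1 fa) l; rewrite ?subr0 ?nm_lt.
have r00 : nm (0 : R[i]) < r by rewrite nm0.
have [e e0 he] := analytic_continuous m0 fa r00 (nm_gt0 fm0).
exists (Num.min e r); first by rewrite lt_min e0.
move=> l; rewrite lt_min => /andP [hle hlr] d hd.
have flm0 : f l m0 <> 0.
  move=> h; have := he l hlr; rewrite subr0 => /(_ hle).
  by rewrite h sub0r nmN ltxx.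
have lA : lin (shift S l) by move=> a x y; rewrite /shift lS; lmod R[i].
have [y My hy] : (iter d.+1 (shift S l) @` M) (iter d (shift S l) m0).
  by rewrite -hd; exists m0.
have AM := @shift_inv S M l sM SM.
pose z := m0 - shift S l y.
have Mz : M z by apply: subB => //; apply: AM; exists y.
have Az : iter d (shift S l) z = 0.
  by rewrite /z (linB (iter_lin d lA)) -iterSr hy subrr.
have shf mu x : nm mu < r -> M x -> f mu (shift S l x) = (mu - l) * f mu x.
  move=> hmu Mx; rewrite /shift (dlinB _ _ (fl _ hmu)) (dlinZ _ _ (fl _ hmu)) fe //.
  by ring.
have fz mu : nm mu < r -> mu != l -> f mu z = 0.
  move=> hmu ml; have := iter_eigen d AM (shf mu ^~ hmu) Mz.
  rewrite Az (dlin0 (fl _ hmu)) => /esym/eqP; rewrite mulf_eq0 expf_eq0 subr_eq0.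
  by rewrite (negPf ml) andbF => /eqP.
have fmz : f l m0 = f l z.
  rewrite /z (dlinB _ _ (fl _ hlr)) (shf l y hlr My) subrr mul0r subr0 //.
apply: flm0; rewrite fmz; apply: nm_eq0; apply/eqP; rewrite eq_le nm_ge0 andbT.
apply: le_all_eps => t t0; rewrite add0r.
have [d' d0 hd'] := analytic_continuous z fa hlr t0.
(* A displacement giving a parameter different from [l], still in the disc and within the continuity
   radius [d']. *)
pose s := Num.min (d' / 2) ((r - nm l) / 2).
have s0 : 0 < s by rewrite lt_min !divr_gt0 // subr_gt0.
have sd : s < d' by apply: (@le_lt_trans _ _ (d' / 2)); [rewrite ge_min lexx|lra].
have sr : s < r - nm l.
  by apply: (@le_lt_trans _ _ ((r - nm l) / 2)); [rewrite ge_min lexx orbT|lra].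
have hmu : nm (l + (s%:C)%C) < r.
  by apply: le_lt_trans (nmD _ _) _; rewrite nmR gtr0_norm //; lra.
have mul : l + (s%:C)%C != l.
  rewrite -subr_eq0 addrAC subrr add0r -(rmorph0 (real_complex R)).
  by rewrite (inj_eq (@complexI R)) gt_eqF.
have := hd' _ hmu; rewrite addrAC subrr add0r nmR gtr0_norm // => /(_ sd).
by rewrite (fz _ hmu mul) sub0r nmN => /ltW.
Qed.

Lemma closed_ker S M : bop S -> closed M -> closed [set x | M x /\ S x = 0].
Proof.
move=> [lS [K K0 hK]] cM; apply/closedP => x hx; split.
  by move/closedP: cM; apply=> e /hx [y [My _] h]; exists y.
apply: nm_eq0; apply/eqP; rewrite eq_le nm_ge0 andbT; apply: le_all_eps => e e0.
have [|y [_ Sy] h] := hx (e / K); first exact: divr_gt0.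
have -> : S x = S (x - y) by rewrite (linB lS) Sy subr0.
rewrite add0r; apply: le_trans (hK _) _; apply: ltW.
by rewrite mulrC -ltr_pdivlMr.
Qed.

Lemma sub_ker S M : lin S -> subspace M -> subspace [set x | M x /\ S x = 0].
Proof.
move=> lS sM; split; first by split; [case: sM|exact: lin0].
move=> a x y [Mx Sx] [My Sy]; split; first exact: (proj2 sM).
by rewrite lS Sx Sy scaler0 addr0.
Qed.

Definition hyperker M S : set X := [set x | M x /\ exists n, iter n S x = 0].

Lemma iter_ker_mono S n m x : lin S -> (n <= m)%N -> iter n S x = 0 -> iter m S x = 0.
Proof. by move=> lS /subnK <- h; rewrite iterD h lin0 //; exact: iter_lin. Qed.

Lemma hyperker_sub S M : lin S -> subspace M -> subspace (hyperker M S).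
Proof.
move=> lS sM; split; first by split; [case: sM|exists 0%N].
move=> a x y [Mx [n hn]] [My [m hm]]; split; first exact: (proj2 sM).
exists (maxn n m); rewrite (iter_lin _ lS).
rewrite (iter_ker_mono lS (leq_maxl n m) hn) (iter_ker_mono lS (leq_maxr n m) hm).
by rewrite scaler0 addr0.
Qed.

Lemma hyperker_pre S M x : M x -> hyperker M S (S x) -> hyperker M S x.
Proof. by move=> Mx [_ [n hn]]; split=> //; exists n.+1; rewrite iterSr. Qed.

(** The Kato condition puts the whole hyperkernel inside the range, so adding it to the range
    changes nothing. The hyperkernel need not be closed; open mapping is therefore applied with [Z]
    zero, and its solutions are reused with zero hyperkernel part. *)
Lemma kato_eigen_family S M : bop S -> subspace M -> closed M -> S @` M `<=` M ->
  kato_on M S -> S @` M <> M -> eigen_family S M.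
Proof.
move=> bS sM cM SM [cSM ker_ran] nsur; have [lS _] := bS.
have add0 : addS (S @` M) [set 0] = S @` M.
  rewrite eqEsubset; split=> x; last by move=> h; apply: addSl => //; exact: sub_set0.
  by move=> [y [_ [h -> ->]]]; rewrite addr0.
have hk : hyperker M S `<=` S @` M.
  move=> x [Mx [n]]; elim: n x Mx => [|n IH] x Mx hx.
    by exists 0; [case: sM|rewrite (lin0 lS)].
  (* The Kato inclusion at level n + 1 gives [y] with S^(n+1) y = S^n x, so [x - S y] is killed by
     S^n. *)
  have [|y My hy] := ker_ran n.+1 (iter n S x).
    by split; [apply: (iter_inv (n := n) SM); exists x|exact: hx].
  have [||w Mw hw] := IH (x - S y).
  - by apply: subB => //; apply: SM; exists y.
  - by rewrite (linB (iter_lin n lS)) -iterSr hy subrr.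
  by exists (w + y); [exact: subD|rewrite (linD lS) hw subrK].
have addh : addS (S @` M) (hyperker M S) = S @` M.
  rewrite eqEsubset; split.
    by apply: addS_le => //; exact: image_sub.
  by move=> x h; apply: addSl => //; exact: hyperker_sub.
have [|C C0 hC] := open_mapping bS sM cM sub_set0 closed_set0.
  by rewrite add0.
apply: (@eigen_family_ex S M (hyperker M S) C) => //.
- exact: hyperker_sub.
- by move=> x [].
- by move=> x; exact: hyperker_pre.
- move=> v; rewrite addh -add0 => /hC [x [z [Mx -> e nx]]].
  by exists x, 0; split=> //; case: (hyperker_sub lS sM).
- by rewrite addh.
- by rewrite addh => h; apply: nsur; rewrite eqEsubset.
Qed.

(** Each member of the chain not contained in [V] supplies a vector that lowers the codimension,
    which can happen only finitely often. *)
Lemma chain_stable W V (A : nat -> set X) : subspace W -> subspace V -> V `<=` W ->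
  cofinite W V -> (forall n, subspace (A n)) -> (forall n, A n `<=` W) ->
  (forall n m, (n <= m)%N -> A n `<=` A m) ->
  exists m, forall n, A n `<=` addS V (A m).
Proof.
move=> sW sV VW fV sA AW mono.
apply: (@codim_ind W (fun V => exists m, forall n, A n `<=` addS V (A m)) V) => //.
move=> {fV VW sV} V sV VW hV.
have [h|/existsNP [n /existsNP [e /not_implyP [Ane nVe]]]] := pselect (forall n, A n `<=` V).
  by exists 0%N => n x /h Vx; exact: addSl.
have [|m hm] := hV _ e (AW _ _ Ane) nVe; first by move=> VeW; apply: nVe; rewrite VeW; exact: AW Ane.
exists (maxn n m) => k x /hm.
apply: addS_le; first exact: addS_sub.
  apply: addS_le; first exact: addS_sub.
    by move=> y Vy; apply: addSl.
  apply: span_le; first exact: addS_sub.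
  move=> y; rewrite inE => /eqP ->; apply: addSr => //; exact: mono (leq_maxl _ _) _ Ane.
by move=> y Ay; apply: addSr => //; exact: mono (leq_maxr _ _) _ Ay.
Qed.

(** Modulo the range the kernels of powers stabilise at some [m], so the hyperkernel may be replaced
    by the closed kernel of S^m. If range and kernel filled [M], applying S^m would give descent at
    [m]. *)
Lemma cofinite_eigen_family S M : bop S -> subspace M -> closed M -> S @` M `<=` M ->
  cofinite M (S @` M) -> (forall d, iter d S @` M <> iter d.+1 S @` M) ->
  eigen_family S M.
Proof.
move=> bS sM cM SM fM nd; have [lS _] := bS.
pose A n := [set x | M x /\ iter n S x = 0].
have sA n : subspace (A n) by apply: sub_ker => //; exact: iter_lin.
have cA n : closed (A n) by apply: closed_ker => //; exact: iter_bop.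
have sSM := image_sub lS sM.
have [n x []|n m nm_ x [Mx hx]|m hm] // := @chain_stable M (S @` M) A sM sSM SM fM sA.
  by split=> //; exact: iter_ker_mono nm_ hx.
have VE : addS (S @` M) (hyperker M S) = addS (S @` M) (A m).
  rewrite eqEsubset; split; apply: addS_le.
  - exact: addS_sub.
  - by move=> x h; apply: addSl.
  - by move=> x [Mx [n hn]]; apply: (hm n).
  - by apply: addS_sub => //; exact: hyperker_sub.
  - by move=> x h; apply: addSl => //; exact: hyperker_sub.
  - by move=> x [Mx hx]; apply: addSr => //; split=> //; exists m.
have cV : closed (addS (S @` M) (A m)).
  apply: (@cofinite_closed S M (A m) M) => //.
    by apply: addS_le => // x [].
  case: fM => s hs; exists s => x /hs [v [y [Sv sy ->]]].
  by exists v, y; split=> //; exact: addSl.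
have [C C0 hC] := open_mapping bS sM cM (sA m) (cA m) cV.
apply: (@eigen_family_ex S M (hyperker M S) C) => //.
- exact: hyperker_sub.
- by move=> x [].
- by move=> x; exact: hyperker_pre.
- move=> v; rewrite VE => /hC [x [z [Mx [Mz hz] e nx]]].
  by exists x, z; split=> //; split=> //; exists m.
- by rewrite VE.
- rewrite VE => h; apply: (nd m); rewrite eqEsubset; split.
    move=> _ [x Mx <-]; have [_ [z [[y My <-] [Mz hz] ->]]] := h _ Mx.
    by exists y => //; rewrite (linD (iter_lin m lS)) hz addr0 iterSr.
  move=> _ [x Mx <-]; exists (S x); first by apply: SM; exists x.
  by rewrite -iterSr.
Qed.

(** * Finite descent under perturbation by scalars *)

Lemma ker_in_shift_range S M l d z : lin S -> subspace M -> S @` M `<=` M ->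
  l != 0 -> M z -> iter d S z = 0 -> (shift S l @` M) z.
Proof.
move=> lS sM SM l0; elim: d z => [|d IH] z Mz hz.
  by exists 0; [case: sM|rewrite /shift (lin0 lS) scaler0 subr0 -hz].
have [||y My hy] := IH (S z).
- by apply: SM; exists z.
- by rewrite -iterSr.
(* Inverts [S - l] on a space where [S] is nilpotent: [y] solves the equation for [S z], which a
   lower power of [S] kills. *)
exists (- (l^-1 *: (z - y))); first by apply: subN => //; apply: subZ => //; apply: subB.
rewrite /shift (linN lS) (linZ lS) (linB lS) -{}hy /shift.
by lmod_split R[i]; field.
Qed.

(** Descent [d] means that [M] is the image plus the kernel of S^d. Solving with [S] instead of
    [S - l] leaves the residual [l *: x], at most half of [v] once |l| < 1/(2C), so the image of
    [S - l] plus that kernel is still [M]. The kernel lies in the image when [l] is nonzero, and is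
    zero when [d] is 0; the second case keeps [l = 0] available. *)
Lemma descent_perturb S M d : bop S -> subspace M -> closed M -> S @` M `<=` M ->
  iter d S @` M = iter d.+1 S @` M -> exists2 e : R, 0 < e &
    forall l, nm l < e -> l != 0 \/ d = 0%N -> shift S l @` M = M.
Proof.
move=> bS sM cM SM hd; have [lS _] := bS.
pose Z := [set x | M x /\ iter d S x = 0].
have sZ : subspace Z by apply: sub_ker => //; exact: iter_lin.
have cZ : closed Z by apply: closed_ker => //; exact: iter_bop.
have VE : addS (S @` M) Z = M.
  rewrite eqEsubset; split; first by apply: addS_le => // x [].
  move=> x Mx; have [y My hy] : (iter d.+1 S @` M) (iter d S x) by rewrite -hd; exists x.
  exists (S y), (x - S y); split; [by exists y| |by lmod R[i]].
  split; first by apply: subB => //; apply: SM; exists y.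
  by rewrite (linB (iter_lin d lS)) -iterSr hy subrr.
have [|C C0 hC] := open_mapping bS sM cM sZ cZ; first by rewrite VE.
rewrite VE in hC.
exists (1 / (2 * C)); first by rewrite divr_gt0 // mulr_gt0.
move=> l hl ld; rewrite eqEsubset; split; first exact: shift_inv.
move=> v Mv.
have [|x [z [Mx [Mz hz] -> _]]] := @successive_approximation (shift S l) M Z M C
  (shift_bop l bS) sM cM sZ cZ (ltW C0) _ v Mv.
  move=> {v Mv} v Mv; have [x [z [Mx Zz e nx]]] := hC v Mv.
  exists x, z; split=> //.
  - have -> : v - (shift S l x + z) = l *: x by rewrite e /shift; lmod R[i].
    exact: subZ.
  - have -> : v - (shift S l x + z) = l *: x by rewrite e /shift; lmod R[i].
    rewrite nmZ; move: hl; rewrite ltr_pdivlMr ?mulr_gt0 // => hl.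
    have := nm_ge0 l; have := nm_ge0 x; have := nm_ge0 v; nra.
apply: subD; [|by exists x|].
  by apply: image_sub => //; have [] := shift_bop l bS.
case: ld => [l0|d0]; first exact: ker_in_shift_range hz.
move: hz; rewrite d0 /= => ->.
exists 0; first by case: sM.
by rewrite lin0 //; have [] := shift_bop l bS.
Qed.

(** A Neumann series: -v/l solves the equation up to S v / l, at most half of [v] when |l| exceeds
    2K. *)
Lemma surjective_shift_large S M : bop S -> subspace M -> closed M -> S @` M `<=` M ->
  exists B : R, forall l, B < nm l -> surjective_on M (shift S l).
Proof.
move=> bS sM cM SM; have [lS [K K0 hK]] := bS; exists (2 * K) => l hl.
have l0 : l != 0 by apply/eqP => l0; move: hl; rewrite l0 nm0; lra.
rewrite /surjective_on eqEsubset; split; first exact: shift_inv.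
move=> v Mv; have C0 : 0 <= (nm l)^-1 by rewrite invr_ge0 nm_ge0.
have [|x [z [Mx -> -> _]]] := @successive_approximation (shift S l) M [set 0] M (nm l)^-1
  (shift_bop l bS) sM cM sub_set0 closed_set0 C0 _ v Mv; last by exists x; rewrite ?addr0.
move=> {v Mv} v Mv; exists (- (l^-1 *: v)), 0.
have -> : v - (shift S l (- (l^-1 *: v)) + 0) = l^-1 *: S v.
  by rewrite /shift (linN lS) (linZ lS); lmod_split R[i]; field.
split=> //.
- by apply: subN => //; exact: subZ.
- by apply: subZ => //; apply: SM; exists v.
- by rewrite nmN nmZ nmV.
- rewrite nmZ nmV mulrC ler_pdivrMr; last by apply: lt_trans hl; lra.
  have := hK v; have := nm_ge0 v; nra.
Qed.

(** * Finite descent for Riesz operators *)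

Definition has_descent S M := exists d : nat, iter d S @` M = iter d.+1 S @` M.

Lemma descent_surjective_near S M l : bop S -> subspace M -> closed M ->
  S @` M `<=` M -> has_descent (shift S l) M ->
  exists2 e : R, 0 < e & forall m, m != l -> nm (m - l) < e -> surjective_on M (shift S m).
Proof.
move=> bS sM cM SM [d hd].
have [e e0 he] := descent_perturb (shift_bop l bS) sM cM (@shift_inv S M l sM SM) hd.
exists e => // m ml hm; have := he (m - l) hm.
rewrite shift_shift subrKC; apply.
by left; rewrite subr_eq0.
Qed.

(** Without descent at [l], an eigen family forbids descent at every nearby point, in particular
    descent 0, which is surjectivity. *)
Lemma limit_surjective_descent S M l : bop S -> subspace M -> closed M ->
  S @` M `<=` M -> finite_codim_in M (shift S l @` M) ->
  (forall e : R, 0 < e -> exists2 m, nm (m - l) < e & surjective_on M (shift S m)) ->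
  has_descent (shift S l) M.
Proof.
move=> bS sM cM SM fM hl; apply: contrapT => nd.
have AM := @shift_inv S M l sM SM; have bA := shift_bop l bS.
have [|e e0 he] := eigen_no_descent (proj1 bA) sM AM.
  by apply: cofinite_eigen_family => // d hd; apply: nd; exists d.
have [m hm sm] := hl e e0.
apply: (he (m - l) hm 0%N); rewrite shift_shift subrKC /=.
by rewrite sm image_id.
Qed.

(* The set of [l <> 0] with [S - l] of finite descent is open and relatively
   closed, and contains all large [l]; follow the ray through [l]. *)
Lemma riesz_descent S N l : bop S -> subspace N -> closed N -> S @` N `<=` N ->
  riesz_on N S -> l != 0 -> has_descent (shift S l) N.
Proof.
move=> bS sN cN SN rS l0; apply: contrapT => nd.
have [B hB] := surjective_shift_large bS sN cN SN.
have sd m : surjective_on N (shift S m) -> has_descent (shift S m) N.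
  by move=> h; exists 0%N; rewrite /= image_id h.
have nl := nm_gt0 l0.
(* The ray is parametrised by [t], with [l] itself at 1; [E] collects the failures and is bounded
   because large shifts are surjective. *)
pose E : set R := [set t | 1 <= t /\ ~ has_descent (shift S ((t%:C)%C * l)) N].
have nt (t : R) : 1 <= t -> nm ((t%:C)%C * l) = t * nm l.
  by move=> t1; rewrite nmM nmR ger0_norm //; lra.
have ntB (s t : R) : nm ((s%:C)%C * l - (t%:C)%C * l) = `|s - t| * nm l.
  by rewrite -mulrBl nmM -rmorphB nmR.
have tl0 (t : R) : 1 <= t -> (t%:C)%C * l != 0.
  move=> t1; rewrite mulf_neq0 // -(rmorph0 (real_complex R)) (inj_eq (@complexI R)).
  by rewrite gt_eqF //; lra.
have E1 : E 1 by split=> //; rewrite rmorph1 mul1r.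
have sE : has_sup E.
  split; first by exists 1.
  exists (`|B| / nm l) => t [t1 ht]; rewrite leNgt; apply/negP => h; apply: ht.
  apply: sd; apply: hB; rewrite nt //; move: h; rewrite ltr_pdivrMr //.
  by apply: le_lt_trans; exact: ler_norm.
pose s := sup E; have s1 : 1 <= s by apply: ub_le_sup => //; case: sE.
have hs : has_descent (shift S ((s%:C)%C * l)) N.
  apply: limit_surjective_descent => //.
    by have [_] := rS _ (tl0 _ s1).
  (* Just beyond the supremum descent holds, hence surjectivity at points still closer; the two
     displacements are at most e/3 and e/2. *)
  move=> e e0; pose t := s + e / (3 * nm l).
  have t0 : 0 < e / (3 * nm l) by rewrite divr_gt0 // mulr_gt0.
  have t1 : 1 <= t by rewrite /t; lra.
  have ht : has_descent (shift S ((t%:C)%C * l)) N.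
    apply: contrapT => h; have : t <= s by apply: ub_le_sup; [case: sE|split].
    by rewrite /t; lra.
  have [e' e0' he'] := descent_surjective_near bS sN cN SN ht.
  pose r := Num.min (e / 2) (e' / 2) / nm l.
  have m0 : 0 < Num.min (e / 2) (e' / 2) by rewrite lt_min !divr_gt0.
  have r0 : 0 < r by rewrite divr_gt0.
  have rE : r * nm l = Num.min (e / 2) (e' / 2) by rewrite /r divfK // gt_eqF.
  exists (((t + r)%:C)%C * l).
    rewrite ntB; have -> : t + r - s = e / (3 * nm l) + r by rewrite /t [s + _]addrC addrAC addrK.
    rewrite ger0_norm; last by lra.
    rewrite mulrDl rE; have -> : e / (3 * nm l) * nm l = e / 3 by field; rewrite gt_eqF.
    have : Num.min (e / 2) (e' / 2) <= e / 2 by rewrite ge_min lexx.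
    by lra.
  apply: he'.
    rewrite -subr_eq0; apply/eqP => h; have := ntB (t + r) t; rewrite h nm0.
    by rewrite addrAC subrr add0r ger0_norm ?ltW // rE; lra.
  rewrite ntB addrAC subrr add0r ger0_norm ?ltW // rE.
  have : Num.min (e / 2) (e' / 2) <= e' / 2 by rewrite ge_min lexx orbT.
  by lra.
(* Descent at the supremum makes points just below it surjective, yet [E] accumulates there or
   contains it. *)
have [e e0 he] := descent_surjective_near bS sN cN SN hs.
have [t [t1 ht] st] : exists2 t, E t & s - e / nm l < t.
  by apply: sup_adherent sE => //; exact: divr_gt0.
have ts : t <= s by apply: ub_le_sup; [case: sE|split].
apply: ht.
have [->|tns] := eqVneq t s; first exact: hs.
apply: sd; apply: he.
  rewrite -subr_eq0; apply/eqP => h; have := ntB t s; rewrite h nm0 => /esym/eqP.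
  by rewrite mulf_eq0 normr_eq0 subr_eq0 (negPf tns) gt_eqF.
rewrite ntB ler0_norm ?subr_le0 // opprB -ltr_pdivlMr //; lra.
Qed.

Lemma riesz_surjective_near S N l : bop S -> subspace N -> closed N ->
  S @` N `<=` N -> riesz_on N S -> l != 0 ->
  exists2 e : R, 0 < e & forall m, m != l -> nm (m - l) < e -> surjective_on N (shift S m).
Proof.
move=> bS sN cN SN rS l0; apply: descent_surjective_near => //.
exact: riesz_descent.
Qed.

End Operators.

(** * Identity theorem for complex-differentiable functions *)

Section DiscreteCauchy.
Context {R : realType}.
Local Notation C := R[i].

(* Dyadic midpoint sums for the integral of [k] along the segment from [p] to
   [q].  They are exactly additive under bisection and exact on affine
   functions, so the quadrisection proof of Cauchy's theorem needs no
   integration theory. *)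
Fixpoint edge (k : C -> C) n p q : C :=
  if n is m.+1 then edge k m p ((p + q) / 2) + edge k m ((p + q) / 2) q
  else k ((p + q) / 2) * (q - p).

Lemma edge_sym k n p q : edge k n q p = - edge k n p q.
Proof.
elim: n p q => [|n IH] p q /=; first by rewrite (addrC q p); ring.
by rewrite (addrC q p); set m := (p + q) / 2; rewrite (IH m q) (IH p m); ring.
Qed.

Lemma edge_lin (a : C) k1 k2 n p q :
  edge (fun z => a * k1 z + k2 z) n p q = a * edge k1 n p q + edge k2 n p q.
Proof. by elim: n p q => [|n IH] p q /=; [ring|rewrite !IH; ring]. Qed.

Lemma edge_affine (a b : C) n p q :
  edge (fun z => a + b * z) n p q = a * (q - p) + b * (q ^+ 2 - p ^+ 2) / 2.
Proof. by elim: n p q => [|n IH] p q /=; [field|rewrite !IH; field]. Qed.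

(** [edge] evaluates its integrand only at iterated midpoints, so this weak convexity suffices for
    estimates. *)
Definition midclosed (D : set C) := forall x y, D x -> D y -> D ((x + y) / 2).

Lemma nm_half (z : C) : nm (z / 2) = nm z / 2.
Proof.
by rewrite nmM nmV -(rmorph_nat (real_complex R)) nmR ger0_norm.
Qed.

Lemma edge_bound (D : set C) k n p q (B : R) : midclosed D -> D p -> D q ->
  (forall z, D z -> nm (k z) <= B) -> nm (edge k n p q) <= B * nm (q - p).
Proof.
move=> mD Dp Dq hB; elim: n p q Dp Dq => [|n IH] p q Dp Dq /=.
  by rewrite nmM; apply: ler_wpM2r; [exact: nm_ge0|apply: hB; exact: mD].
have Dm := mD _ _ Dp Dq; apply: le_trans (nmD _ _) _.
apply: le_trans (lerD (IH _ _ Dp Dm) (IH _ _ Dm Dq)) _.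
have -> : (p + q) / 2 - p = (q - p) / 2 by field.
have -> : q - (p + q) / 2 = (q - p) / 2 by field.
by rewrite nm_half; lra.
Qed.

(** Meant for 1/(z - a): a lower bound for the imaginary part stands in for the exact value of its
    integral. *)
Lemma edge_im (D : set C) k n p q (L : R) : midclosed D -> D p -> D q ->
  (forall z, D z -> L <= complex.Im (k z * (q - p))) -> L <= complex.Im (edge k n p q).
Proof.
move=> mD; elim: n p q L => [|n IH] p q L Dp Dq hL /=; first by apply: hL; exact: mD.
have Dm := mD _ _ Dp Dq.
have half (z d : C) : complex.Im (z * (d / 2)) = complex.Im (z * d) / 2.
  have -> : d / 2 = (2^-1%:C)%C * d by rewrite fmorphV /= rmorph_nat mulrC.
  by case: z d => a b [c e] /=; field.
have h1 : L / 2 <= complex.Im (edge k n p ((p + q) / 2)).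
  apply: IH => // z Dz; have -> : (p + q) / 2 - p = (q - p) / 2 by field.
  by rewrite half; have := hL z Dz; lra.
have h2 : L / 2 <= complex.Im (edge k n ((p + q) / 2) q).
  apply: IH => // z Dz; have -> : q - (p + q) / 2 = (q - p) / 2 by field.
  by rewrite half; have := hL z Dz; lra.
by rewrite raddfD /=; lra.
Qed.

(** * Cauchy's theorem on parallelograms *)

Definition loop k n p w u := edge k n p (p + w) + edge k n (p + w) (p + w + u)
  + edge k n (p + w + u) (p + u) + edge k n (p + u) p.

Definition pgram (p w u : C) : set C := [set z | exists x y : R,
  [/\ 0 <= x <= 1, 0 <= y <= 1 & z = p + (x%:C)%C * w + (y%:C)%C * u]].

(** One level of [edge] is one bisection, so the split is exact, with the level dropping by one; the
    four inner sides are traversed in both directions and cancel. *)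
Lemma loop_split k n p w u : loop k n.+1 p w u =
  loop k n p (w / 2) (u / 2) + loop k n (p + w / 2) (w / 2) (u / 2)
  + loop k n (p + w / 2 + u / 2) (w / 2) (u / 2) + loop k n (p + u / 2) (w / 2) (u / 2).
Proof.
(* The nine vertices of the subdivided parallelogram, with coordinates 0, 1, 2. *)
pose P (x y : C) := p + (x / 2) * w + (y / 2) * u.
have cE (a b c d : C) : a = c -> b = d -> edge k n a b = edge k n c d by move=> -> ->.
rewrite /loop /=.
have -> : edge k n p ((p + (p + w)) / 2) = edge k n (P 0 0) (P 1 0)
  by apply: cE; rewrite /P; field.
have -> : edge k n ((p + (p + w)) / 2) (p + w) = edge k n (P 1 0) (P 2 0)
  by apply: cE; rewrite /P; field.
have -> : edge k n (p + w) ((p + w + (p + w + u)) / 2) = edge k n (P 2 0) (P 2 1)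
  by apply: cE; rewrite /P; field.
have -> : edge k n ((p + w + (p + w + u)) / 2) (p + w + u) = edge k n (P 2 1) (P 2 2)
  by apply: cE; rewrite /P; field.
have -> : edge k n (p + w + u) ((p + w + u + (p + u)) / 2) = edge k n (P 2 2) (P 1 2)
  by apply: cE; rewrite /P; field.
have -> : edge k n ((p + w + u + (p + u)) / 2) (p + u) = edge k n (P 1 2) (P 0 2)
  by apply: cE; rewrite /P; field.
have -> : edge k n (p + u) ((p + u + p) / 2) = edge k n (P 0 2) (P 0 1)
  by apply: cE; rewrite /P; field.
have -> : edge k n ((p + u + p) / 2) p = edge k n (P 0 1) (P 0 0)
  by apply: cE; rewrite /P; field.
have -> : edge k n p (p + w / 2) = edge k n (P 0 0) (P 1 0)
  by apply: cE; rewrite /P; field.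
have -> : edge k n (p + w / 2) (p + w / 2 + u / 2) = edge k n (P 1 0) (P 1 1)
  by apply: cE; rewrite /P; field.
have -> : edge k n (p + w / 2 + u / 2) (p + u / 2) = edge k n (P 1 1) (P 0 1)
  by apply: cE; rewrite /P; field.
have -> : edge k n (p + u / 2) p = edge k n (P 0 1) (P 0 0)
  by apply: cE; rewrite /P; field.
have -> : edge k n (p + w / 2) (p + w / 2 + w / 2) = edge k n (P 1 0) (P 2 0)
  by apply: cE; rewrite /P; field.
have -> : edge k n (p + w / 2 + w / 2) (p + w / 2 + w / 2 + u / 2) = edge k n (P 2 0) (P 2 1)
  by apply: cE; rewrite /P; field.
have -> : edge k n (p + w / 2 + w / 2 + u / 2) (p + w / 2 + u / 2) = edge k n (P 2 1) (P 1 1)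
  by apply: cE; rewrite /P; field.
have -> : edge k n (p + w / 2 + u / 2) (p + w / 2) = edge k n (P 1 1) (P 1 0)
  by apply: cE; rewrite /P; field.
have -> : edge k n (p + w / 2 + u / 2) (p + w / 2 + u / 2 + w / 2) = edge k n (P 1 1) (P 2 1)
  by apply: cE; rewrite /P; field.
have -> : edge k n (p + w / 2 + u / 2 + w / 2) (p + w / 2 + u / 2 + w / 2 + u / 2)
  = edge k n (P 2 1) (P 2 2) by apply: cE; rewrite /P; field.
have -> : edge k n (p + w / 2 + u / 2 + w / 2 + u / 2) (p + w / 2 + u / 2 + u / 2)
  = edge k n (P 2 2) (P 1 2) by apply: cE; rewrite /P; field.
have -> : edge k n (p + w / 2 + u / 2 + u / 2) (p + w / 2 + u / 2) = edge k n (P 1 2) (P 1 1)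
  by apply: cE; rewrite /P; field.
have -> : edge k n (p + u / 2) (p + u / 2 + w / 2) = edge k n (P 0 1) (P 1 1)
  by apply: cE; rewrite /P; field.
have -> : edge k n (p + u / 2 + w / 2) (p + u / 2 + w / 2 + u / 2) = edge k n (P 1 1) (P 1 2)
  by apply: cE; rewrite /P; field.
have -> : edge k n (p + u / 2 + w / 2 + u / 2) (p + u / 2 + u / 2) = edge k n (P 1 2) (P 0 2)
  by apply: cE; rewrite /P; field.
have -> : edge k n (p + u / 2 + u / 2) (p + u / 2) = edge k n (P 0 2) (P 0 1)
  by apply: cE; rewrite /P; field.
rewrite (edge_sym k n (P 1 0) (P 1 1)) (edge_sym k n (P 0 1) (P 1 1)).
rewrite (edge_sym k n (P 1 1) (P 2 1)) (edge_sym k n (P 1 1) (P 1 2)).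
by ring.
Qed.

Lemma pgram_mid p w u : midclosed (pgram p w u).
Proof.
move=> _ _ [x [y [/andP [x0 x1] /andP [y0 y1] ->]]] [x' [y' [/andP [x0' x1'] /andP [y0' y1'] ->]]].
exists ((x + x') / 2), ((y + y') / 2); split; [by apply/andP; split; lra..|].
by rewrite !rmorphM !rmorphD !fmorphV /= !rmorph_nat; field.
Qed.

Lemma pgram_vertex p w u : [/\ pgram p w u p, pgram p w u (p + w),
  pgram p w u (p + w + u) & pgram p w u (p + u)].
Proof.
have h0 : 0 <= (0 : R) <= 1 by rewrite lexx ler01.
have h1 : 0 <= (1 : R) <= 1 by rewrite lexx ler01.
split; [exists 0, 0|exists 1, 0|exists 1, 1|exists 0, 1]; split=> //;
  by rewrite ?rmorph0 ?rmorph1; ring.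
Qed.

Lemma pgram_dist p w u z z' : pgram p w u z -> pgram p w u z' ->
  nm (z - z') <= nm w + nm u.
Proof.
move=> [x [y [/andP [x0 x1] /andP [y0 y1] ->]]] [x' [y' [/andP [x0' x1'] /andP [y0' y1'] ->]]].
have -> : p + (x%:C)%C * w + (y%:C)%C * u - (p + (x'%:C)%C * w + (y'%:C)%C * u)
    = ((x - x')%:C)%C * w + ((y - y')%:C)%C * u by rewrite !rmorphB /=; ring.
apply: le_trans (nmD _ _) _; rewrite !nmM !nmR.
have hx : `|x - x'| <= 1 by rewrite ler_norml; apply/andP; split; lra.
have hy : `|y - y'| <= 1 by rewrite ler_norml; apply/andP; split; lra.
have := nm_ge0 w; have := nm_ge0 u; nra.
Qed.

Lemma loop_bound k n p w u (B : R) : (forall z, pgram p w u z -> nm (k z) <= B) ->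
  nm (loop k n p w u) <= 2 * B * (nm w + nm u).
Proof.
move=> hB; have [v1 v2 v3 v4] := pgram_vertex p w u.
have e a b (Da : pgram p w u a) (Db : pgram p w u b) :=
  @edge_bound _ k n a b B (@pgram_mid p w u) Da Db hB.
have := e _ _ v1 v2; have := e _ _ v2 v3; have := e _ _ v3 v4; have := e _ _ v4 v1.
have -> : p - (p + u) = - u by ring.
have -> : p + u - (p + w + u) = - w by ring.
have -> : p + w + u - (p + w) = u by ring.
have -> : p + w - p = w by ring.
rewrite !nmN => h1 h2 h3 h4; rewrite /loop.
apply: le_trans (nmD _ _) _; have := nmD (edge k n p (p + w) + edge k n (p + w) (p + w + u)) (edge k n (p + w + u) (p + u)).
have := nmD (edge k n p (p + w)) (edge k n (p + w) (p + w + u)).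
lra.
Qed.

(** Compactness by quadrisection: a property that passes from four quarters to the whole, and holds
    for small parallelograms around each point, holds. A counterexample would have failing quarters
    shrinking to one point. *)
Lemma cousin (P : C -> C -> C -> Prop) p w u :
  (forall p w u, P p (w / 2) (u / 2) -> P (p + w / 2) (w / 2) (u / 2) ->
    P (p + w / 2 + u / 2) (w / 2) (u / 2) -> P (p + u / 2) (w / 2) (u / 2) -> P p w u) ->
  (forall z, pgram p w u z -> exists2 d : R, 0 < d & forall p' w' u',
    pgram p' w' u' z -> nm w' + nm u' < d -> P p' w' u') ->
  P p w u.
Proof.
move=> split_ loc; apply: contrapT => nP.
have /choice [c hc] (q : C * (C * C)) : exists c : bool * bool, ~ P q.1 q.2.1 q.2.2 ->
    ~ P (q.1 + c.1%:R * (q.2.1 / 2) + c.2%:R * (q.2.2 / 2)) (q.2.1 / 2) (q.2.2 / 2).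
  case: q => q [w' u'] /=; apply: contrapT => /forallNP h.
  have nPq : ~ P q w' u' by move=> Pq; apply: (h (false, false)).
  have ok (a b : bool) : P (q + a%:R * (w' / 2) + b%:R * (u' / 2)) (w' / 2) (u' / 2).
    by apply: contrapT => nh; apply: (h (a, b)).
  apply: nPq; apply: split_.
  - by have := ok false false; rewrite !mul0r !addr0.
  - by have := ok true false; rewrite mul0r mul1r addr0.
  - by have := ok true true; rewrite !mul1r.
  - by have := ok false true; rewrite mul0r mul1r addr0.
pose q n := iter n (fun q : C * (C * C) =>
  (q.1 + (c q).1%:R * (q.2.1 / 2) + (c q).2%:R * (q.2.2 / 2), (q.2.1 / 2, q.2.2 / 2)))
  (p, (w, u)).
have nPq n : ~ P (q n).1 (q n).2.1 (q n).2.2.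
  by elim: n => [|n IH] //=; exact: (hc (q n)).
have t2 n : ((2 ^+ n)%:C)%C != 0 :> C.
  by rewrite -(rmorph0 (real_complex R)) (inj_eq (@complexI R)) expf_neq0.
have qw n : (q n).2.1 = w / ((2 ^+ n)%:C)%C.
  elim: n => [|n IH]; first by rewrite /= rmorph1 divr1.
  rewrite /= IH exprS rmorphM /= rmorph_nat; field; exact: t2.
have qu n : (q n).2.2 = u / ((2 ^+ n)%:C)%C.
  elim: n => [|n IH]; first by rewrite /= rmorph1 divr1.
  rewrite /= IH exprS rmorphM /= rmorph_nat; field; exact: t2.
(* The choices of quarters are the binary digits of the two coordinates of the common point. *)
pose a n : R := (c (q n)).1%:R / 2 / 2 ^+ n; pose b n : R := (c (q n)).2%:R / 2 / 2 ^+ n.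
have qp n : (q n).1 = p + ((\sum_(i < n) a i)%:C)%C * w + ((\sum_(i < n) b i)%:C)%C * u.
  elim: n => [|n IH]; first by rewrite !big_ord0 rmorph0 !mul0r !addr0.
  rewrite [LHS]/= {1}IH qw qu !big_ord_recr /= !rmorphD /a /b !rmorphM !fmorphV /=.
  rewrite !rmorph_nat; have := t2 n; rewrite !rmorphXn /= !rmorph_nat => h; field; exact: h.
have bits (v : nat -> bool) : exists x : R, forall n,
    0 <= (x - \sum_(i < n) (v i)%:R / 2 / 2 ^+ i) * 2 ^+ n <= 1.
  pose f i : R := (v i)%:R / 2 / 2 ^+ i.
  have f0 i : 0 <= f i by rewrite !divr_ge0 // exprn_ge0.
  have [i|x hx] := @geometricR _ f (1 / 2).
    rewrite ger0_norm // /f; apply: ler_wpM2r; first by rewrite invr_ge0 exprn_ge0.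
    by apply: ler_wpM2r => //; case: (v i).
  have {}hx n : `|x - \sum_(i < n) f i| <= 1 / 2 ^+ n.
    by have := hx n; rewrite mulrA mulr1 mulfV.
  exists x => n; have p2 : 0 < 2 ^+ n :> R by rewrite exprn_gt0.
  have := hx n; rewrite ler_norml => /andP [_ h2].
  rewrite -ler_pdivlMr // h2 andbT; apply: mulr_ge0; last exact: ltW.
  rewrite subr_ge0; apply: le_all_eps => e e0; have [N hN] := pow2_small 1 e0.
  have := hx (N + n)%N; rewrite ler_norml => /andP [h3 _].
  have mono : \sum_(i < n) f i <= \sum_(i < N + n) f i.
    elim: N {hN h3} => // N IH; apply: le_trans IH _.
    by rewrite addSn [leRHS]big_ord_recr /= lerDl.
  have : 1 / 2 ^+ (N + n) <= 1 / 2 ^+ N :> R.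
    by rewrite ler_pM2l // lef_pV2 ?posrE ?exprn_gt0 // ler_weXn2l ?ler1n // leq_addr.
  lra.
have [x hx] := bits (fun n => (c (q n)).1); have [y hy] := bits (fun n => (c (q n)).2).
have zin n : pgram (q n).1 (q n).2.1 (q n).2.2 (p + (x%:C)%C * w + (y%:C)%C * u).
  exists ((x - \sum_(i < n) a i) * 2 ^+ n), ((y - \sum_(i < n) b i) * 2 ^+ n).
  split; [exact: hx|exact: hy|].
  rewrite qp qw qu !rmorphM !rmorphB /=; field; exact: t2.
have [d d0 hd] := loc _ (zin 0%N).
have [N hN] := pow2_small (nm w + nm u) d0.
apply: (nPq N); apply: hd (zin N) _.
rewrite qw qu !nmM !nmV nmR ger0_norm ?exprn_ge0 // -mulrDl //.
Qed.

Definition cdiff (k : C -> C) z := exists b : C, forall e : R, 0 < e ->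
  exists2 d : R, 0 < d & forall v, nm (v - z) < d ->
    nm (k v - k z - b * (v - z)) <= e * nm (v - z).

(** The bound is proportional to the square of the size, so four quarters together reproduce it
    exactly. It is asked only for large [n] because the quarters of a loop live one level lower. *)
Lemma goursat k p w u (e : R) : (forall z, pgram p w u z -> cdiff k z) -> 0 < e ->
  exists N, forall n, (N <= n)%N -> nm (loop k n p w u) <= e.
Proof.
move=> hk e0; pose t := e / ((nm w + nm u) ^+ 2 + 1).
have D0 : 0 < (nm w + nm u) ^+ 2 + 1 by rewrite ltr_pwDr // sqr_ge0.
have t0 : 0 < t by rewrite divr_gt0.
suff [N hN] : exists N, forall n, (N <= n)%N -> nm (loop k n p w u) <= t * (nm w + nm u) ^+ 2.
  exists N => n /hN /le_trans; apply; rewrite /t mulrAC ler_pdivrMr //.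
  by rewrite ler_pM2l // lerDl.
apply: (@cousin (fun p w u => exists N, forall n, (N <= n)%N ->
  nm (loop k n p w u) <= t * (nm w + nm u) ^+ 2)).
  move=> p' w' u' [N1 h1] [N2 h2] [N3 h3] [N4 h4].
  exists (maxn (maxn N1 N2) (maxn N3 N4)).+1 => -[//|n].
  rewrite ltnS !geq_max => /andP [/andP [n1 n2] /andP [n3 n4]].
  rewrite loop_split; move: (h1 n n1) (h2 n n2) (h3 n n3) (h4 n n4).
  rewrite !nm_half.
  set A := loop _ _ _ _ _; set B := loop _ _ _ _ _; set E := loop _ _ _ _ _; set F := loop _ _ _ _ _.
  have := nmD (A + B + E) F; have := nmD (A + B) E; have := nmD A B.
  have -> : t * (nm w' / 2 + nm u' / 2) ^+ 2 = t * (nm w' + nm u') ^+ 2 / 4 by field.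
  lra.
move=> z /hk [b hb]; have [|d d0 hd] := hb (t / 2); first by rewrite divr_gt0.
exists d => // p' w' u' pz hd'; exists 0%N => n _.
(* Removing the first-order part leaves the loop unchanged, since on affine functions [edge] is a
   difference of values at the endpoints. *)
pose g v := k v - k z - b * (v - z).
have -> : loop k n p' w' u' = loop g n p' w' u'.
  have kE x y : edge k n x y = edge g n x y + (k z - b * z) * (y - x) + b * (y ^+ 2 - x ^+ 2) / 2.
    rewrite -addrA -(edge_affine (k z - b * z) b n x y) -[edge g n x y]mul1r -edge_lin.
    congr edge.
    by apply/funext => v; rewrite /g; ring.
  by rewrite /loop !kE; field.
apply: le_trans (@loop_bound g n p' w' u' (t / 2 * (nm w' + nm u')) _) _; last first.
  by rewrite le_eqVlt; apply/orP; left; apply/eqP; field.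
move=> v pv; have hv := pgram_dist pv pz.
apply: le_trans (hd _ (le_lt_trans hv hd')) _.
by rewrite ler_pM2l // divr_gt0.
Qed.

Lemma pgram_half p w u (x0 y0 : bool) z :
  pgram (p + x0%:R * (w / 2) + y0%:R * (u / 2)) (w / 2) (u / 2) z ->
  exists x y : R, [/\ x0%:R / 2 <= x <= 1, y0%:R / 2 <= y <= 1 &
    z = p + (x%:C)%C * w + (y%:C)%C * u].
Proof.
move=> [x [y [/andP [x1 x2] /andP [y1 y2] ->]]].
exists ((x0%:R + x) / 2), ((y0%:R + y) / 2); split.
- by case: x0 => /=; apply/andP; split; lra.
- by case: y0 => /=; apply/andP; split; lra.
by rewrite !rmorphM !rmorphD !fmorphV /= !rmorph_nat; field.
Qed.

Lemma pgram_half_sub p w u (x0 y0 : bool) :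
  pgram (p + x0%:R * (w / 2) + y0%:R * (u / 2)) (w / 2) (u / 2) `<=` pgram p w u.
Proof.
move=> z /pgram_half [x [y [/andP [x1 x2] /andP [y1 y2] ->]]]; exists x, y; split=> //.
  by apply/andP; split=> //; apply: le_trans x1; exact: divr_ge0.
by apply/andP; split=> //; apply: le_trans y1; exact: divr_ge0.
Qed.

(* Cauchy's theorem with an exceptional vertex near which [k] is bounded:
   quadrisection leaves only the smaller copy at that vertex. *)
Lemma goursat_vertex k a w u (e : R) :
  (forall x y : R, (x%:C)%C * w + (y%:C)%C * u = 0 -> x = 0 /\ y = 0) ->
  (forall z, pgram a w u z -> z != a -> cdiff k z) ->
  (exists B d : R, 0 < d /\ forall v, nm (v - a) < d -> nm (k v) <= B) ->
  0 < e -> exists N, forall n, (N <= n)%N -> nm (loop k n a w u) <= e.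
Proof.
move=> free hk [B0 [d [d0 hB0]]] e0; pose B := `|B0|.
have hB v : nm (v - a) < d -> nm (k v) <= B by move=> /hB0 /le_trans; apply; exact: ler_norm.
have key m w' u' t :
    (forall x y : R, (x%:C)%C * w' + (y%:C)%C * u' = 0 -> x = 0 /\ y = 0) ->
    (forall z, pgram a w' u' z -> z != a -> cdiff k z) -> 0 < t ->
    (nm w' + nm u') / 2 ^+ m < d -> exists N, forall n, (N <= n)%N ->
      nm (loop k n a w' u') <= 2 * B * (nm w' + nm u') / 2 ^+ m + t.
  elim: m w' u' t => [|m IH] w' u' t fr hk' t0 small.
    exists 0%N => n _; rewrite expr0 divr1.
    have := @loop_bound k n a w' u' B; rewrite expr0 divr1 in small.
    have [v1 _ _ _] := pgram_vertex a w' u'.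
    move=> h; apply: le_trans (h _) _; last by lra.
    by move=> z pz; apply: hB; exact: le_lt_trans (pgram_dist pz v1) small.
  (* The allowance [t] is split into t/6 for each of the three quarters away from [a] and t/2 for
     the one at [a]. *)
  have t6 : 0 < t / 6 by lra.
  have sub x0 y0 : (x0 || y0) -> exists N, forall n, (N <= n)%N ->
      nm (loop k n (a + x0%:R * (w' / 2) + y0%:R * (u' / 2)) (w' / 2) (u' / 2)) <= t / 6.
    move=> xy; apply: goursat => // z pz.
    apply: hk'; first exact: pgram_half_sub pz.
    have [x [y [/andP [x1 _] /andP [y1 _] ->]]] := pgram_half pz.
    apply/eqP => za; have [|xx yy] := fr x y.
      by apply: (addrI a); rewrite addrA za addr0.
    by move: x1 y1 xy {pz}; rewrite xx yy; case: x0; case: y0 => //=; lra.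
  have [N1 h1] := sub true false isT; have [N2 h2] := sub true true isT.
  have [N3 h3] := sub false true isT.
  have [||||N4 h4] := IH (w' / 2) (u' / 2) (t / 2).
  - by move=> x y exy; apply: fr; rewrite -[RHS](mulr0 2) -exy; field.
  - move=> z pz; apply: hk'.
    by apply: (@pgram_half_sub a w' u' false false); rewrite !mul0r !addr0.
  - by lra.
  - by move: small; rewrite !nm_half exprS invfM mulrA; congr (_ * _ < _); field.
  exists (maxn (maxn N1 N2) (maxn N3 N4)).+1 => -[//|n].
  rewrite ltnS !geq_max => /andP [/andP [n1 n2] /andP [n3 n4]].
  move: (h1 n n1) (h2 n n2) (h3 n n3) (h4 n n4); rewrite loop_split !mul1r !mul0r !addr0.
  set P1 := loop _ _ _ _ _; set P2 := loop _ _ _ _ _.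
  set P3 := loop _ _ _ _ _; set P4 := loop _ _ _ _ _.
  have := nmD (P4 + P1 + P2) P3; have := nmD (P4 + P1) P2; have := nmD P4 P1.
  rewrite !nm_half.
  have -> : 2 * B * (nm w' / 2 + nm u' / 2) / 2 ^+ m
     = 2 * B * (nm w' + nm u') / 2 ^+ m.+1 by rewrite exprS; field; rewrite expf_neq0.
  lra.
have [m1 hm1] := pow2_small (nm w + nm u) d0.
have e2 : 0 < e / 2 by lra.
have [m2 hm2] := pow2_small (2 * B * (nm w + nm u)) e2.
have mono (D : R) m m' : (m <= m')%N -> 0 <= D -> D / 2 ^+ m' <= D / 2 ^+ m.
  move=> mm D0; apply: ler_wpM2l => //.
  by rewrite lef_pV2 ?posrE ?exprn_gt0 // ler_weXn2l // ler1n.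
have D0 : 0 <= nm w + nm u by rewrite addr_ge0 ?nm_ge0.
have [|N hN] := key (maxn m1 m2) w u (e / 2) free hk e2.
  by apply: le_lt_trans hm1; apply: mono => //; exact: leq_maxl.
exists N => n /hN /le_trans; apply.
have h2 := mono (2 * B * (nm w + nm u)) m2 (maxn m1 m2) (leq_maxr _ _).
have : 0 <= 2 * B * (nm w + nm u) by rewrite mulr_ge0 // mulr_ge0 // normr_ge0.
by move=> /h2; lra.
Qed.

(** * Rules for complex derivatives *)

Lemma cdiff_near k k' z : cdiff k z ->
  (exists2 d : R, 0 < d & forall v, nm (v - z) < d -> k v = k' v) -> cdiff k' z.
Proof.
move=> [b hb] [d d0 hd]; exists b => e /hb [d' d0' hd'].
have zd : nm (z - z) < d by rewrite subrr nm0.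
exists (Num.min d d'); first by rewrite lt_min d0.
by move=> v; rewrite lt_min => /andP [h1 h2]; rewrite -!hd //; exact: hd'.
Qed.

Lemma cdiff_cst (c : C) z : cdiff (fun=> c) z.
Proof.
exists 0 => e e0; exists 1 => // v _.
by rewrite subrr mul0r subrr nm0 mulr_ge0 ?nm_ge0 // ltW.
Qed.

Lemma cdiff_affine k (a c : C) z : cdiff k z -> cdiff (fun v => a * k v + c) z.
Proof.
move=> [b hb]; exists (a * b) => e e0.
have a0 : 0 < nm a + 1 by have := nm_ge0 a; lra.
have [|d d0 hd] := hb (e / (nm a + 1)); first exact: divr_gt0.
exists d => // v /hd h.
have -> : a * k v + c - (a * k z + c) - a * b * (v - z) = a * (k v - k z - b * (v - z)) by ring.
rewrite nmM; apply: le_trans (ler_wpM2l (nm_ge0 a) h) _.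
rewrite mulrA; apply: ler_wpM2r; first exact: nm_ge0.
rewrite mulrA ler_pdivrMr // mulrC ler_pM2l //; lra.
Qed.

Lemma cdiff_continuous k z (e : R) : cdiff k z -> 0 < e ->
  exists2 d : R, 0 < d & forall v, nm (v - z) < d -> nm (k v - k z) < e.
Proof.
move=> [b hb] e0; have [d d0 hd] := hb 1 ltr01.
have B0 : 0 < nm b + 1 by have := nm_ge0 b; lra.
exists (Num.min d (e / (nm b + 1))); first by rewrite lt_min d0 divr_gt0.
move=> v; rewrite lt_min ltr_pdivlMr // => /andP [/hd h1 h2].
have -> : k v - k z = (k v - k z - b * (v - z)) + b * (v - z) by ring.
apply: le_lt_trans (nmD _ _) _; rewrite nmM; lra.
Qed.

Lemma cdiff_div g b z : cdiff g z -> z != b -> cdiff (fun v => g v / (v - b)) z.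
Proof.
move=> [c hc] zb; pose D := z - b; have D0 : D != 0 by rewrite subr_eq0.
have nD := nm_gt0 D0.
(* [- G] is the derivative given by the quotient rule; the remainder then becomes (E + h^2 G)/(D +
   h). *)
pose G := g z / D ^+ 2 - c / D; have nG := nm_ge0 G.
exists (- G) => e e0.
have [|d1 d10 hd1] := hc (e * nm D / 4); first by rewrite divr_gt0 // mulr_gt0.
(* The three terms control the remainder of [g], keep the denominator above half of |D|, and control
   the quadratic term. *)
pose m := Num.min d1 (Num.min (nm D / 2) (e * nm D / (4 * (nm G + 1)))).
exists m.
  rewrite !lt_min d10 !divr_gt0 //=; first by rewrite mulr_gt0.
  by rewrite mulr_gt0 //; lra.
move=> v; rewrite !lt_min => /and3P [h1 h2 h3].
pose h := v - z; rewrite -/h in h1 h2 h3 *.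
have vb : v - b = D + h by rewrite /h /D; ring.
have hvb : nm D / 2 <= nm (D + h).
  have := nmB (D + h) h; rewrite addrK; lra.
have Dh0 : D + h != 0.
  by apply/eqP => e1; move: hvb; rewrite e1 nm0; lra.
pose E := g v - g z - c * h.
have -> : g v / (v - b) - g z / (z - b) - - G * h = (E + h ^+ 2 * G) / (D + h).
  rewrite vb -/D /E /G; field; by rewrite D0 Dh0.
have hE : nm E <= e * nm D / 4 * nm h by apply: hd1.
rewrite nmM nmV ler_pdivrMr; last by apply: lt_le_trans hvb; lra.
apply: le_trans (nmD _ _) _; rewrite nmM nmX.
have nh := nm_ge0 h.
have h4 : nm h * (4 * (nm G + 1)) <= e * nm D.
  by move: h3; rewrite ltr_pdivlMr ?mulr_gt0 //; last lra; move/ltW.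
have h5 : nm h ^+ 2 * nm G <= e * nm D / 4 * nm h.
  have : nm h * (nm G) <= e * nm D / 4 by nra.
  by move=> h6; have := ler_wpM2r nh h6; rewrite expr2; lra.
have h7 : e * nm h * (nm D / 2) <= e * nm h * nm (D + h).
  by apply: ler_wpM2l => //; rewrite mulr_ge0 // ltW.
lra.
Qed.

(** Compactness again through [cousin]: boundedness passes from quarters to the whole and holds
    locally by continuity. *)
Lemma bounded_on_pgram g p w u : (forall z, pgram p w u z -> cdiff g z) ->
  exists H : R, forall z, pgram p w u z -> nm (g z) <= H.
Proof.
move=> hg; apply: (@cousin (fun p w u => exists H : R, forall z, pgram p w u z -> nm (g z) <= H)).
  move=> {hg} p' w' u' [H1 h1] [H2 h2] [H3 h3] [H4 h4].
  exists (Num.max (Num.max H1 H2) (Num.max H3 H4)).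
  move=> _ [x [y [/andP [x0 x1] /andP [y0 y1] ->]]]; rewrite !le_max.
  have e2 : (2 : C) != 0 by rewrite pnatr_eq0.
  have cE (t : R) : ((2 * t)%:C)%C = 2 * (t%:C)%C :> C by rewrite rmorphM /= rmorph_nat.
  have cE1 (t : R) : ((2 * t - 1)%:C)%C = 2 * (t%:C)%C - 1 :> C by rewrite rmorphB rmorph1 /= cE.
  have [xl|xl] := leP x (1 / 2); have [yl|yl] := leP y (1 / 2).
  - apply/orP; left; apply/orP; left; apply: h1; exists (2 * x), (2 * y).
    by split; [apply/andP; split; lra|apply/andP; split; lra|rewrite !cE; field].
  - apply/orP; right; apply/orP; right; apply: h4; exists (2 * x), (2 * y - 1).
    by split; [apply/andP; split; lra|apply/andP; split; lra|rewrite cE cE1; field].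
  - apply/orP; left; apply/orP; right; apply: h2; exists (2 * x - 1), (2 * y).
    by split; [apply/andP; split; lra|apply/andP; split; lra|rewrite cE cE1; field].
  - apply/orP; right; apply/orP; left; apply: h3; exists (2 * x - 1), (2 * y - 1).
    by split; [apply/andP; split; lra|apply/andP; split; lra|rewrite !cE1; field].
move=> z /hg cg; have [d d0 hd] := cdiff_continuous cg ltr01.
exists d => // p' w' u' pz small; exists (nm (g z) + 1) => v pv.
have : nm (g v - g z) < 1 by apply: hd; exact: le_lt_trans (pgram_dist pv pz) small.
have := nmD (g v - g z) (g z); rewrite subrK; lra.
Qed.

(** * A Cauchy estimate from four squares around a point *)

Definition outer k n (a w u : C) := edge k n (a + w) (a + w + u) + edge k n (a + w + u) (a + u).

Lemma nm_ii : nm ('i%C : C) = 1.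
Proof. by rewrite /nm normc_def /= expr0n expr1n add0r sqrtr1. Qed.

Lemma ii : 'i%C * 'i%C = -1 :> C.
Proof. by rewrite -expr2 sqr_i. Qed.

Definition segment (p q : C) : set C :=
  [set z | exists2 t : R, 0 <= t <= 1 & z = p + (t%:C)%C * (q - p)].

Lemma segment_mid p q : midclosed (segment p q).
Proof.
move=> _ _ [x /andP [x0 x1] ->] [y /andP [y0 y1] ->].
exists ((x + y) / 2); first by apply/andP; split; lra.
by rewrite rmorphM rmorphD fmorphV /= rmorph_nat; field.
Qed.

Lemma segment_end p q : segment p q p /\ segment p q q.
Proof.
split; [exists 0|exists 1]; rewrite ?rmorph0 ?rmorph1 ?lexx ?ler01 //; ring.
Qed.

(* The two outer sides, seen from [a], of the square with corner [a] and sides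
   [w], [i w]. *)
Lemma outer_segments (a w : C) z :
  segment (a + w) (a + w + 'i%C * w) z \/ segment (a + w + 'i%C * w) (a + 'i%C * w) z ->
  nm w <= nm (z - a) <= 2 * nm w.
Proof.
have main (t : R) (v : C) : 0 <= t <= 1 -> nm v = nm w ->
    nm w <= nm ((1 +i* t)%C * v) <= 2 * nm w.
  move=> /andP [t0 t1] nv; rewrite nmM nv.
  have h1 := Re_le_nm (1 +i* t)%C; have h2 := nm_le_ReIm (1 +i* t)%C.
  rewrite /= in h1 h2; rewrite !ger0_norm // in h1 h2; have := nm_ge0 w.
  by move=> h3; apply/andP; split; nra.
case=> -[t ht ->].
- have -> : a + w + (t%:C)%C * (a + w + 'i%C * w - (a + w)) - a = (1 +i* t)%C * w.
    by rewrite [(1 +i* t)%C]complexE /= rmorph1; ring.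
  exact: main.
- have -> : a + w + 'i%C * w + (t%:C)%C * (a + 'i%C * w - (a + w + 'i%C * w)) - a
      = (1 +i* (t - 1))%C * ('i%C * w).
    rewrite [(1 +i* (t - 1))%C]complexE /= rmorph1 rmorphB rmorph1.
    rewrite mulrDl mul1r mulrACA ii; ring.
  have nw : nm ('i%C * w) = nm w by rewrite nmM nm_ii mul1r.
  have /andP [t0 t1] := ht; rewrite nmM nw.
  have h1 := Re_le_nm (1 +i* (t - 1))%C; have h2 := nm_le_ReIm (1 +i* (t - 1))%C.
  rewrite /= (@ler0_norm _ (t - 1)) ?ger0_norm // in h1 h2; last by lra.
  have := nm_ge0 w; move=> h3; apply/andP; split; nra.
Qed.

Lemma outer_bound f n (a w : C) (B : R) :
  (forall z, nm w <= nm (z - a) <= 2 * nm w -> nm (f z) <= B) ->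
  nm (outer f n a w ('i%C * w)) <= 2 * B * nm w.
Proof.
move=> hB; apply: le_trans (nmD _ _) _.
have [s1 s2] := segment_end (a + w) (a + w + 'i%C * w).
have [s3 s4] := segment_end (a + w + 'i%C * w) (a + 'i%C * w).
have := @edge_bound _ f n _ _ B (@segment_mid _ _) s1 s2
  (fun z hz => hB z (outer_segments (or_introl hz))).
have := @edge_bound _ f n _ _ B (@segment_mid _ _) s3 s4
  (fun z hz => hB z (outer_segments (or_intror hz))).
have -> : a + 'i%C * w - (a + w + 'i%C * w) = - w by ring.
have -> : a + w + 'i%C * w - (a + w) = 'i%C * w by ring.
rewrite nmN nmM nm_ii mul1r; lra.
Qed.

Lemma im_inv (s : R) : `|s| <= 1 -> 1 / 2 <= complex.Im ('i%C / (1 +i* s)%C).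
Proof.
move=> hs; have s2 : s ^+ 2 <= 1.
  by move: hs; rewrite ler_norml => /andP [? ?]; nra.
have s0 := sqr_ge0 s.
have n0 : (1 +i* s)%C != 0 :> C by apply/eqP => -[/eqP]; rewrite oner_eq0.
have e : 'i%C = ((s / (1 + s ^+ 2)) +i* (1 / (1 + s ^+ 2)))%C * (1 +i* s)%C :> C.
  have s1 : 1 + s ^+ 2 != 0 by rewrite lt0r_neq0 //; lra.
  by apply/eqP; rewrite eq_complex /=; apply/andP; split; apply/eqP; field.
rewrite {1}e mulfK //=.
rewrite ler_pdivlMr; lra.
Qed.

(** The exact integral over these two sides is i times pi/2. Each side contributes imaginary part at
    least 1/2, because i/(1 + is) has imaginary part 1/(1 + s^2). *)
Lemma outer_im n (a w : C) : w != 0 ->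
  1 <= complex.Im (outer (fun z => (z - a)^-1) n a w ('i%C * w)).
Proof.
move=> w0; rewrite /outer raddfD /=.
have i0 : 'i%C != 0 :> C by rewrite -normr_eq0 nmE nm_ii rmorph1 oner_neq0.
have n0 (s : R) : (1 +i* s)%C != 0 :> C.
  by apply/eqP => -[/eqP]; rewrite oner_eq0.
have q (x v : C) : x != 0 -> v != 0 -> (x * v)^-1 * ('i%C * v) = 'i%C / x.
  by move=> x0 v0; field; rewrite x0 v0.
have h1 : 1 / 2 <= complex.Im (edge (fun z => (z - a)^-1) n (a + w) (a + w + 'i%C * w)).
  have [s1 s2] := segment_end (a + w) (a + w + 'i%C * w).
  apply: (@edge_im _ (fun z => (z - a)^-1) n _ _ (1 / 2) (@segment_mid _ _) s1 s2) => z [t /andP [t0 t1] ->].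
  have -> : a + w + (t%:C)%C * (a + w + 'i%C * w - (a + w)) - a = (1 +i* t)%C * w.
    by rewrite [(1 +i* t)%C]complexE /= rmorph1; ring.
  have -> : a + w + 'i%C * w - (a + w) = 'i%C * w by ring.
  rewrite q //; apply: im_inv.
  by rewrite ger0_norm.
have h2 : 1 / 2 <= complex.Im (edge (fun z => (z - a)^-1) n (a + w + 'i%C * w) (a + 'i%C * w)).
  have [s1 s2] := segment_end (a + w + 'i%C * w) (a + 'i%C * w).
  apply: (@edge_im _ (fun z => (z - a)^-1) n _ _ (1 / 2) (@segment_mid _ _) s1 s2) => z [t /andP [t0 t1] ->].
  have -> : a + w + 'i%C * w + (t%:C)%C * (a + 'i%C * w - (a + w + 'i%C * w)) - a
      = (1 +i* (t - 1))%C * ('i%C * w).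
    rewrite [(1 +i* (t - 1))%C]complexE /= rmorph1 rmorphB rmorph1.
    rewrite mulrDl mul1r mulrACA ii; ring.
  have -> : a + 'i%C * w - (a + w + 'i%C * w) = 'i%C * ('i%C * w).
    by rewrite mulrA ii; ring.
  rewrite q ?mulf_neq0 //; apply: im_inv.
  by rewrite ler0_norm; lra.
lra.
Qed.

(** Separates the sides through [a]: for four squares placed around [a] these cancel in pairs and
    only outer sides remain. *)
Lemma loop_outer k n (a w u : C) : loop k n a w u =
  edge k n a (a + w) + outer k n a w u - edge k n a (a + u).
Proof. by rewrite /loop /outer (edge_sym k n a (a + u)); ring. Qed.

Lemma free_square (w : C) (x y : R) : w != 0 ->
  (x%:C)%C * w + (y%:C)%C * ('i%C * w) = 0 -> x = 0 /\ y = 0.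
Proof.
move=> w0 h; have /eqP : (x +i* y)%C * w = 0.
  by rewrite -h [(x +i* y)%C]complexE /=; ring.
by rewrite mulf_eq0 (negPf w0) orbF => /eqP [-> ->].
Qed.

(** Cauchy's theorem makes the contour sum of (h z - h a)/(z - a) small, so [h a] times the sum of
    1/(z - a) is nearly the sum of h z/(z - a). The former factor is at least 4 in modulus, the
    latter sum at most 8H; hence the constant 2. *)
Lemma cauchy_estimate h (a w : C) (H : R) : w != 0 ->
  (forall z, nm (z - a) <= 2 * nm w -> cdiff h z) ->
  (forall z, nm w <= nm (z - a) <= 2 * nm w -> nm (h z) <= H) ->
  nm (h a) <= 2 * H.
Proof.
move=> w0 hh hH; have nw := nm_gt0 w0.
(* The difference quotient is differentiable away from [a] and bounded near it; at [a] division by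
   zero gives it the value 0. *)
pose k z := (h z - h a) / (z - a).
have ha : cdiff h a by apply: hh; rewrite subrr nm0 mulr_ge0 // ltW.
have bk : exists B d : R, 0 < d /\ forall v, nm (v - a) < d -> nm (k v) <= B.
  have [b hb] := ha; have [d d0 hd] := hb 1 ltr01.
  exists (nm b + 1), d; split=> // v hv; rewrite /k.
  have [->|va] := eqVneq v a.
    by rewrite !subrr mul0r nm0; have := nm_ge0 b; lra.
  have va0 : 0 < nm (v - a) by rewrite nm_gt0 // subr_eq0.
  rewrite nmM nmV ler_pdivrMr //.
  have -> : h v - h a = (h v - h a - b * (v - a)) + b * (v - a) by ring.
  by apply: le_trans (nmD _ _) _; rewrite nmM; have := hd v hv; lra.
have quarter v (e : R) : v != 0 -> nm v = nm w -> 0 < e ->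
    exists N, forall n, (N <= n)%N -> nm (loop k n a v ('i%C * v)) <= e.
  move=> v0 nv; apply: goursat_vertex => //.
    by move=> x y; exact: free_square.
  move=> z pz za; apply: cdiff_div => //.
  have [pa _ _ _] := pgram_vertex a v ('i%C * v).
  have /hh cz : nm (z - a) <= 2 * nm w.
    by have := pgram_dist pz pa; rewrite nmM nm_ii mul1r nv; lra.
  have [d d0 hd] : exists2 d : R, 0 < d & forall v, nm (v - z) < d ->
      1 * h v + - h a = h v - h a by exists 1 => // v' _; rewrite mul1r.
  by apply: cdiff_near (cdiff_affine 1 (- h a) cz) _; exists d.
(* Successive quarter turns of [w], whose squares surround [a]. *)
pose w1 := 'i%C * w; pose w2 := 'i%C * w1; pose w3 := 'i%C * w2.
have i2 v : 'i%C * ('i%C * v) = - v :> C by rewrite mulrA ii mulN1r.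
have w4 : 'i%C * w3 = w by rewrite /w3 /w2 i2 /w1 i2 opprK.
have i0 : 'i%C != 0 :> C by rewrite -normr_eq0 nmE nm_ii rmorph1 oner_neq0.
have [w10 w20 w30] : [/\ w1 != 0, w2 != 0 & w3 != 0] by rewrite /w3 /w2 /w1 !mulf_neq0.
have [n1 n2 n3] : [/\ nm w1 = nm w, nm w2 = nm w & nm w3 = nm w].
  by rewrite /w3 /w2 /w1 !nmM nm_ii !mul1r.
pose total f n := outer f n a w ('i%C * w) + outer f n a w1 ('i%C * w1)
  + outer f n a w2 ('i%C * w2) + outer f n a w3 ('i%C * w3).
have totalE f n : total f n = loop f n a w ('i%C * w) + loop f n a w1 ('i%C * w1)
  + loop f n a w2 ('i%C * w2) + loop f n a w3 ('i%C * w3).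
  by rewrite !loop_outer w4 -/w1 -/w2 -/w3 /total w4 -/w1 -/w2 -/w3; ring.
apply: le_all_eps => e e0.
have [N0 h0] := quarter w e w0 erefl e0; have [N1 h1] := quarter w1 e w10 n1 e0.
have [N2 h2] := quarter w2 e w20 n2 e0; have [N3 h3] := quarter w3 e w30 n3 e0.
pose n := maxn (maxn N0 N1) (maxn N2 N3).
have tk : nm (total k n) <= 4 * e.
  have l0 : (N0 <= n)%N by rewrite /n !leq_max leqnn.
  have l1 : (N1 <= n)%N by rewrite /n !leq_max leqnn ?orbT.
  have l2 : (N2 <= n)%N by rewrite /n !leq_max leqnn ?orbT.
  have l3 : (N3 <= n)%N by rewrite /n !leq_max leqnn ?orbT.
  rewrite totalE; move: (h0 n l0) (h1 n l1) (h2 n l2) (h3 n l3).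
  set A := loop _ _ _ _ _; set B := loop _ _ _ _ _; set E := loop _ _ _ _ _; set F := loop _ _ _ _ _.
  have := nmD (A + B + E) F; have := nmD (A + B) E; have := nmD A B; lra.
have th : nm (total (fun z => h z / (z - a)) n) <= 8 * H.
  have b v : nm v = nm w -> nm (outer (fun z => h z / (z - a)) n a v ('i%C * v)) <= 2 * H.
    move=> nv; have -> : 2 * H = 2 * (H / nm w) * nm v by rewrite nv; field; rewrite gt_eqF.
    apply: outer_bound => z; rewrite nv => hz; have /andP [hz1 _] := hz.
    have hz0 : 0 < nm (z - a) by apply: lt_le_trans hz1.
    have Hh := hH z hz; have H0 : 0 <= H by apply: le_trans Hh; exact: nm_ge0.
    rewrite nmM nmV ler_pdivrMr //; apply: le_trans Hh _.
    by rewrite mulrAC ler_pdivlMr // ler_wpM2l.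
  move: (b w erefl) (b w1 n1) (b w2 n2) (b w3 n3); rewrite /total.
  set A := outer _ _ _ _ _; set B := outer _ _ _ _ _; set E := outer _ _ _ _ _; set F := outer _ _ _ _ _.
  have := nmD (A + B + E) F; have := nmD (A + B) E; have := nmD A B; lra.
have ti : 4 <= nm (total (fun z => (z - a)^-1) n).
  apply: le_trans (Im_le_nm _); apply: le_trans (ler_norm _).
  have ImD (x y : C) : complex.Im (x + y) = complex.Im x + complex.Im y by case: x; case: y.
  move: (outer_im n a w0) (outer_im n a w10) (outer_im n a w20) (outer_im n a w30).
  rewrite /total /outer !ImD; lra.
have tE : total k n = - h a * total (fun z => (z - a)^-1) n + total (fun z => h z / (z - a)) n.
  have kE : k = fun z => - h a * (z - a)^-1 + h z / (z - a).
    by apply/funext => z; rewrite /k; ring.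
  by rewrite kE /total /outer !edge_lin; ring.
have : nm (h a) * nm (total (fun z => (z - a)^-1) n) <= 8 * H + 4 * e.
  rewrite -nmM; have -> : h a * total (fun z => (z - a)^-1) n
    = total (fun z => h z / (z - a)) n - total k n by rewrite tE; ring.
  by apply: le_trans (nmB _ _) _; exact: lerD.
have := ler_wpM2l (nm_ge0 (h a)) ti; lra.
Qed.

(* Dividing by [(z - b) / (a - b)] keeps [g a], halves the bound on the far
   annulus, and stays differentiable since [g] vanishes near [b]. *)
Lemma vanish_step g (a b : C) (s : R) : 0 < s -> b != a -> nm (b - a) <= s / 3 ->
  (forall z, nm (z - a) <= 8 * s -> cdiff g z) ->
  (exists2 d : R, 0 < d & forall z, nm (z - b) < d -> g z = 0) -> g a = 0.
Proof.
move=> s0 ba hba hg [d d0 hd].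
have ns : nm (s%:C)%C = s by rewrite nmR gtr0_norm.
have sC : (s%:C)%C != 0 :> C by rewrite -(rmorph0 (real_complex R)) (inj_eq (@complexI R)) gt_eqF.
have key n g1 (H : R) : (forall z, nm (z - a) <= 2 * s -> cdiff g1 z) ->
    (forall z, nm (z - b) < d -> g1 z = 0) ->
    (forall z, s <= nm (z - a) <= 2 * s -> nm (g1 z) <= H) -> nm (g1 a) <= 2 * H / 2 ^+ n.
  elim: n g1 H => [|n IH] g1 H c1 z1 b1.
    rewrite expr0 divr1; apply: (@cauchy_estimate g1 a (s%:C)%C) => // z; rewrite ns //.
      exact: c1.
    exact: b1.
  pose g2 z := (a - b) * (g1 z / (z - b)) + 0.
  have -> : g1 a = g2 a by rewrite /g2 addr0 mulrCA mulfV ?mulr1 // subr_eq0 eq_sym.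
  have -> : 2 * H / 2 ^+ n.+1 = 2 * (H / 2) / 2 ^+ n.
    by rewrite exprS; field; rewrite expf_neq0.
  apply: IH.
  - move=> z hz; have [zb|zb] := eqVneq z b.
      apply: cdiff_near (cdiff_cst 0 z) _; exists d => // v; rewrite zb => hv.
      by rewrite /g2 z1 // mul0r mulr0 addr0.
    by apply: cdiff_affine; apply: cdiff_div => //; exact: c1.
  - by move=> z hz; rewrite /g2 z1 // mul0r mulr0 addr0.
  - move=> z hz; have /andP [hz1 hz2] := hz.
    (* On the annulus |z - b| is at least 2s/3 while |a - b| is at most s/3, so the quotient is at
       most 1/2. *)
    have hzb : 2 * s / 3 <= nm (z - b).
      have := nm_tri b z a; lra.
    rewrite /g2 addr0 !nmM nmV nmBC mulrCA.
    have H0 := b1 z hz; have n0 := nm_ge0 (g1 z).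
    apply: (@le_trans _ _ (nm (g1 z) * (1 / 2))); last by lra.
    apply: ler_wpM2l => //; rewrite ler_pdivrMr; lra.
(* The square centred at [a] with half side 2s contains the annulus and lies in the disc of radius
   8s; it supplies the initial bound [H]. *)
have [z [x [y [hx hy ->]]]|H hH] := @bounded_on_pgram g
    (a - 2 * (s%:C)%C - 2 * ('i%C * (s%:C)%C)) (4 * (s%:C)%C) (4 * ('i%C * (s%:C)%C)).
  apply: hg.
  have -> : a - 2 * (s%:C)%C - 2 * ('i%C * (s%:C)%C) + (x%:C)%C * (4 * (s%:C)%C)
      + (y%:C)%C * (4 * ('i%C * (s%:C)%C)) - a
    = (((4 * x - 2) +i* (4 * y - 2))%C) * (s%:C)%C.
    rewrite [((_ - _) +i* _)%C]complexE /= !rmorphB !rmorphM /= !rmorph_nat; ring.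
  rewrite nmM ns; apply: ler_wpM2r; first exact: ltW.
  apply: le_trans (nm_le_ReIm _) _ => /=.
  move: hx hy => /andP [x0 x1] /andP [y0 y1].
  have : `|4 * x - 2| <= 2 by rewrite ler_norml; apply/andP; split; lra.
  have : `|4 * y - 2| <= 2 by rewrite ler_norml; apply/andP; split; lra.
  lra.
apply: (@nm_limit0 _ _ _ (fun n => 2 * H / 2 ^+ n)).
  move=> n; apply: key => //.
    by move=> z hz; apply: hg; lra.
  move=> z /andP [_ hz]; apply: hH.
  have hr := le_trans (Re_le_nm _) hz; have hi := le_trans (Im_le_nm _) hz.
  move: hr hi; rewrite !ler_norml => /andP [r1 r2] /andP [i1 i2].
  exists ((complex.Re (z - a) / s + 2) / 4), ((complex.Im (z - a) / s + 2) / 4).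
  have bnd t : - (2 * s) <= t -> t <= 2 * s -> 0 <= (t / s + 2) / 4 <= 1.
    move=> t1 t2; have : - 2 <= t / s by rewrite ler_pdivlMr //; lra.
    have : t / s <= 2 by rewrite ler_pdivrMr //.
    by move=> *; apply/andP; split; lra.
  split; [exact: bnd|exact: bnd|].
  have {1}-> : z = a + ((complex.Re (z - a))%:C)%C + 'i%C * ((complex.Im (z - a))%:C)%C.
    by rewrite -addrA -complexE; ring.
  rewrite !rmorphM !rmorphD !rmorphM !fmorphV /= !rmorph_nat; field; exact: sC.
by move=> e e0; exact: pow2_small.
Qed.

(** The disc on which [g] vanishes is enlarged: a point slightly outside the largest one is close to
    a point inside it, near which [g] is zero, and [vanish_step] applies at a scale proportional to
    [r - s]. *)
Lemma identity_theorem g (r r0 : R) : 0 < r0 ->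
  (forall z, nm z < r -> cdiff g z) -> (forall z, nm z < r0 -> g z = 0) ->
  forall z, nm z < r -> g z = 0.
Proof.
move=> r00 hg hz z hzr.
pose E : set R := [set t | t <= r /\ forall z, nm z < t -> g z = 0].
have m0 : 0 < Num.min r0 r.
  by rewrite lt_min r00; apply: le_lt_trans hzr; exact: nm_ge0.
have Em : E (Num.min r0 r).
  split; first by rewrite ge_min lexx orbT.
  by move=> v; rewrite lt_min => /andP [/hz].
have sE : has_sup E by split; [exists (Num.min r0 r)|exists r => t []].
pose s := sup E.
have sr : s <= r by apply: ge_sup => [|t []//]; case: sE.
have s0 : 0 < s by apply: lt_le_trans m0 _; apply: ub_le_sup => //; case: sE.
have gs v : nm v < s -> g v = 0.
  by move=> hv; have [t [_ h] /h] := sup_gt (proj1 sE) hv.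
have [|sr'] := leP r s; first by move=> h; apply: gs; exact: lt_le_trans h.
(* With 60, the displacement 2h is at most a third of the scale (r - s)/10 used in [vanish_step],
   and the disc of eight times that scale stays within radius [r]. *)
pose h := Num.min ((r - s) / 60) (s / 2).
have h0 : 0 < h by rewrite lt_min !divr_gt0 // subr_gt0.
have h1 : h <= (r - s) / 60 by rewrite ge_min lexx.
have h2 : h <= s / 2 by rewrite ge_min lexx orbT.
suff : E (s + h).
  by move=> Es; exfalso; have : s + h <= s by [apply: ub_le_sup => //; case: sE|]; lra.
split; first by lra.
move=> a ha; have [|as_] := ltP (nm a) s; first exact: gs.
have sh : 0 < s + h by lra.
(* Chosen so that [b], the point [a] shrunk by the factor 1 - t, has norm below s - h/2 yet lies
   within 2h of [a]. *)
pose t := 2 * h / (s + h).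
have t0 : 0 < t by rewrite divr_gt0 // mulr_gt0.
have t1 : t <= 1 by rewrite ler_pdivrMr //; lra.
have th : t * (s + h) = 2 * h by rewrite /t divfK // gt_eqF.
pose b := ((1 - t)%:C)%C * a.
have nb : nm b = (1 - t) * nm a by rewrite nmM nmR ger0_norm // subr_ge0.
have ba : b - a = - ((t%:C)%C * a) by rewrite /b rmorphB rmorph1 /=; ring.
have nba : nm (b - a) = t * nm a by rewrite ba nmN nmM nmR gtr0_norm.
have na : 0 < nm a by lra.
have tna : t * nm a <= 2 * h by rewrite -th ler_pM2l // ltW.
apply: (@vanish_step g a b ((r - s) / 10)).
- by rewrite divr_gt0 // subr_gt0.
- rewrite -subr_eq0; apply/eqP => e; move: nba; rewrite e nm0.
  have h3 : 0 < t * nm a by rewrite mulr_gt0.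
  by move=> h4; rewrite -h4 ltxx in h3.
- by rewrite nba; lra.
- move=> v hv; apply: hg; have := nmD (v - a) a; rewrite subrK; lra.
- have nbs : nm b < s.
    rewrite nb; apply: (@lt_trans _ _ ((1 - t) * (s + h) + h / 2)); last first.
      by rewrite mulrBl mul1r th; lra.
    have : (1 - t) * nm a <= (1 - t) * (s + h).
      by apply: ler_wpM2l; [rewrite subr_ge0|exact: ltW].
    lra.
  exists (s - nm b); first by lra.
  move=> v hv; apply: gs; have := nmD (v - b) b; rewrite subrK; lra.
Qed.

End DiscreteCauchy.

(** * Reducing pairs *)

Section Decompositions.
Context {R : realType} {X : completeNormedModType R[i]}.
Implicit Types (S T : X -> X) (M N Z V W : set X).

Lemma direct_unique M N m n m' n' : subspace M -> subspace N -> direct_sum M N ->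
  M m -> N n -> M m' -> N n' -> m + n = m' + n' -> m = m' /\ n = n'.
Proof.
move=> sM sN [MN _] Mm Nn Mm' Nn' e.
have h : (M `&` N) (m - m').
  split; first exact: subB.
  have -> : m - m' = n' - n.
    have mE : m = m' + n' - n by rewrite -e addrK.
    by rewrite mE; lmod R[i].
  exact: subB.
have /eqP : m - m' = 0 by rewrite MN in h.
rewrite subr_eq0 => /eqP mm; split=> //.
by move: e; rewrite mm => /addrI.
Qed.

Lemma span_cat (s t : seq X) x y : span s x -> span t y -> span (s ++ t) (x + y).
Proof.
move=> sx ty; apply: subD; first exact: span_sub.
  by apply: span_mono sx => z; rewrite mem_cat => ->.
by apply: span_mono ty => z; rewrite mem_cat => ->; rewrite orbT.
Qed.

(** [P] projects onto [N] along [M]; open mapping for the identity on [M] modulo [N] bounds the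
    [M]-component, hence [P]. *)
Lemma reducing_projection T M N : bop T -> reducing_pair T M N -> exists P : X -> X,
  [/\ bop P, forall x, N (P x), forall x, M (x - P x) &
   [/\ forall x, N x -> P x = x, forall x, M x -> P x = 0 & forall x, P (T x) = T (P x)]].
Proof.
move=> [lT _] [[sM sN] [cM cN] TM TN dMN]; have [_ hD] := dMN.
have bid : bop (id : X -> X).
  by split=> //; exists 1 => // x; rewrite mul1r.
have VE : addS (id @` M) N = setT.
  rewrite eqEsubset; split=> // x _; have [m [n [Mm [Nn ->]]]] := hD x.
  by exists m, n; split=> //; exists m.
have [|C C0 hC] := open_mapping bid sM cM sN cN; first by rewrite VE; exact: closedT.
have /choice [P hP] (x : X) : exists n, [/\ N n, M (x - n) & nm (x - n) <= C * nm x].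
  have [|m [n [Mm Nn e nmm]]] := hC x; first by rewrite VE.
  by exists n; have -> : x - n = m by rewrite e addrK.
have uq x m n : M m -> N n -> x = m + n -> P x = n.
  move=> Mm Nn e; have [NP MP _] := hP x.
  have [] := direct_unique sM sN dMN MP NP Mm Nn; last by [].
  by rewrite subrK.
have dec x : x = (x - P x) + P x by rewrite subrK.
exists P; split.
- split.
    move=> a x y; have [NPx MPx _] := hP x; have [NPy MPy _] := hP y.
    apply: (uq _ (a *: (x - P x) + (y - P y))).
    + exact: (proj2 sM).
    + exact: (proj2 sN).
    + by lmod R[i].
  exists (1 + C); first by lra.
  move=> x; have [_ _ h] := hP x; have -> : P x = x - (x - P x) by lmod R[i].
  by apply: le_trans (nmB _ _) _; rewrite mulrDl mul1r lerD2l.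
- by move=> x; have [] := hP x.
- by move=> x; have [] := hP x.
- split.
  + by move=> x Nx; apply: (uq x 0); rewrite ?add0r //; case: sM.
  + by move=> x Mx; apply: (uq x x 0); rewrite ?addr0 //; case: sN.
  + move=> x; have [NPx MPx _] := hP x.
    apply: (uq _ (T (x - P x))).
    * by apply: TM; exists (x - P x).
    * by apply: TN; exists (P x).
    * by rewrite (linB lT) subrK.
Qed.

Lemma cofinite_iter S M n : lin S -> subspace M -> cofinite M (S @` M) ->
  cofinite M (iter n S @` M).
Proof.
move=> lS sM [s hs]; elim: n => [|n [t ht]].
  by exists [::] => x Mx; apply: addSl; [exact: span_sub|exists x].
exists (map (iter n S) s ++ t) => x /ht [_ [v [[m Mm <-] tv ->]]].
have [_ [w [[m' Mm' <-] sw ->]]] := hs _ Mm.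
exists (iter n S (S m')), (iter n S w + v); split.
- by exists m' => //; rewrite iterSr.
- apply: span_cat => //; apply: (span_map (iter_lin n lS)); by exists w.
- by rewrite (linD (iter_lin n lS)) addrA.
Qed.

(** The complement is built one vector at a time so that [T] sends each new vector into the span of
    the earlier ones. Such vectors exist because T^d maps [M] into [Y], and because [T] maps [Y]
    onto itself the [Y]-part of an image can be corrected away. *)
Lemma invariant_complement T M Y d : lin T -> subspace M -> T @` M `<=` M ->
  subspace Y -> Y `<=` M -> T @` Y = Y -> iter d T @` M `<=` Y -> cofinite M Y ->
  exists t, [/\ span t `<=` M, T @` span t `<=` span t,
    forall x, span t x -> Y x -> x = 0 & M `<=` addS Y (span t)].
Proof.
move=> lT sM TM sY YM TY dY fY.
pose ok t := [/\ span t `<=` M, T @` span t `<=` span t & forall x, span t x -> Y x -> x = 0].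
(* For [codim_ind] the current list [t] is carried inside the predicate, through the equation for
   [V]. *)
suff : (fun V => forall t, V = addS Y (span t) -> ok t ->
    exists t', ok t' /\ M `<=` addS Y (span t')) Y.
  move=> /(_ [::]) [||t [[h1 h2 h3] h4]]; last by exists t.
  - rewrite eqEsubset; split=> x; first by move=> Yx; apply: addSl => //; exact: span_sub.
    by move=> [y [_ [Yy /span_nil -> ->]]]; rewrite addr0.
  - split.
    + by move=> x /span_nil ->; case: sM.
    + by move=> _ [x /span_nil -> <-]; apply/span_nil; exact: lin0.
    + by move=> x /span_nil.
apply: (@codim_ind _ _ M (fun V => forall t, V = addS Y (span t) -> ok t ->
    exists t', ok t' /\ M `<=` addS Y (span t')) Y) => //.
move=> V sV VM hV t VE [tM Tt tY].
have [VeM|nVM] := pselect (V = M); first by exists t; split=> //; rewrite -VE VeM.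
have [e0 [Me0 nVe0]] : exists e, M e /\ ~ V e.
  apply: contrapT => h; apply: nVM; rewrite eqEsubset; split=> // x Mx.
  by apply: contrapT => nVx; apply: h; exists x.
have YV : Y `<=` V by rewrite VE => y Yy; apply: addSl => //; exact: span_sub.
(* The last point outside [V] on the orbit of [e0], which enters [V] after at most [d] steps. *)
have [e [Me nVe [y [n [Yy tn Te]]]]] : exists e, [/\ M e, ~ V e & addS Y (span t) (T e)].
  have : V (iter d T e0) by apply: YV; apply: dY; exists e0.
  elim: {dY} d e0 Me0 nVe0 => [|d IH] e0 Me0 nVe0 h; first by [].
  have [VT|nVT] := pselect (V (T e0)); first by exists e0; rewrite -VE.
  by apply: (IH (T e0)) => //; [apply: TM; exists e0|rewrite -iterSr].
have [y1 Yy1 y1E] : (T @` Y) y by rewrite TY.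
pose e1 := e - y1.
have Me1 : M e1 by apply: subB => //; exact: YM.
have nVe1 : ~ V e1.
  move=> h; apply: nVe; have -> : e = e1 + y1 by rewrite subrK.
  by apply: subD => //; exact: YV.
have Te1 : T e1 = n by rewrite (linB lT) Te y1E addrAC subrr add0r.
apply: (hV nVM e1 Me1 nVe1 (e1 :: t)); first by rewrite VE [in RHS]addS_cons.
split.
- move=> _ /span_cons [a [z [/tM Mz ->]]]; apply: subD => //; exact: subZ.
- move=> _ [_ /span_cons [a [z [tz ->]]] <-]; rewrite lT Te1.
  apply/span_cons; exists 0, (a *: n + T z); rewrite scale0r add0r; split=> //.
  by apply: (proj2 (span_sub t)) => //; apply: Tt; exists z.
- move=> _ /span_cons [a [z [tz ->]]] Yaz.
  have Vae : V (a *: e1).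
    have -> : a *: e1 = (a *: e1 + z) - z by rewrite addrK.
    apply: subB => //; first exact: YV.
    by rewrite VE; apply: addSr.
  have a0 : a = 0.
    apply/eqP; apply: contrapT => /negP a0; apply: nVe1.
    have -> : e1 = a^-1 *: (a *: e1) by lmod_split R[i]; field.
    exact: subZ.
  by move: Yaz; rewrite a0 scale0r add0r; exact: tY.
Qed.

(** The new pair is the stable range T^d M, closed because of finite codimension, and [N] enlarged
    by the finite-dimensional complement. The enlargement preserves the Riesz property: kernels grow
    at most by [span t], and [t] can be added to the list filling up the range. *)
Lemma lower_semi_browder_split T M N : bop T -> reducing_pair T M N ->
  lower_semi_browder_on M T -> riesz_on N T ->
  exists M' N', reducing_pair T M' N' /\ surjective_on M' T /\ riesz_on N' T.
Proof.
move=> bT [[sM sN] [cM cN] TM TN dMN] [fM [d hd]] rN; have [lT _] := bT.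
have [MN hD] := dMN.
pose Y := iter d T @` M.
have sY : subspace Y by apply: image_sub => //; exact: iter_lin.
have YM : Y `<=` M by exact: iter_inv.
have TY : T @` Y = Y.
  rewrite {2}/Y hd eqEsubset; split.
    by move=> _ [_ [x Mx <-] <-]; exists x.
  by move=> _ [x Mx <-]; exists (iter d T x) => //; exists x.
have fY : cofinite M Y by exact: cofinite_iter.
have Y0 : addS Y [set 0] = Y.
  rewrite eqEsubset; split=> x; last by move=> h; apply: addSl => //; exact: sub_set0.
  by move=> [y [_ [h -> ->]]]; rewrite addr0.
have cY : closed Y.
  rewrite -Y0; apply: (@cofinite_closed _ _ (iter d T) M [set 0] M) => //.
  - exact: iter_bop.
  - exact: sub_set0.
  - exact: closed_set0.
  - by rewrite Y0.
  - by rewrite Y0.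
have [t [tM Tt tY MY]] := invariant_complement lT sM TM sY YM TY (@subset_refl _ Y) fY.
pose N' := addS N (span t); have st := @span_sub _ _ t.
exists Y, N'; split; [split|split].
- by split=> //; exact: addS_sub.
- by split=> //; exact: closed_add_span.
- by rewrite /invariant TY.
- move=> _ [_ [n [v [Nn tv ->]]] <-]; exists (T n), (T v); rewrite (linD lT).
  by split=> //; [apply: TN; exists n|apply: Tt; exists v].
- split.
    rewrite eqEsubset; split=> x; last first.
      by move=> ->; split; [case: sY|case: (addS_sub sN st)].
    move=> [Yx [n [v [Nn tv e]]]].
    have [xv n0] : x = v /\ 0 = n.
      apply: (direct_unique sM sN dMN) => //; [exact: YM|by case: sN|exact: tM|].
      by rewrite addr0 addrC -e.
    by apply: tY; rewrite ?xv // -xv.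
  move=> x; have [m [n [/MY [y [v [Yy tv ->]]] [Nn ->]]]] := hD x.
  by exists y, (n + v); split=> //; split; [exists n, v|lmod R[i]].
- exact: TY.
- move=> l l0; have [[s hs] [s' hs']] := rN l l0.
  have lA : lin (shift T l) by have [] := shift_bop l bT.
  split.
    exists (t ++ s) => _ [[n [v [Nn tv ->]]] h].
    have Mv := tM _ tv.
    have [_ An] : shift T l v = 0 /\ shift T l n = 0.
      apply: (direct_unique sM sN dMN); [by apply: (@shift_inv _ _ T M); [|exact: TM|exists v]
        |by apply: (@shift_inv _ _ T N); [|exact: TN|exists n]|by case: sM|by case: sN|].
      by rewrite -(linD lA) (addrC v) h addr0.
    by rewrite addrC; apply: span_cat => //; apply: hs.
  exists (s' ++ t) => _ [n [v [/hs' [_ [w [[n' Nn' <-] sw ->]]] tv ->]]].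
  exists (shift T l n'), (w + v); split; [|exact: span_cat|by lmod R[i]].
  by exists n' => //; apply: addSl.
Qed.

Lemma descent_le S M d e : S @` M `<=` M -> (d <= e)%N ->
  iter d S @` M = iter d.+1 S @` M -> iter e S @` M = iter e.+1 S @` M.
Proof.
move=> SM /subnK <- hd; elim: (e - d)%N => [|n IH] //.
have E k : iter k.+1 S @` M = S @` (iter k S @` M).
  rewrite eqEsubset; split.
    by move=> _ [x Mx <-]; exists (iter k S x) => //; exists x.
  by move=> _ [_ [x Mx <-] <-]; exists x.
by rewrite addSn E IH -E.
Qed.

Lemma iter_subset S M d : S @` M `<=` M -> iter d.+1 S @` M `<=` iter d S @` M.
Proof.
by move=> SM _ [x Mx <-]; exists (S x); [apply: SM; exists x|rewrite -iterSr].
Qed.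

Lemma lower_semi_browder_sum S M N : lin S -> (forall x, exists m n, M m /\ N n /\ x = m + n) ->
  S @` M `<=` M -> S @` N `<=` N -> lower_semi_browder_on M S ->
  lower_semi_browder_on N S -> lower_semi_browder_on setT S.
Proof.
move=> lS hD SM SN [[s hs] [d hd]] [[t ht] [e he]]; split.
  exists (s ++ t) => x _; have [m [n [/hs [_ [v [[m' Mm' <-] sv ->]]]
    [/ht [_ [w [[n' Nn' <-] tw ->]]] ->]]]] := hD x.
  exists (S (m' + n')), (v + w); split; [by exists (m' + n')|exact: span_cat|].
  by rewrite (linD lS); lmod R[i].
exists (maxn d e).
have hd' := descent_le SM (leq_maxl d e) hd; have he' := descent_le SN (leq_maxr d e) he.
rewrite eqEsubset; split; last exact: iter_subset.
move=> _ [x _ <-]; have [m [n [Mm [Nn ->]]]] := hD x.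
have [m' Mm' mE] : (iter (maxn d e).+1 S @` M) (iter (maxn d e) S m) by rewrite -hd'; exists m.
have [n' Nn' nE] : (iter (maxn d e).+1 S @` N) (iter (maxn d e) S n) by rewrite -he'; exists n.
by exists (m' + n') => //; rewrite !(linD (iter_lin _ lS)) mE nE.
Qed.

Lemma surjective_sum S M N : lin S -> (forall x, exists m n, M m /\ N n /\ x = m + n) ->
  surjective_on M S -> surjective_on N S -> surjective_on setT S.
Proof.
move=> lS hD sM sN; rewrite /surjective_on eqEsubset; split=> // x _.
have [m [n []]] := hD x; rewrite -{1}sM => -[m' Mm' <-] []; rewrite -{1}sN => -[n' Nn' <-] ->.
by exists (m' + n') => //; rewrite (linD lS).
Qed.

Lemma surjective_lower_semi_browder S M : surjective_on M S -> lower_semi_browder_on M S.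
Proof.
move=> sM; split; last by exists 0%N; rewrite /= image_id sM.
by exists [::] => x Mx; exists x, 0; rewrite addr0 sM; split=> //; apply/span_nil.
Qed.

Lemma surjective_kato S M : closed M -> surjective_on M S -> kato_on M S.
Proof.
move=> cM sM; split; first by rewrite sM.
move=> n x [Mx _]; suff -> : iter n S @` M = M by [].
elim: n => [|n IH]; first exact: image_id.
rewrite -[RHS]sM -{2}IH eqEsubset; split.
  by move=> _ [y My <-]; exists (iter n S y) => //; exists y.
by move=> _ [_ [y My <-] <-]; exists y.
Qed.

(** The [M]-component of a preimage under a power of [S] is again a preimage, by uniqueness of the
    decomposition. *)
Lemma descent_restrict S M N d : lin S -> subspace M -> subspace N -> direct_sum M N ->
  S @` M `<=` M -> S @` N `<=` N ->
  iter d S @` setT = iter d.+1 S @` setT -> iter d S @` M = iter d.+1 S @` M.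
Proof.
move=> lS sM sN dMN SM SN hd; rewrite eqEsubset; split; last exact: iter_subset.
move=> _ [m Mm <-]; have [y _ yE] : (iter d.+1 S @` setT) (iter d S m) by rewrite -hd; exists m.
have [m' [n' [Mm' [Nn' e]]]] := (proj2 dMN) y.
have [h _] : iter d.+1 S m' = iter d S m /\ iter d.+1 S n' = 0.
  apply: (direct_unique sM sN dMN).
  - by apply: (@iter_inv _ _ S M d.+1 SM); exists m'.
  - by apply: (@iter_inv _ _ S N d.+1 SN); exists n'.
  - by apply: (@iter_inv _ _ S M d SM); exists m.
  - by case: sN.
  - by rewrite -(linD (iter_lin _ lS)) -e yE addr0.
by exists m'.
Qed.

Lemma iter_eq_on S S' M n x : S @` M `<=` M -> (forall x, M x -> S x = S' x) ->
  M x -> iter n S x = iter n S' x.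
Proof.
move=> SM h Mx; elim: n => //= n <-.
by apply: h; apply: (@iter_inv _ _ S M n SM); exists x.
Qed.

Lemma lower_semi_browder_eq S S' M : S @` M `<=` M -> (forall x, M x -> S x = S' x) ->
  lower_semi_browder_on M S' -> lower_semi_browder_on M S.
Proof.
move=> SM h [fM [d hd]].
have E n : iter n S @` M = iter n S' @` M.
  by rewrite eqEsubset; split=> _ [x Mx <-]; exists x => //;
    rewrite (iter_eq_on n SM h Mx).
split; last by exists d; rewrite !E.
by have := E 1%N => /= ->.
Qed.

End Decompositions.

(** * The implications between the seven conditions *)

Section Equivalences.
Context {R : realType} {X : completeNormedModType R[i]}.
Implicit Types (S T : X -> X) (M N : set X).

Definition surjective_plus_riesz T :=
  exists M N, reducing_pair T M N /\ surjective_on M T /\ riesz_on N T.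

Lemma surjective_plus_riesz_GKRD T : surjective_plus_riesz T -> GKRD T.
Proof.
move=> [M [N [hMN [sM rN]]]]; exists M, N; split=> //; split=> //.
by apply: surjective_kato => //; case: hMN => _ [].
Qed.

(** If [T] were not onto [M], an eigen family would exclude finite descent of [T - w] on [M], hence
    on [X], for all small [w], making 0 interior. *)
Lemma GKRD_int_lsB T : bop T -> GKRD T -> ~ int_pt (sigma_lsB T) 0 ->
  surjective_plus_riesz T.
Proof.
move=> bT [M [N [hMN [kM rN]]]] nint; exists M, N; split=> //; split=> //.
have [[sM sN] [cM cN] TM TN dMN] := hMN; have [lT _] := bT.
apply: contrapT => nsur; apply: nint.
have [e e0 he] := eigen_no_descent lT sM TM (kato_eigen_family bT sM cM TM kM nsur).
exists (e%:C)%C; first by rewrite -(rmorph0 (real_complex R)) ltcR.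
move=> w; rewrite subr0 nm_lt => hw [_ [d hd]]; apply: (he w hw d).
have [lw _] := shift_bop w bT.
exact: (descent_restrict lw sM sN dMN (@shift_inv _ _ T M w sM TM)
  (@shift_inv _ _ T N w sN TN) hd).
Qed.

Lemma sigma_lsB_su T : sigma_lsB T `<=` sigma_su T.
Proof. by move=> l h sl; apply: h; exact: surjective_lower_semi_browder. Qed.

(** The complex plane has no isolated points, so an interior point of [A] is an accumulation
    point. *)
Lemma not_acc_not_int (A : set R[i]) z : ~ acc_pt A z -> ~ int_pt A z.
Proof.
move=> nacc [e /posC [d d0 ->] he]; apply: nacc => t /posC [t' t0 ->].
pose m := Num.min d t' / 2.
have mm0 : 0 < Num.min d t' by rewrite lt_min d0.
have m0 : 0 < m by rewrite divr_gt0.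
have md : m < d by apply: (@lt_le_trans _ _ (Num.min d t')); [rewrite /m; lra|rewrite ge_min lexx].
have mt : m < t' by apply: (@lt_le_trans _ _ (Num.min d t')); [rewrite /m; lra|rewrite ge_min lexx orbT].
exists (z + (m%:C)%C).
have nE : nm (z + (m%:C)%C - z) = m by rewrite addrAC subrr add0r nmR gtr0_norm.
split; [by apply: he; rewrite nm_lt nE| |by rewrite nm_lt nE].
by rewrite -subr_eq0; apply/eqP => h; move: nE; rewrite h nm0 => m00; rewrite -m00 ltxx in m0.
Qed.

(** For small nonzero [w], surjectivity on [M] persists, and the Riesz part is lower semi-Browder at
    every nonzero [w]. *)
Lemma surjective_plus_riesz_acc T : bop T -> surjective_plus_riesz T ->
  ~ acc_pt (sigma_lsB T) 0.
Proof.
move=> bT [M [N [[[sM sN] [cM cN] TM TN dMN] [surM rN]]]] hacc; have [lT _] := bT.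
have hd : iter 0 T @` M = iter 1 T @` M by rewrite /= image_id surM.
have [e e0 he] := descent_perturb bT sM cM TM hd.
have [|w [hw w0]] := hacc (e%:C)%C; first by rewrite -(rmorph0 (real_complex R)) ltcR.
rewrite subr0 nm_lt => we; apply: hw.
apply: (@lower_semi_browder_sum _ _ _ M N); [by have [] := shift_bop w bT|exact: (proj2 dMN)| | | |].
- exact: shift_inv.
- exact: shift_inv.
- by apply: surjective_lower_semi_browder; apply: he => //; left.
- by split; [have [] := rN w w0|exact: riesz_descent].
Qed.

(** The radius comes from [M], where surjectivity is stable. On [N] surjectivity holds on a
    punctured neighbourhood of each nonzero [l], so a small displacement achieves both. *)
Lemma surjective_plus_riesz_dense T : bop T -> surjective_plus_riesz T ->
  exists2 r : R, 0 < r & forall l (e : R), nm l < r -> 0 < e ->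
    exists m, [/\ nm (m - l) < e, nm m < r & surjective_on setT (shift T m)].
Proof.
move=> bT [M [N [[[sM sN] [cM cN] TM TN dMN] [surM rN]]]]; have [lT _] := bT.
have hd : iter 0 T @` M = iter 1 T @` M by rewrite /= image_id surM.
have [r r0 hr] := descent_perturb bT sM cM TM hd.
exists r => // l e hl e0.
have posn0 (t : R) : 0 < t -> (t%:C)%C != 0 :> R[i].
  by move=> t0; rewrite -(rmorph0 (real_complex R)) (inj_eq (@complexI R)) gt_eqF.
have step l' (e' : R) : l' != 0 -> nm l' < r -> 0 < e' ->
    exists m, [/\ nm (m - l') < e', nm m < r & surjective_on setT (shift T m)].
  move=> l'0 hl' e'0; have [d d0 hd'] := riesz_surjective_near bT sN cN TN rN l'0.
  pose m := Num.min (Num.min d e') (r - nm l').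
  have m0 : 0 < m by rewrite !lt_min d0 e'0 subr_gt0.
  have md : m <= d by rewrite /m !ge_min lexx.
  have me : m <= e' by rewrite /m !ge_min lexx orbT.
  have mr : m <= r - nm l' by rewrite /m !ge_min lexx !orbT.
  have m20 : 0 < m / 2 by lra.
  have nE : nm (l' + ((m / 2)%:C)%C - l') = m / 2 by rewrite addrAC subrr add0r nmR gtr0_norm.
  have hmr : nm (l' + ((m / 2)%:C)%C) < r.
    by apply: le_lt_trans (nmD _ _) _; rewrite nmR gtr0_norm //; lra.
  exists (l' + ((m / 2)%:C)%C); rewrite nE; split=> //; first by lra.
  apply: (@surjective_sum _ _ _ M N); [by have [] := shift_bop (l' + ((m / 2)%:C)%C) bT|exact: (proj2 dMN)| |].
    by apply: hr => //; right.
  apply: hd'; last by rewrite nE; lra.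
  by rewrite -subr_eq0 addrAC subrr add0r posn0.
(* The Riesz part gives no information at 0; that point is first moved to a small positive [s]. *)
have [l0|l0] := eqVneq l 0; last exact: step.
pose s := Num.min (e / 2) (r / 2).
have s0 : 0 < s by rewrite lt_min !divr_gt0.
have se : s <= e / 2 by rewrite /s ge_min lexx.
have sr : s <= r / 2 by rewrite /s ge_min lexx orbT.
have ns : nm (s%:C)%C = s by rewrite nmR gtr0_norm.
have e2 : 0 < e / 2 by lra.
have [||m [h1 h2 h3]] := step (s%:C)%C (e / 2) (posn0 _ s0); rewrite ?ns //; first by lra.
exists m; split=> //; rewrite l0 subr0.
by have := nmD (m - (s%:C)%C) (s%:C)%C; rewrite subrK ns; lra.
Qed.

Lemma surjective_plus_riesz_int T : bop T -> surjective_plus_riesz T ->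
  ~ int_pt (sigma_su T) 0.
Proof.
move=> bT h; have [r r0 hr] := surjective_plus_riesz_dense bT h.
move=> [e /posC [e' e0 ->] he].
have [|m [h1 h2 h3]] := hr 0 e' _ e0; first by rewrite nm0.
by apply: (he m) => //; rewrite nm_lt.
Qed.

Lemma analytic_cdiff (r : R) (f : R[i] -> X -> R[i]) x z : dual_analytic_on 0 (r%:C)%C f ->
  nm z < r -> cdiff (fun l => f l x) z.
Proof.
move=> [_ fa] hz; have [|g [_ hg]] := fa z; first by rewrite subr0 nm_lt.
exists (g x) => e e0; have n0 : 0 < nm x + 1 by have := nm_ge0 x; lra.
have [|d /posC [d' d0 ->] hd] := hg ((e / (nm x + 1))%:C)%C.
  by rewrite -(rmorph0 (real_complex R)) ltcR divr_gt0.
exists (Num.min d' (r - nm z)); first by rewrite lt_min d0 subr_gt0.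
move=> v; rewrite lt_min => /andP [h1 h2].
have := hd v; rewrite subr0 !nm_lt => /(_ _ h1 x).
rewrite !nmE -!rmorphM lecR => h3; rewrite mulrC; apply: le_trans (h3 _) _.
  by have := nmD (v - z) z; rewrite subrK; lra.
rewrite mulrAC; apply: ler_wpM2r; first exact: nm_ge0.
rewrite mulrAC ler_pdivrMr // ler_pM2l //; lra.
Qed.

(** Where [T - m] is surjective, a functional annihilating its range is zero. Density and continuity
    extend this to a small disc, and the identity theorem, applied for each fixed [x], to the whole
    disc. *)
Lemma surjective_plus_riesz_SVEP T : bop T -> surjective_plus_riesz T ->
  adjoint_SVEP_at T 0.
Proof.
move=> bT h r /posC [r' r0 ->] f fa fT.
have [s s0 hs] := surjective_plus_riesz_dense bT h.
have zero l x : nm l < Num.min s r' -> f l x = 0.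
  rewrite lt_min => /andP [ls lr]; apply: nm_eq0; apply/eqP; rewrite eq_le nm_ge0 andbT.
  apply: le_all_eps => e e0; rewrite add0r.
  have [d d0 hd] := analytic_continuous x fa lr e0.
  have m0 : 0 < Num.min d (r' - nm l) by rewrite lt_min d0 subr_gt0.
  have [m [h1 h2 h3]] := hs l _ ls m0.
  move: h1; rewrite lt_min => /andP [h1 h4].
  have hm : nm m < r' by have := nmD (m - l) l; rewrite subrK; lra.
  have fm0 : f m x = 0.
    have [y _ <-] : (shift T m @` setT) x by rewrite h3.
    have [|fl _] := (proj1 fa) m; first by rewrite subr0 nm_lt.
    rewrite /shift (dlinB _ _ fl) (dlinZ _ _ fl); apply: fT.
    by rewrite subr0 nm_lt.
  by have := hd m hm h1; rewrite fm0 sub0r nmN => /ltW.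
move=> l; rewrite subr0 nm_lt => hl x.
apply: (@identity_theorem _ (fun l => f l x) r' (Num.min s r')) hl.
- by rewrite lt_min s0.
- by move=> z hz; exact: analytic_cdiff fa hz.
- by move=> z hz; exact: zero.
Qed.

(** The eigen family satisfies its equation only on [M]. Composition with the projection onto [M]
    along [N], which commutes with [T], gives eigenfunctionals of the adjoint on all of [X], still
    analytic and nonzero at 0. *)
Lemma GKRD_SVEP T : bop T -> GKRD T -> adjoint_SVEP_at T 0 -> surjective_plus_riesz T.
Proof.
move=> bT [M [N [hMN [kM rN]]]] svep; exists M, N; split=> //; split=> //.
have [[sM sN] [cM cN] TM TN dMN] := hMN; have [lT _] := bT.
apply: contrapT => nsur.
have [r [f [m0 [r0 [fd fa] fe Mm0 fm0]]]] := kato_eigen_family bT sM cM TM kM nsur.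
have [P [[lP [K K0 hK]] NP MP [PN PM PT]]] := reducing_projection bT hMN.
pose Q x := x - P x.
have QB x : nm (Q x) <= (1 + K) * nm x.
  by apply: le_trans (nmB _ _) _; rewrite mulrDl mul1r lerD2l.
have lQ (a : R[i]) x y : Q (a *: x + y) = a *: Q x + Q y by rewrite /Q lP; lmod R[i].
have dQ g : dual_elt g -> dual_elt (fun x => g (Q x)).
  move=> [gl [B B0 hB]]; split; first by move=> a x y; rewrite lQ gl.
  have K1 : 0 <= 1 + K by lra.
  exists (B * ((1 + K)%:C)%C).
    by rewrite mulr_ge0 // -(rmorph0 (real_complex R)) lecR.
  move=> x; apply: le_trans (hB _) _; rewrite -mulrA; apply: ler_wpM2l => //.
  by rewrite !nmE -rmorphM lecR.
apply/negP: fm0; rewrite negbK; apply/eqP.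
have -> : m0 = Q m0 by rewrite /Q PM // subr0.
apply: (svep (r%:C)%C _ (fun l x => f l (Q x))).
- by rewrite -(rmorph0 (real_complex R)) ltcR.
- split; first by move=> l /fd; exact: dQ.
  move=> l hl; have [g [dg hg]] := fa l hl; exists (fun x => g (Q x)); split; first exact: dQ.
  move=> e /posC [e' e0 ->]; have K1 : 0 < 1 + K by lra.
  have [|d d0 hd] := hg ((e' / (1 + K))%:C)%C.
    by rewrite -(rmorph0 (real_complex R)) ltcR divr_gt0.
  exists d => // m hm md x; apply: le_trans (hd m hm md (Q x)) _.
  rewrite !nmE -!rmorphM lecR.
  apply: le_trans (ler_wpM2l _ (QB x)) _.
    by rewrite mulr_ge0 ?nm_ge0 // divr_ge0 // ltW.
  by rewrite le_eqVlt; apply/orP; left; apply/eqP; field; rewrite lt0r_neq0.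
- move=> l; rewrite subr0 nm_lt => hl x.
  have -> : Q (T x) = T (Q x) by rewrite /Q PT (linB lT).
  by rewrite fe ?subrr //; exact: MP.
- by rewrite subrr normr0 -(rmorph0 (real_complex R)) ltcR.
Qed.

(** [P] is the projection onto [N] along [M]. Then [T + P] is [T] on [M] and [T - (-1)] on [N], a
    nonzero shift of a Riesz operator, while [T P] is 0 on [M] and [T] on [N]. *)
Lemma surjective_plus_riesz_projection T : bop T -> surjective_plus_riesz T ->
  exists P : X -> X, [/\ bounded_op P, (forall x, P (P x) = P x),
    (forall x, P (T x) = T (P x)),
    lower_semi_browder_on setT (fun x => T x + P x) &
    riesz_on setT (fun x => T (P x))].
Proof.
move=> bT [M [N [hMN [surM rN]]]].
have [[sM sN] [cM cN] TM TN dMN] := hMN; have [lT _] := bT.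
have [P [bP NP MP [PN PM PT]]] := reducing_projection bT hMN; have [lP _] := bP.
exists P; split=> //.
- exact/bopP.
- by move=> x; apply: PN.
- have TPM x : M x -> T x + P x = T x by move=> Mx; rewrite PM // addr0.
  have TPN x : N x -> T x + P x = shift T (-1) x.
    by move=> Nx; rewrite PN // /shift; lmod R[i].
  have invM : (fun x => T x + P x) @` M `<=` M.
    by move=> _ [x Mx <-]; rewrite TPM //; apply: TM; exists x.
  have invN : (fun x => T x + P x) @` N `<=` N.
    by move=> _ [x Nx <-]; apply: subD => //; apply: TN; exists x.
  apply: (@lower_semi_browder_sum _ _ _ M N) => //.
  + by move=> a x y; rewrite lT lP; lmod R[i].
  + exact: (proj2 dMN).
  + apply: lower_semi_browder_eq TPM _ => //.
    exact: surjective_lower_semi_browder.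
  + apply: lower_semi_browder_eq TPN _ => //.
    have n0 : -1 != 0 :> R[i] by rewrite oppr_eq0 oner_neq0.
    by split; [have [] := rN _ n0|exact: riesz_descent].
- move=> l l0; have [[s hs] [t ht]] := rN l l0; split.
    exists s => x [_]; rewrite /shift => /eqP; rewrite subr_eq0 => /eqP h.
    have Nx : N x.
      have -> : x = l^-1 *: T (P x) by rewrite h scalerA mulVf // scale1r.
      by apply: subZ => //; apply: TN; exists (P x) => //; exact: NP.
    by apply: hs; split=> //; rewrite /shift -h PN // subrr.
  exists t => x _; have [_ [v [[n Nn <-] tv e]]] := ht _ (NP x).
  pose m := x - P x; have Mm : M m by exact: MP.
  (* On [M] the shifted operator is multiplication by [-l], so the [M]-part of [x] has the exact
     preimage -m/l. *)
  exists (shift (fun x => T (P x)) l (n - l^-1 *: m)), v; split=> //.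
  have -> : x = m + P x by rewrite /m subrK.
  rewrite e /shift (linB lP) (linZ lP) (PM _ Mm) (PN _ Nn) scaler0 subr0.
  by lmod_split R[i]; field.
Qed.

(** With [M] the kernel and [N] the range of [P], [T + P] equals [T] on [M] and [T P] equals [T] on
    [N]. Both properties restrict to these subspaces, and the first is then improved to surjectivity
    by [lower_semi_browder_split]. *)
Lemma projection_surjective_plus_riesz T (P : X -> X) : bop T -> bop P ->
  (forall x, P (P x) = P x) -> (forall x, P (T x) = T (P x)) ->
  lower_semi_browder_on setT (fun x => T x + P x) ->
  riesz_on setT (fun x => T (P x)) -> surjective_plus_riesz T.
Proof.
move=> bT bP PP PT lsb rTP; have [lT _] := bT; have [lP _] := bP.
pose M := [set x | setT x /\ P x = 0].
have sM : subspace M by exact: sub_ker lP sub_setT.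
have cM : closed M by apply: closed_ker => //; exact: closedT.
pose I x := x - P x.
have bI : bop I.
  have := shift_bop 1 bP => -[ls [K K0 hK]]; split.
    by move=> a x y; rewrite /I lP; lmod R[i].
  exists K => // x; have := hK x; rewrite /shift scale1r /I; rewrite nmBC //.
pose N := [set x | setT x /\ I x = 0].
have [lI _] := bI.
have sN : subspace N by exact: sub_ker lI sub_setT.
have cN : closed N by apply: closed_ker => //; exact: closedT.
have NP x : N x -> P x = x by move=> [_ /eqP]; rewrite subr_eq0 => /eqP.
have PN x : N (P x) by split=> //; rewrite /I PP subrr.
have MI x : M (I x) by split=> //; rewrite /I (linB lP) PP subrr.
have TM : T @` M `<=` M by move=> _ [x [_ Px] <-]; split=> //; rewrite PT Px lin0.
have TN : T @` N `<=` N by move=> _ [x Nx <-]; split=> //; rewrite /I PT NP // subrr.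
have dMN : direct_sum M N.
  split; last by move=> x; exists (I x), (P x); rewrite subrK.
  rewrite eqEsubset; split=> x; last by move=> ->; split; [case: sM|case: sN].
  by move=> [[_ Px] /NP]; rewrite Px => <-.
have TPM x : M x -> T x = T x + P x by move=> [_ ->]; rewrite addr0.
have lTP : lin (fun x => T x + P x) by move=> a x y; rewrite lT lP; lmod R[i].
have invN : (fun x => T x + P x) @` N `<=` N.
  by move=> _ [x Nx <-]; apply: subD => //; apply: TN; exists x.
have invM : (fun x => T x + P x) @` M `<=` M.
  by move=> _ [x Mx <-]; rewrite -TPM //; apply: TM; exists x.
apply: (@lower_semi_browder_split _ _ T M N) => //.
- apply: lower_semi_browder_eq TPM _ => //.
  have [[s hs] [d hd]] := lsb; split; last first.
    by exists d; exact: (descent_restrict lTP sM sN dMN invM invN hd).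
  (* [I] commutes with [T + P], so the images under [I] of vectors complementing the range in [X]
     complement it in [M]. *)
  exists (map I s) => x Mx; have [_ [v [[y _ <-] sv e]]] := hs x Logic.I.
  exists (T (I y) + P (I y)), (I v); split.
  + by exists (I y); [exact: MI|].
  + by apply: (span_map lI); exists v.
  + have Ix : I x = x by case: Mx => _ Px; rewrite /I Px subr0.
    rewrite -{1}Ix e (linD lI); congr (_ + _).
    by rewrite /I (linD lP) PT PP (linB lT) (linB lP) PP; lmod R[i].
- move=> l l0; have [[s hs] [t ht]] := rTP l l0; split.
    exists s => x [Nx h]; apply: hs; split=> //.
    by move: h; rewrite /shift NP.
  exists (map P t) => x Nx; have [_ [v [[y _ <-] tv e]]] := ht x Logic.I.
  exists (shift T l (P y)), (P v); split.
  + by exists (P y); [exact: PN|].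
  + by apply: (span_map lP); exists v.
  + rewrite -{1}(NP _ Nx) e (linD lP); congr (_ + _).
    by rewrite /shift (linB lP) (linZ lP) PT PP.
Qed.

End Equivalences.

Theorem theorem2p8 (R : realType) (X : completeNormedModType R[i]) (T : X -> X) :
  infinite_dimensional (X := X) -> bounded_op T ->
  let i1 := exists M N, reducing_pair T M N /\ surjective_on M T /\ riesz_on N T in
  let i2 := GKRD T /\ ~ int_pt (sigma_su T) 0 in
  let i3 := GKRD T /\ adjoint_SVEP_at T 0 in
  let i4 := exists M N, reducing_pair T M N /\
              lower_semi_browder_on M T /\ riesz_on N T in
  let i5 := GKRD T /\ ~ acc_pt (sigma_lsB T) 0 in
  let i6 := GKRD T /\ ~ int_pt (sigma_lsB T) 0 in
  let i7 := exists P : X -> X, [/\ bounded_op P, (forall x, P (P x) = P x),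
              (forall x, P (T x) = T (P x)),
              lower_semi_browder_on setT (fun x => T x + P x) &
              riesz_on setT (fun x => T (P x))] in
  [/\ (i1 <-> i2), (i1 <-> i3), (i1 <-> i4), (i1 <-> i5) &
      ((i1 <-> i6) /\ (i1 <-> i7))].
Proof.
move=> _ /bopP bT i1 i2 i3 i4 i5 i6 i7.
have gk : i1 -> GKRD T := @surjective_plus_riesz_GKRD _ _ T.
have i61 : i6 -> i1 by move=> [g nint]; exact: GKRD_int_lsB.
have i15 : i1 -> i5 by move=> h; split; [exact: gk|exact: surjective_plus_riesz_acc].
have i56 : i5 -> i6 by move=> [g h]; split=> //; exact: not_acc_not_int.
split.
- split=> [h|[g nint]]; first by split; [exact: gk|exact: surjective_plus_riesz_int].
  (* A disc inside [sigma_lsB T] is also inside [sigma_su T], which reduces (ii) to (vi). *)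
  apply: i61; split=> // -[e e0 he]; apply: nint; exists e => // w /he.
  exact: sigma_lsB_su.
- split=> [h|[g svep]]; last exact: GKRD_SVEP.
  by split; [exact: gk|exact: surjective_plus_riesz_SVEP].
- split=> [[M [N [hMN [sM rN]]]]|[M [N [hMN [lM rN]]]]].
    by exists M, N; split=> //; split=> //; exact: surjective_lower_semi_browder.
  exact: lower_semi_browder_split lM rN.
- by split=> // /i56.
- split; first by split=> // /i15.
  split; first exact: surjective_plus_riesz_projection.
  by move=> [P [/bopP bP PP PT lsb rTP]]; exact: projection_surjective_plus_riesz rTP.
Qed.
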